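(* Let $(M,F)$ be a Finsler manifold. The set of Mobius transformations of $(M,F)$ is a subgroup of the group of conformal transformations of $(M,F)$ (under composition), and it contains the group of homotheties of $(M,F)$.
   Context: Finsler manifold: $M$ is a connected smooth $n$-dimensional manifold, $TM_0$ the bundle of nonzero tangent vectors, $\pi:TM_0\to M$ the projection, $\pi^*TM$ the pull-back bundle. A Finsler structure is $F:TM\to[0,\infty)$, smooth on $TM_0$, with $F(x,\lambda y)=\lambda F(x,y)$ for all $\lambda>0$, and $g_{ij}(x,y)=\frac12\frac{\partial^2F^2}{\partial y^i\partial y^j}$ positive definite on $TM_0$; $g$ is an inner product on $\pi^*TM$, with inverse $g^{ij}$. Cartan connection: $G^i=\frac14 g^{il}\{[F^2]_{x^ky^l}y^k-[F^2]_{x^l}\}$, $G^j_i=\partial G^j/\partial y^i$, $\delta_i=\frac{\delta}{\delta x^i}=\frac{\partial}{\partial x^i}-G^j_i\frac{\partial}{\partial y^j}$, $\Gamma^i_{jk}=\frac12g^{il}(\delta_jg_{lk}+\delta_kg_{jl}-\delta_lg_{jk})$, $C^i_{jk}=\frac12g^{il}\frac{\partial g_{jk}}{\partial y^l}$. The Cartan connection ${}^c\nabla$ is the linear connection on $\pi^*TM$ with ${}^c\nabla_{\delta_k}\frac{\partial}{\partial x^j}=\Gamma^i_{jk}\frac{\partial}{\partial x^i}$ and ${}^c\nabla_{\partial/\partial y^k}\frac{\partial}{\partial x^j}=C^i_{jk}\frac{\partial}{\partial x^i}$. The map $\varrho=\pi_*:TTM_0\to\pi^*TM$ sends $\delta_i\mapsto\frac{\partial}{\partial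 x^i}$, $\frac{\partial}{\partial y^i}\mapsto0$. For $\varphi\in C^\infty(M)$ with $\varphi_i=\partial\varphi/\partial x^i$: $\nabla\varphi=g^{ij}(x,y)\varphi_j\frac{\partial}{\partial x^i}\in\Gamma(\pi^*TM)$, $\|\mathrm{grad}\,\varphi\|^2=g^{ij}\varphi_i\varphi_j$, and $\Delta\varphi=g^{ij}\big(\frac{\partial^2\varphi}{\partial x^i\partial x^j}-(\Gamma^k_{ij}+C^k_{ij})\varphi_k\big)$ (the sum of the horizontal and vertical Laplacians). Conformal maps: a diffeomorphism $f:(M,F)\to(M,\bar F)$ between Finsler structures on $M$ is conformal if $f^*\bar F=e^{\varphi}F$ for some smooth $\varphi:M\to\mathbb R$, where $(f^*\bar F)(x,y)=\bar F(f(x),df_x(y))$; it is homothetic if $\varphi$ is constant. Its Schwarzian derivative is the linear map $S_F(f):\Gamma(TTM_0)\to\Gamma(\pi^*TM)$ on vector fields $\hat X$ on $TM_0$, $$S_F(f)\hat X={}^c\nabla_{\hat X}(\nabla\varphi)-g(\nabla\varphi,\varrho\hat X)\nabla\varphi-\tfrac1n\big(\Delta\varphi-\|\mathrm{grad}\,\varphi\|^2\big)\varrho\hat X .$$ The conformal map $f$ is a Mobius mapping if $S_F(f)=0$, i.e. $S_F(f)\hat X=0$ for all $\hat X$. A conformal transformation of $(M,F)$ is a diffeomorphism $f:M\to M$ with $f^*F=e^{\varphi}F$ for some smooth $\varphi:M\to\mathbb R$, where $(f^*F)(x,y)=F(f(x),df_x(y))$. It is a homothetic transformation (homothety) of $(M,F)$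 if this $\varphi$ is constant, and a Mobius transformation of $(M,F)$ if $S_F(f)=0$, where $S_F(f)$ is computed with this $\varphi$. *)

(* Defs.v *)
From HB Require Import structures.
From mathcomp Require Import all_boot all_order all_algebra.
From mathcomp Require Import all_classical all_reals all_analysis.

Set Implicit Arguments.
Unset Strict Implicit.
Unset Printing Implicit Defensive.

Import Order.TTheory GRing.Theory Num.Theory.
Import numFieldNormedType.Exports.

Local Open Scope classical_set_scope.
Local Open Scope ring_scope.

(* C^infinity on an open set U of a finite-dimensional space: every iterated  *)
(* directional derivative of f (including f itself) is Frechet differentiable *)
(* at every point of U.                                                       *)
Definition smooth_on (R : realType) (V W : normedModType R) (U : set V)
    (f : V -> W) : Prop :=
  forall (s : seq V) (x : V), U x ->
    differentiable (foldr (fun v g => 'D_v g) f s) x.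

(* -------------------------------------------------------------------------- *)
(* Smooth manifolds                                                           *)
(* -------------------------------------------------------------------------- *)

(* coords is only meaningful on source, and its inverse param on target. *)
Record chart (R : realType) (n : nat) (M : topologicalType) := Chart {
  source : set M;
  target : set 'rV[R]_n;
  coords : M -> 'rV[R]_n;
  param : 'rV[R]_n -> M;
  source_open : open source;
  target_open : open target;
  coords_target : forall p, source p -> target (coords p);
  param_source : forall x, target x -> source (param x);
  coordsK : {in source, cancel coords param};
  paramK : {in target, cancel param coords};
  coords_continuous : {in source, continuous coords};
  param_continuous : {in target, continuous param}
}.

Definition transition (R : realType) (n : nat) (M : topologicalType)
    (c c' : chart R n M) : 'rV[R]_n -> 'rV[R]_n :=
  coords c' \o param c.

Record manifold (R : realType) (n : nat) (M : topologicalType) := Manifold {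
  atlas : set (chart R n M);
  chart_at : M -> chart R n M;
  manifold_hausdorff : hausdorff_space M;
  manifold_second_countable : @second_countable M;
  manifold_connected : connected [set: M];
  chart_at_atlas : forall p, atlas (chart_at p);
  chart_at_source : forall p, source (chart_at p) p;
  transition_smooth : forall c c', atlas c -> atlas c' ->
    smooth_on (target c `&` param c @^-1` source c') (transition c c')
}.

Section SmoothMaps.
Context {R : realType} {n : nat} {M : topologicalType} (S : manifold R n M).

Definition smooth_fun (phi : M -> R) : Prop :=
  forall c, atlas S c -> smooth_on (W := R^o) (target c) (phi \o param c).

Definition smooth_map (f : M -> M) : Prop :=
  continuous f /\
  forall c c', atlas S c -> atlas S c' ->
    smooth_on (target c `&` (f \o param c) @^-1` source c')
      (coords c' \o f \o param c).

(* The tangent space T_pM is 'rV[R]_n: a tangent vector at p is represented   *)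
(* by its components in the preferred chart chart_at S p.  Its components in  *)
(* another chart c around p are obtained with the Jacobian of the transition  *)
(* from chart_at S p to c.  Below, (x, y) in 'rV[R]_n * 'rV[R]_n stands for   *)
(* the vector y^i d/dx^i at the point with coordinates x, in a given chart.   *)
Local Notation E := ('rV[R]_n * 'rV[R]_n)%type.

(* df_p : T_pM -> T_{f p}M *)
Definition tangent_map (f : M -> M) (p : M) (v : 'rV[R]_n) : 'rV[R]_n :=
  'D_v (coords (chart_at S (f p)) \o f \o param (chart_at S p))
    (coords (chart_at S p) p).

(* the change of coordinates of TM induced by a change of charts of M *)
Definition ttransition (c c' : chart R n M) (z : E) : E :=
  (transition c c' z.1, 'D_(z.2) (transition c c') z.1).

(* the part of TM_0 over a chart, in coordinates *)
Definition slit (c : chart R n M) : set E :=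
  [set z | target c z.1 /\ z.2 != 0].

(* the expression (x, y) |-> F(x, y) in the chart c of a function F on TM *)
Definition local_fun (F : M -> 'rV[R]_n -> R) (c : chart R n M) (z : E) : R^o :=
  let p := param c z.1 in F p (ttransition c (chart_at S p) z).2.

(* A vector field on TM_0 assigns to (p, v), v != 0, a pair (a, b), which     *)
(* represents a^i d/dx^i + b^i d/dy^i in the coordinates (x, y) of TM induced *)
(* by chart_at S p.  local_field X c gives the components of X in the         *)
(* coordinates (x, y) induced by the chart c.                                 *)
Definition local_field (X : M -> 'rV[R]_n -> E) (c : chart R n M) (z : E) : E :=
  let q := chart_at S (param c z.1) in
  let w := ttransition c q z in
  'D_(X (param c z.1) w.2) (ttransition q c) w.

Definition smooth_field (X : M -> 'rV[R]_n -> E) : Prop :=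
  forall c, atlas S c -> smooth_on (slit c) (local_field X c).

End SmoothMaps.

(* -------------------------------------------------------------------------- *)
(* Finsler geometry in the coordinates (x, y); L is the expression of F and   *)
(* phi : 'rV_n -> R that of a function on M.                                  *)
(* -------------------------------------------------------------------------- *)

Section LocalGeometry.
Context {R : realType} {n : nat}.
Local Notation E := ('rV[R]_n * 'rV[R]_n)%type.
Implicit Types (i j k l : 'I_n) (z : E) (f : E -> R^o).

Definition basis_vec i : 'rV[R]_n := delta_mx 0 i.

Definition dx i f : E -> R^o := 'D_((basis_vec i, 0) : E) f.
Definition dy i f : E -> R^o := 'D_((0, basis_vec i) : E) f.

Variable L : E -> R^o.

Definition energy : E -> R^o := fun z => L z ^+ 2.

(* g_{ij} and g^{ij} *)
Definition gmx z : 'M[R]_n := \matrix_(i, j) (2^-1 * dy i (dy j energy) z).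
Definition glow i j : E -> R^o := fun z => gmx z i j.
Definition ginv i j : E -> R^o := fun z => invmx (gmx z) i j.

(* G^i *)
Definition spray i : E -> R^o := fun z =>
  4^-1 * \sum_l ginv i l z *
    (\sum_k dy l (dx k energy) z * z.2 0 k - dx l energy z).

(* nonlin j i is G^j_i *)
Definition nonlin j i : E -> R^o := dy i (spray j).

(* delta / delta x^i *)
Definition delta i f : E -> R^o := fun z =>
  dx i f z - \sum_j nonlin j i z * dy j f z.

(* Gamma i j k is Gamma^i_{jk}, Cart i j k is C^i_{jk} *)
Definition Gamma i j k : E -> R^o := fun z =>
  2^-1 * \sum_l ginv i l z *
    (delta j (glow l k) z + delta k (glow j l) z - delta l (glow j k) z).
Definition Cart i j k : E -> R^o := fun z =>
  2^-1 * \sum_l ginv i l z * dy l (glow j k) z.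

(* components on delta_k and d/dy^k of a^k d/dx^k + b^k d/dy^k, where         *)
(* xi = (a, b) and d/dx^k = delta_k + G^l_k d/dy^l                            *)
Definition hor (xi : E) : 'rV[R]_n := xi.1.
Definition ver z (xi : E) : 'rV[R]_n :=
  \row_k (xi.2 0 k + \sum_l nonlin k l z * xi.1 0 l).

(* the Cartan covariant derivative at z, in the direction xi, of the section  *)
(* s^i d/dx^i of pi^*TM                                                       *)
Definition cartan (s : E -> 'rV[R]_n) (xi : E) z : 'rV[R]_n :=
  \row_i ('D_xi (fun z' => s z' 0 i : R^o) z +
    \sum_j \sum_k s z 0 j *
      (Gamma i j k z * hor xi 0 k + Cart i j k z * ver z xi 0 k)).

Definition inner z (u w : 'rV[R]_n) : R :=
  \sum_i \sum_j glow i j z * u 0 i * w 0 j.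

Variable phi : 'rV[R]_n -> R^o.

Definition dphi i z : R := 'D_(basis_vec i) phi z.1.
Definition ddphi i j z : R := 'D_(basis_vec i) ('D_(basis_vec j) phi) z.1.

Definition grad z : 'rV[R]_n := \row_i \sum_j ginv i j z * dphi j z.

Definition grad_sqnorm z : R := \sum_i \sum_j ginv i j z * dphi i z * dphi j z.

Definition laplacian z : R :=
  \sum_i \sum_j ginv i j z *
    (ddphi i j z - \sum_k (Gamma k i j z + Cart k i j z) * dphi k z).

(* the Schwarzian derivative, applied to the vector xi at z *)
Definition local_schwarzian (xi : E) z : 'rV[R]_n :=
  cartan grad xi z - inner z (grad z) (hor xi) *: grad z
  - (n%:R^-1 * (laplacian z - grad_sqnorm z)) *: hor xi.

End LocalGeometry.

(* -------------------------------------------------------------------------- *)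
(* Finsler structures and their conformal transformations                     *)
(* -------------------------------------------------------------------------- *)

Record finsler (R : realType) (n : nat) (M : topologicalType)
    (S : manifold R n M) := Finsler {
  finsler_fun :> M -> 'rV[R]_n -> R;
  finsler_ge0 : forall p v, 0 <= finsler_fun p v;
  finsler_smooth : forall c, atlas S c ->
    smooth_on (slit c) (local_fun S finsler_fun c);
  finsler_homogeneous : forall p v (a : R), 0 < a ->
    finsler_fun p (a *: v) = a * finsler_fun p v;
  finsler_convex : forall c z, atlas S c -> slit c z ->
    forall u : 'rV[R]_n, u != 0 ->
      0 < inner (local_fun S finsler_fun c) z u u
}.

(* The group (under composition) of bijections of M onto itself; the groups   *)
(* of transformations of M are considered as subgroups of it.                 *)
Record selfbij (M : Type) := SelfBij {
  fwd :> M -> M;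
  bwd : M -> M;
  fwdK : cancel fwd bwd;
  bwdK : cancel bwd fwd
}.

Section SelfBijGroup.
Context {M : Type}.

Lemma selfbijP (f g : selfbij M) : fwd f =1 fwd g -> f = g.
Proof.
case: f g => [f f' fK f'K] [g g' gK g'K] /= /funext fg.
subst g; have fg' : f' = g' by apply/funext => x; rewrite -{1}[x]g'K fK.
by subst g'; congr SelfBij; apply: Prop_irrelevance.
Qed.

Definition selfbij_one : selfbij M :=
  @SelfBij M id id (fun _ => erefl) (fun _ => erefl).
Definition selfbij_inv (f : selfbij M) : selfbij M := SelfBij (bwdK f) (fwdK f).
Definition selfbij_mul (f g : selfbij M) : selfbij M :=
  @SelfBij M (fwd f \o fwd g) (bwd g \o bwd f)
    (can_comp (fwdK f) (fwdK g)) (can_comp (bwdK g) (bwdK f)).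

Lemma selfbij_mulA : associative selfbij_mul.
Proof. by move=> f g h; apply: selfbijP. Qed.
Lemma selfbij_mul1 : left_id selfbij_one selfbij_mul.
Proof. by move=> f; apply: selfbijP. Qed.
Lemma selfbij_mulr1 : right_id selfbij_one selfbij_mul.
Proof. by move=> f; apply: selfbijP. Qed.
Lemma selfbij_mulV : left_inverse selfbij_one selfbij_inv selfbij_mul.
Proof. by move=> f; apply: selfbijP => x /=; rewrite fwdK. Qed.
Lemma selfbij_mulrV : right_inverse selfbij_one selfbij_inv selfbij_mul.
Proof. by move=> f; apply: selfbijP => x /=; rewrite bwdK. Qed.

HB.instance Definition _ := gen_eqMixin (selfbij M).
HB.instance Definition _ := gen_choiceMixin (selfbij M).
HB.instance Definition _ := isGroup.Build (selfbij M)
  selfbij_mulA selfbij_mul1 selfbij_mulr1 selfbij_mulV selfbij_mulrV.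

End SelfBijGroup.

Section Transformations.
Context {R : realType} {n : nat} {M : topologicalType} {S : manifold R n M}.
Variable F : finsler S.

Definition diffeomorphism (f : selfbij M) : Prop :=
  smooth_map S (fwd f) /\ smooth_map S (bwd f).

(* f is a conformal transformation with f^*F = e^phi F *)
Definition conformal_with (f : selfbij M) (phi : M -> R) : Prop :=
  [/\ diffeomorphism f,
      smooth_fun S phi &
      forall p v, F (f p) (tangent_map S f p v) = expR (phi p) * F p v].

(* The components, in the chart c, of the section S_F(f)X of pi^*TM, where    *)
(* phi is the conformal exponent of f.                                        *)
Definition schwarzian (phi : M -> R) (X : M -> 'rV[R]_n -> 'rV[R]_n * 'rV[R]_n)
    (c : chart R n M) (z : 'rV[R]_n * 'rV[R]_n) : 'rV[R]_n :=
  local_schwarzian (local_fun S F c) (phi \o param c) (local_field S X c z) z.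

Definition schwarzian_eq0 (phi : M -> R) : Prop :=
  forall X, smooth_field S X ->
  forall c z, atlas S c -> slit c z -> schwarzian phi X c z = 0.

Definition conformal_transformations : {pred selfbij M} :=
  [pred f | `[< exists phi, conformal_with f phi >]].

Definition mobius_transformations : {pred selfbij M} :=
  [pred f | `[< exists2 phi, conformal_with f phi & schwarzian_eq0 phi >]].

Definition homotheties : {pred selfbij M} :=
  [pred f | `[< exists2 phi, conformal_with f phi &
                  forall p q, phi p = phi q >]].

End Transformations.

(* Main.v *)
(* Let psi be a function on M, put V = grad psi and E = F^2.  The Schwarzian of psi vanishes if
   and only if, on TM_0, V does not depend on y, dE(0, V) = 2 dpsi(y), and the complete lift V^c
   of V satisfies V^c E = 2 dpsi(y)^2 + 2 lambda E with lambda independent of y.  Indeed, the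
   vertical part of the equation says that V does not depend on y (hence is annihilated by the
   Cartan tensor), and contracting its horizontal part with y gives the last identity.
   Conversely, differentiating that identity twice in y recovers the horizontal part: the
   nonlinear connection only enters through its value on V, which differs from - D_y V by a
   combination of V and y, and the Cartan tensor annihilates both.

   In this form the equation involves neither a connection nor g^{-1}, so that it is clearly
   preserved by diffeomorphisms.  If phi and chi solve it for F, then chi - phi solves it for
   e^phi F; constants always solve it.  With the cocycle rules for the exponents of composites
   and inverses of conformal maps, this gives the theorem. *)

From HB Require Import structures.
Require Import Defs.
From mathcomp Require Import all_boot all_order all_algebra.
From mathcomp Require Import all_classical all_reals all_analysis.
From mathcomp Require Import ring lra.

Set Implicit Arguments.
Unset Strict Implicit.
Unset Printing Implicit Defensive.

Import Order.TTheory GRing.Theory Num.Theory.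
Import numFieldNormedType.Exports.

Local Open Scope classical_set_scope.
Local Open Scope ring_scope.

(** * Smooth germs *)

(** Working with the Schwarzian directly would require the transformation laws of the nonlinear
    connection, of Gamma and of g^{-1}, both under diffeomorphisms and under conformal factors. The
    reformulation replaces them by two witnesses, V and lambda, constrained only through derivatives
    of F^2 and psi. Here lambda is the scalar (Delta psi - |grad psi|^2)/n of the Schwarzian. That
    it is independent of y is a consequence of the equation: the contraction with y and its own
    second contraction can be compared, and the difference is F^2 times a vertical derivative of
    lambda. In the converse direction lambda is an arbitrary witness, and it has to be identified
    with that scalar by taking the trace of the Hessian equation. Two obstacles shape the rest.
    Charts give the equations on open sets only, and the arguments keep differentiating identities,
    so calculus is done on germs. Moreover the Schwarzian is tested on global smooth fields of TM_0,
    so that a pointwise statement requires extending a single vector by means of a bump function. *)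

Section DirectionalDerivatives.
Context {R : realType}.
Implicit Types V W Z : normedModType R.

Lemma near_eq_differentiable V W (f g : V -> W) (x : V) :
  (\near x, f x = g x) -> differentiable f x -> differentiable g x.
Proof.
move=> fg /diff_locallyP[dfc dfE].
have fgx : f x = g x by exact: nbhs_singleton fg.
have gE : g \o shift x = cst (g x) + 'd f x +o_ 0 id.
  apply/eqaddoP => _/posnumP[eps].
  have /eqaddoP/(_ eps%:num) := dfE; move=> /(_ (gt0 eps)) h.
  have fg0 : \forall y \near (0 : V), f (y + x) = g (y + x).
    by move: fg; rewrite (near_shift 0 x); apply: filterS => y /=; rewrite subr0.
  near=> y.
  have -> : (g \o shift x - (cst (g x) + 'd f x)) y =
      (f \o shift x - (cst (f x) + 'd f x)) y.
    by rewrite -fgx; congr (_ - _); rewrite /= (near fg0 y).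
  by near: y.
have dgE := diff_unique dfc gE.
by apply/diff_locallyP; rewrite dgE.
Unshelve. all: by end_near. Qed.

Lemma derive_comp V W Z (f : V -> W) (g : W -> Z) x v :
  differentiable f x -> differentiable g (f x) ->
  'D_v (g \o f) x = 'D_('D_v f x) g (f x).
Proof.
move=> df dg; rewrite (deriveE v (differentiable_comp df dg)) (deriveE v df).
by rewrite (deriveE _ dg) (diff_comp df dg).
Qed.

(** Differentiability is asked on a neighbourhood at every level, so that the rules of calculus hold
    as identities of germs and can be differentiated again. The order [k] is finite to allow
    induction, each derivative costing one order. *)
Fixpoint ndiff_at V W (k : nat) (f : V -> W) (x : V) : Prop :=
  (\near x, differentiable f x) /\
  (if k is k'.+1 then forall v, ndiff_at k' ('D_v f) x else True).

Lemma ndiff_at_near V W k (f : V -> W) (x : V) :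
  ndiff_at k f x -> \near x, differentiable f x.
Proof. by case: k => [|k] []. Qed.

Lemma ndiff_atW V W k (f : V -> W) (x : V) : ndiff_at k.+1 f x -> ndiff_at k f x.
Proof.
elim: k f => [|k IH] f [df Df]; split=> // v; exact/IH/Df.
Qed.

Lemma near_eq_near_derive V W (f g : V -> W) (x : V) v : (\near x, f x = g x) ->
  \near x, 'D_v f x = 'D_v g x.
Proof.
by move=> fg; apply: filterS (nbhs_interior fg) => y; exact: near_eq_derive.
Qed.

Lemma near_eq_ndiff_at V W k (f g : V -> W) (x : V) : (\near x, f x = g x) ->
  ndiff_at k f x -> ndiff_at k g x.
Proof.
elim: k f g => [|k IH] f g fg [df Df]; split=> //.
- by near=> y; apply: (@near_eq_differentiable _ _ f); near: y; [exact: nbhs_interior fg|].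
- by near=> y; apply: (@near_eq_differentiable _ _ f); near: y; [exact: nbhs_interior fg|].
- by move=> v; apply: IH (Df v); exact: near_eq_near_derive.
Unshelve. all: by end_near. Qed.

Lemma ndiff_at_cst V W k (a : W) (x : V) : ndiff_at k (cst a) x.
Proof.
elim: k a => [|k IH] a; (split; first by near=> y; exact: differentiable_cst) => // v.
have -> : 'D_v (cst a : V -> W) = cst 0; last exact: IH.
by apply/funext => y; rewrite derive_cst.
Unshelve. all: by end_near. Qed.

Lemma ndiff_atD V W k (f g : V -> W) (x : V) :
  ndiff_at k f x -> ndiff_at k g x -> ndiff_at k (f \+ g) x.
Proof.
elim: k f g => [|k IH] f g [df Df] [dg Dg].
  by split=> //; near=> y; apply: differentiableD; near: y.
split; first by near=> y; apply: differentiableD; near: y.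
move=> v; apply: near_eq_ndiff_at (IH _ _ (Df v) (Dg v)).
near=> y; rewrite /= -deriveD //; apply: diff_derivable; near: y => //.
Unshelve. all: by end_near. Qed.

Lemma ndiff_at_sum V W (I : Type) (r : seq I) (P : pred I) k (f : I -> V -> W) x :
  (forall i, P i -> ndiff_at k (f i) x) ->
  ndiff_at k (fun y => \sum_(i <- r | P i) f i y) x.
Proof.
move=> Df; elim: r => [|i r IH].
  suff -> : (fun y => \sum_(i <- [::] | P i) f i y) = cst 0 by exact: ndiff_at_cst.
  by apply/funext => y; rewrite big_nil.
have -> : (fun y => \sum_(j <- i :: r | P j) f j y) =
    (if P i then f i else cst 0) \+ (fun y => \sum_(j <- r | P j) f j y).
  by apply/funext => y /=; rewrite big_cons; case: ifP; rewrite ?add0r.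
by apply: ndiff_atD IH; case: ifP => [/Df|_] //; exact: ndiff_at_cst.
Qed.

Lemma linear_is_diff V W (l : V -> W) (x : V) : linear l -> continuous l ->
  differentiable l x /\ forall v, 'D_v l x = l v.
Proof.
move=> ll lc.
pose l' : {linear V -> W} := HB.pack l (GRing.isLinear.Build _ _ _ _ _ ll).
have dl : differentiable l' x by apply: linear_differentiable.
by split => // v; rewrite (deriveE v dl) (diff_lin (f := l')).
Qed.

Lemma ndiff_at_lin V W Z k (f : V -> W) (l : W -> Z) (x : V) :
  linear l -> continuous l -> ndiff_at k f x -> ndiff_at k (l \o f) x.
Proof.
move=> ll lc; have ld y := (linear_is_diff y ll lc).1.
elim: k f => [|k IH] f [df Df].
  by split=> //; near=> y; apply: differentiable_comp => //; near: y.
split; first by near=> y; apply: differentiable_comp => //; near: y.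
move=> v; apply: near_eq_ndiff_at (IH _ (Df v)).
near=> y; rewrite derive_comp //; last by near: y.
by rewrite (linear_is_diff _ ll lc).2.
Unshelve. all: by end_near. Qed.

Lemma ndiff_atM V k (f g : V -> R^o) (x : V) :
  ndiff_at k f x -> ndiff_at k g x -> ndiff_at k (fun y => f y * g y) x.
Proof.
elim: k f g => [|k IH] f g [df Df] [dg Dg].
  by split=> //; near=> y; apply: differentiableM; near: y.
split; first by near=> y; apply: differentiableM; near: y.
move=> v.
have H1 := IH _ _ (ndiff_atW (conj df Df)) (Dg v).
have H2 := IH _ _ (ndiff_atW (conj dg Dg)) (Df v).
apply: near_eq_ndiff_at (ndiff_atD H1 H2).
near=> y; rewrite -[RHS]/('D_v (f * g) y) deriveM //; apply: diff_derivable; near: y => //.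
Unshelve. all: by end_near. Qed.

Lemma ndiff_atV V k (f : V -> R^o) (x : V) :
  f x != 0 -> ndiff_at k f x -> ndiff_at k (fun y => (f y)^-1 : R^o) x.
Proof.
move=> fx0.
have nfx0 : ndiff_at k f x -> \near x, f x != 0.
  move=> /ndiff_at_near/nbhs_singleton/differentiable_continuous cf.
  by apply: (cf [set r | r != 0]); apply: open_nbhs_nbhs; split => //; exact: open_neq.
elim: k nfx0 => [|k IH] nfx0 df.
  by split=> //; near=> y; apply: differentiableV; near: y; [exact: ndiff_at_near df|exact: nfx0].
split; first by near=> y; apply: differentiableV; near: y; [exact: ndiff_at_near df|exact: nfx0].
move=> v; have := IH _ (ndiff_atW df); move=> H.
have H' : ndiff_at k (fun y => - ((f y)^-1 * (f y)^-1) * 'D_v f y : R^o) x.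
  apply: ndiff_atM; last by case: df => _; apply.
  apply: (@ndiff_at_lin _ _ _ k (fun y => (f y)^-1 * (f y)^-1 : R^o) -%R).
  - by move=> a u w; rewrite /= opprD scalerN.
  - exact: opp_continuous.
  by apply: ndiff_atM; apply: H => _; exact: nfx0.
apply: near_eq_ndiff_at H'.
near=> y; rewrite -[RHS]/('D_v (fun y => (f y)^-1) y) deriveV.
- by rewrite /= -expr2 exprVn.
- by near: y; exact: nfx0.
- by apply: diff_derivable; near: y; exact: ndiff_at_near df.
Unshelve. all: by end_near. Qed.

Lemma differentiable_expR (y : R) : differentiable (expR : R^o -> R^o) y.
Proof. by apply/derivable1_diffP; exact: derivable_expR. Qed.

Lemma derive_expR_comp V (f : V -> R^o) (x v : V) : differentiable f x ->
  'D_v (fun y => expR (f y) : R^o) x = expR (f x) * 'D_v f x.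
Proof.
move=> df; rewrite (derive_comp (f := f) (g := expR)) //; last exact: differentiable_expR.
rewrite (deriveE _ (differentiable_expR (f x))).
have -> : 'd (expR : R^o -> R^o) (f x) ('D_v f x) =
    'D_v f x *: derive1 (expR : R^o -> R^o) (f x).
  by rewrite (diff1E (differentiable_expR (f x))).
have -> : derive1 (expR : R^o -> R^o) (f x) = expR (f x).
  by rewrite derive1E; exact: (@derive_val _ _ _ _ _ _ _ (is_derive_expR (f x))).
exact: mulrC.
Qed.

Lemma ndiff_at_expR V k (f : V -> R^o) (x : V) :
  ndiff_at k f x -> ndiff_at k (fun y => expR (f y) : R^o) x.
Proof.
have dexp g y : differentiable g y -> differentiable (fun y : V => expR (g y) : R^o) y.
  by move=> dg; apply: (@differentiable_comp _ _ _ _ g expR) => //; exact: differentiable_expR.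
elim: k => [|k IH] df.
  by split=> //; near=> y; apply: dexp; near: y; exact: ndiff_at_near df.
split; first by near=> y; apply: dexp; near: y; exact: ndiff_at_near df.
move=> v; have H := ndiff_atM (IH (ndiff_atW df)) (df.2 v).
apply: near_eq_ndiff_at H; near=> y.
by rewrite derive_expR_comp //; near: y; exact: ndiff_at_near df.
Unshelve. all: by end_near. Qed.

(** [ndiff_at] only iterates derivatives in fixed directions. Finitely many vectors with continuous
    linear coordinates turn a derivative in a moving direction into a finite sum of products of such
    derivatives. *)
Record frame V := Frame {
  frame_index : finType;
  frame_vec : frame_index -> V;
  frame_coord : frame_index -> V -> R^o;
  frame_coord_linear : forall i, linear (frame_coord i);
  frame_coord_continuous : forall i, continuous (frame_coord i);
  frameE : forall v, v = \sum_i frame_coord i v *: frame_vec i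
}.

Arguments frame_coord {V} f i.
Arguments frame_vec {V} f i.
Arguments frame_coord_linear {V} f i.
Arguments frame_coord_continuous {V} f i.
Arguments frameE {V} f v.

Lemma frame_coord0 V (B : frame V) i : frame_coord B i 0 = 0.
Proof.
have := frame_coord_linear B i 1 0 0; rewrite !scale1r addr0 => /esym/eqP.
by rewrite -subr_eq0 addrK => /eqP.
Qed.

Lemma frame_coordZ V (B : frame V) i a v : frame_coord B i (a *: v) = a * frame_coord B i v.
Proof. by have := frame_coord_linear B i a v 0; rewrite frame_coord0 !addr0. Qed.

Lemma ndiff_at_frame V W (B : frame W) k (f : V -> W) (x : V) :
  ndiff_at k f x <-> forall i, ndiff_at k (frame_coord B i \o f) x.
Proof.
split=> [df i|df]; first by
  apply: ndiff_at_lin df; [exact: frame_coord_linear|exact: frame_coord_continuous].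
have -> : f = (fun y => \sum_i frame_coord B i (f y) *: frame_vec B i).
  by apply/funext => y; rewrite -frameE.
apply: ndiff_at_sum => i _.
apply: (@ndiff_at_lin _ _ _ k (frame_coord B i \o f) ( *:%R^~ (frame_vec B i))).
- by move=> a u v; rewrite scalerDl scalerA.
- exact: scalel_continuous.
- exact: df.
Qed.

Lemma ndiff_at_scale V W (B : frame W) k (a : V -> R^o) (f : V -> W) (x : V) :
  ndiff_at k a x -> ndiff_at k f x -> ndiff_at k (fun y => a y *: f y) x.
Proof.
move=> da /(ndiff_at_frame B) df; apply/(ndiff_at_frame B) => i.
have -> : frame_coord B i \o (fun y => a y *: f y) =
    (fun y => a y * frame_coord B i (f y)).
  by apply/funext => y /=; rewrite frame_coordZ.
by apply: ndiff_atM => //; exact: df.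
Qed.

Lemma derive_frame V W (B : frame V) (f : V -> W) (x v : V) :
  differentiable f x ->
  'D_v f x = \sum_i frame_coord B i v *: 'D_(frame_vec B i) f x.
Proof.
move=> df; rewrite {1}(frameE B v) deriveE // linear_sum.
by apply: eq_bigr => i _; rewrite linearZ deriveE.
Qed.

(** The chain rule differentiates [g] in the direction ['D_v f y], which moves with [y]. Expanding
    it in the frame [BW] leaves fixed directions, to which the induction hypothesis applies. *)
Lemma ndiff_at_comp V W Z (BW : frame W) (BZ : frame Z) k (f : V -> W)
    (g : W -> Z) (x : V) :
  ndiff_at k f x -> ndiff_at k g (f x) -> ndiff_at k (g \o f) x.
Proof.
move=> + + ; elim: k g => [|k IH] g df dg.
  have fc := differentiable_continuous (nbhs_singleton (ndiff_at_near df)).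
  split=> //; near=> y; apply: differentiable_comp; near: y.
    exact: ndiff_at_near df.
  exact: fc (ndiff_at_near dg).
have fc := differentiable_continuous (nbhs_singleton (ndiff_at_near df)).
have ndf := ndiff_at_near df.
have ndg := fc _ (ndiff_at_near dg).
split; first by near=> y; apply: differentiable_comp; near: y.
move=> v.
have H : ndiff_at k (fun y => \sum_i frame_coord BW i ('D_v f y) *:
    ('D_(frame_vec BW i) g \o f) y) x.
  apply: ndiff_at_sum => i _; apply: (ndiff_at_scale BZ).
    by apply: (@ndiff_at_lin _ _ _ k ('D_v f) (frame_coord BW i));
       [exact: frame_coord_linear|exact: frame_coord_continuous | exact: df.2].
  by apply: IH; [exact: ndiff_atW | exact: dg.2].
apply: near_eq_ndiff_at H; near=> y.
rewrite derive_comp; [|by near: y|by near: y].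
by rewrite (derive_frame BW) //; near: y.
Unshelve. all: by end_near. Qed.

End DirectionalDerivatives.

Arguments frame_coord {R V} f i.
Arguments frame_vec {R V} f i.
Arguments frame_coord_linear {R V} f i.
Arguments frame_coord_continuous {R V} f i.
Arguments frameE {R V} f v.

(** * Symmetry of mixed second derivatives *)

Section SecondDerivatives.
Context {R : realType}.
Implicit Types V W Z : normedModType R.

Lemma is_derive_line V (f : V -> R^o) (a u : V) (s : R) :
  differentiable f (a + s *: u) ->
  is_derive (s : R^o) 1 (fun t : R^o => f (a + t *: u)) ('D_u f (a + s *: u)).
Proof.
move=> df; pose l (t : R^o) := a + t *: u.
have [ds Ds] : differentiable (fun t : R^o => t *: u) s /\
    forall v, 'D_v (fun t : R^o => t *: u) s = v *: u.
  apply: linear_is_diff; last exact: scalel_continuous.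
  by move=> c t t'; rewrite scalerDl scalerA.
have dl : differentiable l s.
  by apply: differentiableD => //; exact: differentiable_cst.
have Dl : 'D_1 l s = u.
  rewrite -[l]/(cst a + (fun t : R^o => t *: u)).
  rewrite deriveD ?derive_cst ?add0r ?Ds ?scale1r //; exact: diff_derivable.
have dfl : differentiable f (l s) by [].
apply: DeriveDef.
  by apply: diff_derivable; exact: (@differentiable_comp _ _ _ _ l f).
by rewrite -[LHS]/('D_1 (f \o l) s) derive_comp // Dl.
Qed.

Lemma mean_value (phi dphi : R -> R) (h : R) : 0 < h ->
  (forall s : R, 0 <= s <= h -> is_derive s 1 phi (dphi s)) ->
  exists2 s : R, 0 <= s <= h & phi h - phi 0 = h * dphi s.
Proof.
move=> h0 D.
have D1 s : s \in `]0, h[ -> is_derive s 1 phi (dphi s).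
  by rewrite in_itv /= => /andP[s0 sh]; apply: D; rewrite !ltW.
have c : {within `[0, h], continuous phi}.
  apply: derivable_within_continuous => s; rewrite in_itv /= => sh.
  by have [] := D s sh.
have [s sh ->] := MVT h0 D1 c.
exists s; last by rewrite subr0 mulrC.
by move: sh; rewrite in_itv /= => /andP[s0 sh]; rewrite !ltW.
Qed.

(** The mean value theorem is used twice: along [u] for the increment of [f] in the direction
    [h *: v], then along [v] for ['D_u f]. The left side is symmetric in [u] and [v], which is what
    [derive_comm] exploits. *)
Lemma second_difference V (f : V -> R^o) (a u v : V) (h : R) : 0 < h ->
  (forall s t : R, 0 <= s <= h -> 0 <= t <= h ->
     differentiable f (a + s *: u + t *: v) /\
     differentiable ('D_u f) (a + s *: u + t *: v)) ->
  exists s t : R, [/\ 0 <= s <= h, 0 <= t <= h &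
    f (a + h *: u + h *: v) - f (a + h *: u) - (f (a + h *: v) - f a) =
    h * h * 'D_v ('D_u f) (a + s *: u + t *: v)].
Proof.
move=> h0 df.
pose phi (s : R^o) : R^o := f ((a + h *: v) + s *: u) - f (a + s *: u).
pose dphi (s : R^o) : R^o := 'D_u f ((a + h *: v) + s *: u) - 'D_u f (a + s *: u).
have hh : 0 <= h <= h by rewrite lexx ltW.
have h00 : 0 <= (0 : R) <= h by rewrite lexx ltW.
have Dphi s : 0 <= s <= h -> is_derive s 1 phi (dphi s).
  move=> sh; apply: is_deriveB; apply: is_derive_line.
    by rewrite addrAC; exact: (df _ _ sh hh).1.
  by have := (df _ _ sh h00).1; rewrite scale0r addr0.
have [s sh phiE] := @mean_value phi dphi h h0 Dphi.
pose psi (t : R^o) : R^o := 'D_u f ((a + s *: u) + t *: v).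
have Dpsi t : 0 <= t <= h -> is_derive t 1 psi ('D_v ('D_u f) (a + s *: u + t *: v)).
  by move=> th; apply: is_derive_line; exact: (df _ _ sh th).2.
have [t th psiE] := @mean_value psi _ h h0 Dpsi.
exists s, t; split => //.
have : phi h - phi 0 = h * h * 'D_v ('D_u f) (a + s *: u + t *: v).
  rewrite phiE /dphi [a + h *: v + _]addrAC -[X in _ - X]addr0.
  have := psiE; rewrite /psi scale0r !addr0 => ->.
  by rewrite mulrA.
rewrite /phi scale0r !addr0 => <-; rewrite [a + h *: v + _]addrAC.
by rewrite !opprB.
Qed.

(** One and the same second difference, computed in both orders, makes the two mixed derivatives
    agree at two different points near [x]. Their continuity at [x] does the rest. *)
Lemma derive_comm V (f : V -> R^o) (x u v : V) : ndiff_at 2 f x ->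
  'D_u ('D_v f) x = 'D_v ('D_u f) x.
Proof.
move=> [df Df].
have [du Du] := Df u; have [dv Dv] := Df v.
have cuv : {for x, continuous ('D_u ('D_v f))}.
  by apply: differentiable_continuous; exact: nbhs_singleton (Dv u).1.
have cvu : {for x, continuous ('D_v ('D_u f))}.
  by apply: differentiable_continuous; exact: nbhs_singleton (Du v).1.
apply/eqP; rewrite -subr_eq0 -normr_le0; apply/ler_addgt0Pl => e e0; rewrite addr0.
have e20 : 0 < e / 2 by rewrite divr_gt0.
move/cvgrPdist_le : cuv => /(_ _ e20) cuv.
move/cvgrPdist_le : cvu => /(_ _ e20) cvu.
have N : \forall y \near x, differentiable f y /\ differentiable ('D_u f) y /\
    differentiable ('D_v f) y /\ `|'D_u ('D_v f) x - 'D_u ('D_v f) y| <= e / 2 /\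
    `|'D_v ('D_u f) x - 'D_v ('D_u f) y| <= e / 2.
  exact: (filterI df (filterI du (filterI dv (filterI cuv cvu)))).
have [r /= r0 {}N] := (nbhs_ballP _ _).1 N.
(* The parallelogram spanned by [h *: u] and [h *: v] stays within [h * k = r / 2] of [x]; the
   summand 1 keeps [k] positive when both vectors vanish. *)
pose k : R := 1 + `|u| + `|v|.
have k0 : 0 < k by rewrite /k -addrA ltr_pwDl // addr_ge0.
pose h := r / 2 / k.
have h0 : 0 < h by rewrite !divr_gt0.
have xN s t : 0 <= s <= h -> 0 <= t <= h -> ball x r (x + s *: u + t *: v).
  move=> /andP[s0 sh] /andP[t0 th]; rewrite -ball_normE /= -addrA opprD addNKr.
  rewrite normrN (le_lt_trans (ler_normD _ _)) // !normrZ !ger0_norm //.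
  apply: (@le_lt_trans _ _ (h * `|u| + h * `|v|)).
    by rewrite lerD // ler_wpM2r.
  apply: (@le_lt_trans _ _ (h * k)).
    by rewrite /k !mulrDr lerD2r lerDr mulr1 ltW.
  by rewrite /h divfK ?gt_eqF // gtr_pMr // invf_lt1 // ltr1n.
have [s [t [sh th E1]]] : exists s t : R, [/\ 0 <= s <= h, 0 <= t <= h &
    f (x + h *: u + h *: v) - f (x + h *: u) - (f (x + h *: v) - f x) =
    h * h * 'D_v ('D_u f) (x + s *: u + t *: v)].
  by apply: second_difference => // s t sh th; have [? []] := N _ (xN _ _ sh th).
have [t' [s' [th' sh' E2]]] : exists s t : R, [/\ 0 <= s <= h, 0 <= t <= h &
    f (x + h *: v + h *: u) - f (x + h *: v) - (f (x + h *: u) - f x) =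
    h * h * 'D_u ('D_v f) (x + s *: v + t *: u)].
  apply: second_difference => // s' t' sh' th'; rewrite addrAC.
  by have [? [? []]] := N _ (xN _ _ th' sh').
have E3 : 'D_v ('D_u f) (x + s *: u + t *: v) = 'D_u ('D_v f) (x + s' *: u + t' *: v).
  have hn0 : h * h != 0 by rewrite mulf_neq0 // gt_eqF.
  apply: (mulfI hn0).
  transitivity (f (x + h *: u + h *: v) - f (x + h *: u) - (f (x + h *: v) - f x)).
    exact/esym/E1.
  have -> : x + s' *: u + t' *: v = x + t' *: v + s' *: u by rewrite addrAC.
  transitivity (f (x + h *: v + h *: u) - f (x + h *: v) - (f (x + h *: u) - f x)).
    have -> : x + h *: v + h *: u = x + h *: u + h *: v by rewrite addrAC.
    move: (f _) (f _) (f _) (f _) => A B C D.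
    by rewrite !opprB addrACA [RHS]addrACA; congr (_ + _); rewrite addrC.
  exact: E2.
have [_ [_ [_ [_ Avu]]]] := N _ (xN _ _ sh th).
have [_ [_ [_ [Auv _]]]] := N _ (xN _ _ sh' th').
have tri (A B C : R) : `|A - C| <= e / 2 -> `|B - C| <= e / 2 -> `|A - B| <= e.
  move=> AC BC; apply: (le_trans (ler_distD C A B)); rewrite (splitr e).
  by rewrite distrC in BC; exact: (lerD AC BC).
by rewrite -E3 in Auv; exact: tri Auv Avu.
Qed.

End SecondDerivatives.

(** * Calculus of smooth germs *)

Section Smoothness.
Context {R : realType}.
Implicit Types V W Z : normedModType R.

Definition real_frame : frame (R^o : normedModType R).
Proof.
refine (@Frame R R^o unit (fun _ => 1) (fun _ => id) _ _ _) => //.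
- by move=> _ x; exact: cvg_id.
- by move=> v; rewrite big_const card_unit /= addr0 [RHS]mulr1.
Defined.

Definition row_frame n : frame ('rV[R]_n).
Proof.
refine (@Frame R 'rV[R]_n 'I_n (fun i => delta_mx 0 i) (fun i v => v 0 i) _ _ _).
- by move=> i a u v; rewrite !mxE.
- by move=> i; exact: coord_continuous.
- by move=> v; exact: row_sum_delta.
Defined.

Definition pair_frame V W (B : frame V) (C : frame W) :
  frame (V * W : normedModType R)%type.
Proof.
refine (@Frame R (V * W : normedModType R)%type (frame_index B + frame_index C)%type
  (fun k => match k with inl i => (frame_vec B i, 0) | inr j => (0, frame_vec C j) end)
  (fun k v => match k with inl i => frame_coord B i v.1 | inr j => frame_coord C j v.2 end)
  _ _ _).
- by case=> i a u v; apply: frame_coord_linear.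
- case=> i v.
    apply: (@continuous_comp _ _ _ fst (frame_coord B i)); first exact: cvg_fst.
    exact: frame_coord_continuous.
  apply: (@continuous_comp _ _ _ snd (frame_coord C i)); first exact: cvg_snd.
  exact: frame_coord_continuous.
- case=> a b; rewrite big_sumType /= {1}(frameE B a) {1}(frameE C b).
  have -> : \sum_i frame_coord B i a *: (frame_vec B i, 0 : W) =
      (\sum_i frame_coord B i a *: frame_vec B i, 0).
    elim/big_ind2: _ => [//|u u' v v' -> ->|i _].
      by rewrite -[LHS]/(_ + _, _ + _) addr0.
    by rewrite -[LHS]/(_ *: _, _ *: _) scaler0.
  have -> : \sum_i frame_coord C i b *: (0 : V, frame_vec C i) =
      (0, \sum_i frame_coord C i b *: frame_vec C i).
    elim/big_ind2: _ => [//|u u' v v' -> ->|i _].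
      by rewrite -[LHS]/(_ + _, _ + _) addr0.
    by rewrite -[LHS]/(_ *: _, _ *: _) scaler0.
  by rewrite -[RHS]/(_ + _, _ + _) addr0 add0r.
Defined.

Lemma frame_eq W (B : frame W) (u v : W) :
  (forall i, frame_coord B i u = frame_coord B i v) -> u = v.
Proof.
by move=> uv; rewrite (frameE B u) (frameE B v); apply: eq_bigr => i _; rewrite uv.
Qed.

Lemma is_derive_bigsum V W (I : Type) (r : seq I) (F : I -> V -> W) (x v : V) :
  (forall i, differentiable (F i) x) ->
  differentiable (fun z => \sum_(i <- r) F i z) x /\
  'D_v (fun z => \sum_(i <- r) F i z) x = \sum_(i <- r) 'D_v (F i) x.
Proof.
move=> dF; elim: r => [|i r [IH1 IH2]].
  have -> : (fun z => \sum_(i <- [::]) F i z) = cst 0.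
    by apply/funext => z; rewrite big_nil.
  by rewrite big_nil derive_cst; split => //; exact: differentiable_cst.
have -> : (fun z => \sum_(j <- i :: r) F j z) = F i + (fun z => \sum_(j <- r) F j z).
  by apply/funext => z; rewrite big_cons.
split; first exact: differentiableD.
rewrite deriveD ?big_cons ?IH2 //; exact: diff_derivable.
Qed.

Lemma differentiable_frame V W (B : frame W) (f : V -> W) (x : V) i :
  differentiable f x -> differentiable (frame_coord B i \o f) x.
Proof.
move=> df; apply: differentiable_comp => //.
exact: (linear_is_diff _ (frame_coord_linear B i) (frame_coord_continuous B i)).1.
Qed.

Lemma derive_frame_coord V W (B : frame W) (f : V -> W) (x v : V) i :
  differentiable f x -> 'D_v (frame_coord B i \o f) x = frame_coord B i ('D_v f x).
Proof.
have l := linear_is_diff _ (frame_coord_linear B i) (frame_coord_continuous B i).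
by move=> df; rewrite derive_comp ?(l _).2 //; exact: (l _).1.
Qed.

Lemma differentiable_frameP V W (B : frame W) (f : V -> W) (x : V) :
  (forall i, differentiable (frame_coord B i \o f) x) -> differentiable f x.
Proof.
move=> df.
have -> : f = (fun y => \sum_i frame_coord B i (f y) *: frame_vec B i).
  by apply/funext => y; rewrite -frameE.
apply: (is_derive_bigsum _ 0 _).1 => i.
apply: (@differentiable_comp _ _ _ _ (frame_coord B i \o f) ( *:%R^~ (frame_vec B i))).
  exact: df.
apply: (linear_is_diff _ _ _).1; last exact: scalel_continuous.
by move=> a u v; rewrite scalerDl scalerA.
Qed.

Lemma differentiable_scale V W (B : frame W) (a : V -> R^o) (f : V -> W) (x : V) :
  differentiable a x -> differentiable f x -> differentiable (fun y => a y *: f y) x.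
Proof.
move=> da df; apply: (differentiable_frameP (B := B)) => i.
have -> : frame_coord B i \o (fun y => a y *: f y) = a * (frame_coord B i \o f).
  by apply/funext => y; exact: frame_coordZ.
by apply: differentiableM => //; exact: differentiable_frame.
Qed.

Definition smooth_at V W (f : V -> W) (x : V) := forall k, ndiff_at k f x.

Lemma smooth_at_derive V W (f : V -> W) (x v : V) :
  smooth_at f x -> smooth_at ('D_v f) x.
Proof. by move=> fs k; exact: (fs k.+1).2. Qed.

Lemma smooth_at_differentiable V W (f : V -> W) (x : V) :
  smooth_at f x -> differentiable f x.
Proof. by move=> /(_ 0)/ndiff_at_near/nbhs_singleton. Qed.

(** In the [foldr] of [smooth_on] the last vector is differentiated first. Splitting the sequence by
    [rcons] therefore peels off the innermost derivative, which is the recursion of [ndiff_at]. *)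
Lemma smooth_onP V W (U : set V) (f : V -> W) : open U ->
  smooth_on U f <-> forall x, U x -> smooth_at f x.
Proof.
move=> Uo; split=> [fs x Ux k|fs s x Ux].
  elim: k f fs => [|k IH] f fs; (split; last first) => //.
  - by near=> y; apply: (fs [::]); near: y; exact: open_nbhs_nbhs.
  - by move=> v; apply: IH => s y Uy; have := fs (rcons s v) y Uy; rewrite foldr_rcons.
  - by near=> y; apply: (fs [::]); near: y; exact: open_nbhs_nbhs.
apply: smooth_at_differentiable.
have {fs} := fs x Ux; elim/last_ind: s f => [//|s v IH] f fs.
by rewrite foldr_rcons; apply: IH; exact: smooth_at_derive.
Unshelve. all: by end_near. Qed.

Lemma derive_sym V W (B : frame W) (f : V -> W) (x u v : V) : ndiff_at 2 f x ->
  'D_u ('D_v f) x = 'D_v ('D_u f) x.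
Proof.
move=> df; apply: (frame_eq (B := B)) => i.
have df' : \near x, differentiable f x := ndiff_at_near df.
have E w : \near x, 'D_w (frame_coord B i \o f) x = (frame_coord B i \o 'D_w f) x.
  by apply: filterS df' => y; exact: derive_frame_coord.
have dd w : differentiable ('D_w f) x by exact: nbhs_singleton (df.2 w).1.
rewrite -(derive_frame_coord (B := B) u i (dd v)) -(derive_frame_coord (B := B) v i (dd u)).
rewrite -(near_eq_derive _ (E v)) -(near_eq_derive _ (E u)).
by apply: derive_comm; exact: (ndiff_at_frame B 2 f x).1.
Qed.

Lemma ndiff_at_along V W (B : frame V) (C : frame W) k (f : V -> W) (X : V -> V) (x : V) :
  ndiff_at k.+1 f x -> ndiff_at k X x -> ndiff_at k (fun z => 'D_(X z) f z) x.
Proof.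
move=> df dX; have H : ndiff_at k (fun z =>
    \sum_i frame_coord B i (X z) *: 'D_(frame_vec B i) f z) x.
  apply: ndiff_at_sum => i _; apply: (ndiff_at_scale C); last exact: df.2.
  exact: (ndiff_at_frame B k X x).1.
apply: near_eq_ndiff_at H; apply: filterS (ndiff_at_near df) => z dfz.
by rewrite -derive_frame.
Qed.

(** The direction depends on the point, hence the first term. In the frame this is the product rule
    for each summand, followed by symmetry of second derivatives. Nearly all computations with F^2
    below go through this rule. *)
Lemma derive_along_real V (B : frame V) (f : V -> R^o) (X : V -> V) (x v : V) :
  ndiff_at 2 f x -> differentiable X x ->
  'D_v (fun z => 'D_(X z) f z) x = 'D_('D_v X x) f x + 'D_(X x) ('D_v f) x.
Proof.
move=> df dX.
have dfn := ndiff_at_near df.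
have dfx := nbhs_singleton dfn.
have dd w : differentiable ('D_w f) x by exact: nbhs_singleton (df.2 w).1.
have dXi i : differentiable (frame_coord B i \o X) x by exact: differentiable_frame.
pose F i z : R^o := frame_coord B i (X z) * 'D_(frame_vec B i) f z.
have dF i : differentiable (F i) x by exact: (differentiableM (dXi i) (dd _)).
have E : \near x, 'D_(X x) f x = \sum_i F i x.
  by apply: filterS dfn => z dfz; exact: derive_frame.
rewrite (near_eq_derive _ E) (is_derive_bigsum _ _ dF).2.
rewrite (derive_frame B _ dfx) (derive_frame B _ (dd v)) -big_split /=.
apply: eq_bigr => i _.
rewrite -[F i]/((frame_coord B i \o X) * ('D_(frame_vec B i) f)).
rewrite deriveM; [|exact: diff_derivable|exact: diff_derivable].
rewrite (derive_frame_coord (B := B) v i dX) (derive_comm v (frame_vec B i) df).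
by rewrite addrC; congr (_ + _); exact: mulrC.
Qed.

Lemma derive_along V W (B : frame V) (C : frame W) (f : V -> W) (X : V -> V) (x v : V) :
  ndiff_at 2 f x -> differentiable X x ->
  'D_v (fun z => 'D_(X z) f z) x = 'D_('D_v X x) f x + 'D_(X x) ('D_v f) x.
Proof.
move=> df dX; apply: (frame_eq (B := C)) => j.
have dfn := ndiff_at_near df.
have dfx := nbhs_singleton dfn.
have dd w : differentiable ('D_w f) x by exact: nbhs_singleton (df.2 w).1.
pose g := frame_coord C j \o f.
have dg : ndiff_at 2 g x by exact: (ndiff_at_frame C 2 f x).1.
have Eg : \near x, forall w, 'D_w g x = frame_coord C j ('D_w f x).
  by apply: filterS dfn => z dfz w; exact: derive_frame_coord.
have c1 := frame_coord_linear C j 1 ('D_('D_v X x) f x) ('D_(X x) ('D_v f) x).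
rewrite !scale1r in c1.
rewrite c1 -(derive_frame_coord (B := C) _ j dfx).
rewrite -(derive_frame_coord (B := C) (X x) j (dd v)).
have E2 : \near x, 'D_v g x = (frame_coord C j \o 'D_v f) x.
  by apply: filterS Eg => z Ez; exact: Ez.
rewrite -(near_eq_derive _ E2) -(derive_along_real B v dg dX).
have dXf : differentiable (fun z => 'D_(X z) f z) x.
  have H : \near x, \sum_i frame_coord B i (X x) *: 'D_(frame_vec B i) f x = 'D_(X x) f x.
    by apply: filterS dfn => z dfz; exact/esym/derive_frame.
  apply: (near_eq_differentiable H); apply: (is_derive_bigsum _ 0 _).1 => i.
  apply: (@differentiable_scale _ _ C (frame_coord B i \o X)); last exact: dd.
  exact: differentiable_frame.
rewrite -(derive_frame_coord (B := C) v j dXf); apply: near_eq_derive.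
by apply: filterS Eg => z Ez; exact/esym/Ez.
Qed.

Lemma near_eq_smooth_at V W (f g : V -> W) (x : V) :
  (\near x, f x = g x) -> smooth_at f x -> smooth_at g x.
Proof. by move=> fg fs k; exact: (near_eq_ndiff_at fg (fs k)). Qed.

Lemma smooth_at_cst V W (a : W) (x : V) : smooth_at (cst a) x.
Proof. by move=> k; exact: ndiff_at_cst. Qed.

Lemma smooth_atD V W (f g : V -> W) (x : V) :
  smooth_at f x -> smooth_at g x -> smooth_at (f \+ g) x.
Proof. by move=> fs gs k; exact: ndiff_atD. Qed.

Lemma smooth_at_sum V W (I : Type) (r : seq I) (P : pred I) (f : I -> V -> W) (x : V) :
  (forall i, P i -> smooth_at (f i) x) ->
  smooth_at (fun y => \sum_(i <- r | P i) f i y) x.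
Proof. by move=> fs k; apply: ndiff_at_sum => i Pi; exact: fs. Qed.

Lemma smooth_at_lin V W Z (f : V -> W) (l : W -> Z) (x : V) :
  linear l -> continuous l -> smooth_at f x -> smooth_at (l \o f) x.
Proof. by move=> ll lc fs k; exact: (ndiff_at_lin ll lc). Qed.

Lemma smooth_atM V (f g : V -> R^o) (x : V) :
  smooth_at f x -> smooth_at g x -> smooth_at (fun y => f y * g y : R^o) x.
Proof. by move=> fs gs k; exact: ndiff_atM. Qed.

Lemma smooth_at_prod V (I : Type) (r : seq I) (P : pred I) (f : I -> V -> R^o) (x : V) :
  (forall i, P i -> smooth_at (f i) x) ->
  smooth_at (fun y => \prod_(i <- r | P i) f i y : R^o) x.
Proof.
move=> fs; elim: r => [|i r IH].
  have -> : (fun y => \prod_(i <- [::] | P i) f i y : R^o) = cst 1.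
    by apply/funext => y; rewrite big_nil.
  exact: smooth_at_cst.
have -> : (fun y => \prod_(j <- i :: r | P j) f j y : R^o) =
    (fun y => (if P i then f i y else 1) * \prod_(j <- r | P j) f j y).
  by apply/funext => y /=; rewrite big_cons; case: ifP; rewrite ?mul1r.
by apply: smooth_atM IH; have := fs i; case: (P i) => [/(_ isT)//|_]; exact: smooth_at_cst.
Qed.

Lemma smooth_atN V (f : V -> R^o) (x : V) :
  smooth_at f x -> smooth_at (fun y => - f y : R^o) x.
Proof.
move=> fs; apply: (@smooth_at_lin V R^o R^o f (fun r => - r)) => //.
  by move=> a u w; rewrite /= opprD scalerN.
exact: opp_continuous.
Qed.

Lemma smooth_atV V (f : V -> R^o) (x : V) :
  f x != 0 -> smooth_at f x -> smooth_at (fun y => (f y)^-1 : R^o) x.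
Proof. by move=> fx fs k; exact: ndiff_atV. Qed.

Lemma smooth_at_expR V (f : V -> R^o) (x : V) :
  smooth_at f x -> smooth_at (fun y => expR (f y) : R^o) x.
Proof. by move=> fs k; exact: ndiff_at_expR. Qed.

Lemma smooth_at_frame V W (B : frame W) (f : V -> W) (x : V) :
  smooth_at f x <-> forall i, smooth_at (frame_coord B i \o f) x.
Proof.
by split=> [fs i k|fs k]; [exact: (ndiff_at_frame B k f x).1|
  apply/(ndiff_at_frame B) => i; exact: fs].
Qed.

Lemma smooth_at_scale V W (B : frame W) (a : V -> R^o) (f : V -> W) (x : V) :
  smooth_at a x -> smooth_at f x -> smooth_at (fun y => a y *: f y) x.
Proof. by move=> sa fs k; exact: (ndiff_at_scale B). Qed.

Lemma smooth_at_comp V W Z (B : frame W) (C : frame Z) (f : V -> W) (g : W -> Z) (x : V) :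
  smooth_at f x -> smooth_at g (f x) -> smooth_at (g \o f) x.
Proof. by move=> fs gs k; exact: (ndiff_at_comp B C). Qed.

Lemma smooth_at_along V W (B : frame V) (C : frame W) (f : V -> W) (X : V -> V) (x : V) :
  smooth_at f x -> smooth_at X x -> smooth_at (fun z => 'D_(X z) f z) x.
Proof. by move=> fs Xs k; exact: (ndiff_at_along B C). Qed.

Lemma smooth_at_row V n (f : V -> 'rV[R]_n) (x : V) :
  smooth_at f x <-> forall i, smooth_at (fun y => f y 0 i : R^o) x.
Proof. exact: (smooth_at_frame (row_frame n)). Qed.

Lemma smooth_at_id V (x : V) : smooth_at (id : V -> V) x.
Proof.
move=> k; have := @ndiff_at_lin R V V V k id id x.
case: k => [|k] _; split => //.
- by near=> y; exact: (linear_is_diff y (fun _ _ _ => erefl) (fun z => cvg_id)).1.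
- by near=> y; exact: (linear_is_diff y (fun _ _ _ => erefl) (fun z => cvg_id)).1.
- move=> v; have -> : 'D_v (id : V -> V) = cst v.
    apply/funext => y.
    exact: (linear_is_diff y (fun _ _ _ => erefl) (fun z => cvg_id)).2.
  exact: ndiff_at_cst.
Unshelve. all: by end_near. Qed.

Lemma smooth_at_linear V W (l : V -> W) (x : V) : linear l -> continuous l ->
  smooth_at l x.
Proof.
by move=> ll lc; apply: (@smooth_at_lin _ _ _ id l) => //; exact: smooth_at_id.
Qed.

Lemma smooth_at_fst V W (x : V * W) : smooth_at (fst : (V * W)%type -> V) x.
Proof. by apply: smooth_at_linear => // z; exact: cvg_fst. Qed.

Lemma smooth_at_snd V W (x : V * W) : smooth_at (snd : (V * W)%type -> W) x.
Proof. by apply: smooth_at_linear => // z; exact: cvg_snd. Qed.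

Lemma smooth_at_pair V W Z (f : V -> W) (g : V -> Z) (x : V) :
  smooth_at f x -> smooth_at g x -> smooth_at (fun y => (f y, g y)) x.
Proof.
move=> fs gs.
have h1 : smooth_at ((fun w : W => (w, 0) : W * Z) \o f) x.
  apply: smooth_at_lin => //.
    by move=> a u v; rewrite -[RHS]/(_ + _, _ + _) /= scaler0 addr0.
  by move=> w; apply: (cvg_pair (f := id) (g := fun=> 0)); [exact: cvg_id|exact: cvg_cst].
have h2 : smooth_at ((fun w : Z => (0, w) : W * Z) \o g) x.
  apply: smooth_at_lin => //.
    by move=> a u v; rewrite -[RHS]/(_ + _, _ + _) /= scaler0 addr0.
  by move=> w; apply: (cvg_pair (f := fun=> 0) (g := id)); [exact: cvg_cst|exact: cvg_id].
apply: near_eq_smooth_at (smooth_atD h1 h2).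
by near=> y; rewrite /= -[LHS]/(_ + _, _ + _) /= addr0 add0r.
Unshelve. all: by end_near. Qed.

End Smoothness.

(* Locked, because unification would otherwise unfold 'D_v into limits. *)
HB.lock Definition dd (R : realType) (V W : normedModType R) (v : V) (f : V -> W)
    (x : V) : W := 'D_v f x.
Arguments dd {R V W} v f x.

Lemma ddE (R : realType) (V W : normedModType R) (v : V) (f : V -> W) (x : V) :
  'D_v f x = dd v f x.
Proof. by rewrite dd.unlock. Qed.

Lemma ddfE (R : realType) (V W : normedModType R) (v : V) (f : V -> W) :
  'D_v f = dd v f.
Proof. by apply/funext => x; exact: ddE. Qed.

Section Dirder.
Context {R : realType} {V W : normedModType R}.
Implicit Types (f : V -> W) (x u v : V).

Lemma smooth_at_dd v f x : smooth_at f x -> smooth_at (dd v f) x.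
Proof. by rewrite -ddfE; exact: smooth_at_derive. Qed.

Lemma ddD f x u v : differentiable f x -> dd (u + v) f x = dd u f x + dd v f x.
Proof. by move=> df; rewrite -!ddE !deriveE// linearD. Qed.

Lemma ddZ f x a v : differentiable f x -> dd (a *: v) f x = a *: dd v f x.
Proof. by move=> df; rewrite -!ddE !deriveE// linearZ. Qed.

Lemma ddN f x v : differentiable f x -> dd (- v) f x = - dd v f x.
Proof. by move=> df; rewrite -!ddE !deriveE// linearN. Qed.

Lemma dd0 f x : dd 0 f x = 0.
Proof. by rewrite -ddE derive0. Qed.

Lemma dd_sum f x (I : finType) (a : I -> R) (u : I -> V) : differentiable f x ->
  dd (\sum_i a i *: u i) f x = \sum_i a i *: dd (u i) f x.
Proof.
move=> df; rewrite -ddE deriveE// linear_sum.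
by apply: eq_bigr => i _; rewrite -ddE (deriveE _ df) linearZ.
Qed.

Lemma near_eq_dd f (g : V -> W) x v : (\near x, f x = g x) -> dd v f x = dd v g x.
Proof. by rewrite -!ddE; exact: near_eq_derive. Qed.

Lemma dd_sym (B : frame W) f x u v : smooth_at f x ->
  dd u (dd v f) x = dd v (dd u f) x.
Proof. by move=> fs; rewrite -!ddfE; exact: (derive_sym B u v (fs 2)). Qed.

Lemma dd_along (B : frame V) (C : frame W) f (X : V -> V) x v :
  smooth_at f x -> differentiable X x ->
  dd v (fun z => dd (X z) f z) x = dd (dd v X x) f x + dd (X x) (dd v f) x.
Proof.
move=> fs dX.
have -> : (fun z => dd (X z) f z) = (fun z => 'D_(X z) f z).
  by apply/funext => z; rewrite ddE.
rewrite -ddE (derive_along B C v (fs 2) dX) ddfE; congr (_ + _); last exact: ddE.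
by rewrite -[dd v X x]ddE; exact: ddE.
Qed.

End Dirder.

Section RealDirder.
Context {R : realType} {V : normedModType R}.
Implicit Types (f g : V -> R^o) (x v : V).

Lemma dd_add f g x v : differentiable f x -> differentiable g x ->
  dd v (fun y => f y + g y : R^o) x = dd v f x + dd v g x.
Proof.
move=> df dg; rewrite -!ddE; apply: (@deriveD _ _ _ f g); exact: diff_derivable.
Qed.

Lemma dd_sub f g x v : differentiable f x -> differentiable g x ->
  dd v (fun y => f y - g y : R^o) x = dd v f x - dd v g x.
Proof.
move=> df dg; rewrite -!ddE; apply: (@deriveB _ _ _ f g); exact: diff_derivable.
Qed.

Lemma dd_mul f g x v : differentiable f x -> differentiable g x ->
  dd v (fun y => f y * g y : R^o) x = f x * dd v g x + g x * dd v f x.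
Proof.
move=> df dg; rewrite -!ddE; apply: (@deriveM _ _ f g); exact: diff_derivable.
Qed.

Lemma dd_scal (c : R) f x v : differentiable f x ->
  dd v (fun y => c * f y : R^o) x = c * dd v f x.
Proof.
move=> df; rewrite -!ddE; apply: (@deriveZ _ _ _ f c); exact: diff_derivable.
Qed.

Lemma differentiable_scal (c : R) f x : differentiable f x ->
  differentiable (fun y => c * f y : R^o) x.
Proof. exact: (@differentiableZ _ _ _ f c). Qed.

End RealDirder.

(** * The fundamental tensor and the Cartan connection *)

Section Metric.
Context {R : realType} {n : nat}.
Local Notation rV := 'rV[R]_n.
Local Notation E := ('rV[R]_n * 'rV[R]_n)%type.
Local Notation bv := (@basis_vec R n).

Definition tangent_frame : frame (E : normedModType R) :=
  pair_frame (row_frame n) (row_frame n).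

Definition horz (u : rV) : E := (u, 0).
Definition vert (u : rV) : E := (0, u).

Lemma pairD (a b c d : rV) : ((a, b) : E) + (c, d) = (a + c, b + d).
Proof. by []. Qed.

Lemma pairZ (k : R) (a b : rV) : k *: ((a, b) : E) = (k *: a, k *: b).
Proof. by []. Qed.

Lemma horzD u w : horz (u + w) = horz u + horz w.
Proof. by rewrite /horz pairD addr0. Qed.

Lemma vertD u w : vert (u + w) = vert u + vert w.
Proof. by rewrite /vert pairD addr0. Qed.

Lemma horzZ a u : horz (a *: u) = a *: horz u.
Proof. by rewrite /horz pairZ scaler0. Qed.

Lemma vertZ a u : vert (a *: u) = a *: vert u.
Proof. by rewrite /vert pairZ scaler0. Qed.

Lemma horz_vert (z : E) : z = horz z.1 + vert z.2.
Proof. by case: z => a b; rewrite /horz /vert pairD addr0 add0r. Qed.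

Lemma horz0 : horz 0 = 0. Proof. by []. Qed.
Lemma vert0 : vert 0 = 0. Proof. by []. Qed.

Lemma vert_sum (I : finType) (u : I -> rV) : vert (\sum_i u i) = \sum_i vert (u i).
Proof. by elim/big_ind2: _ => // a b c d <- <-; rewrite vertD. Qed.

Lemma horz_sum (I : finType) (u : I -> rV) : horz (\sum_i u i) = \sum_i horz (u i).
Proof. by elim/big_ind2: _ => // a b c d <- <-; rewrite horzD. Qed.

Lemma vert_lincomb (I : finType) (a : I -> R) (u : I -> rV) :
  vert (\sum_i a i *: u i) = \sum_i a i *: vert (u i).
Proof. by rewrite vert_sum; apply: eq_bigr => i _; exact: vertZ. Qed.

Lemma horz_linear : linear horz.
Proof. by move=> a u w; rewrite horzD horzZ. Qed.

Lemma vert_linear : linear vert.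
Proof. by move=> a u w; rewrite vertD vertZ. Qed.

Lemma dir_horz_sum (f : E -> R^o) (z : E) (I : finType) (a : I -> R) (u : I -> rV) :
  differentiable f z ->
  dd (horz (\sum_i a i *: u i)) f z = \sum_i a i * dd (horz (u i)) f z.
Proof.
move=> df; rewrite horz_sum -(dd_sum _ _ df); congr (dd _ f z).
by apply: eq_bigr => i _; exact: horzZ.
Qed.

Lemma dir_vert_sum (f : E -> R^o) (z : E) (I : finType) (a : I -> R) (u : I -> rV) :
  differentiable f z ->
  dd (vert (\sum_i a i *: u i)) f z = \sum_i a i * dd (vert (u i)) f z.
Proof. by move=> df; rewrite vert_lincomb (dd_sum _ _ df). Qed.

(** * Fundamental tensor and Cartan connection at one point of TM_0 *)

Section Point.
Variables (L : E -> R^o) (z : E).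
Hypothesis Ls : smooth_at (energy L) z.
Hypothesis Lpos : forall u : rV, u != 0 -> 0 < inner L z u u.

Hypothesis Lsn : \near z, smooth_at (energy L) z.

Let En : E -> R^o := energy L.

(** This is 2 g(u, w), since g is half the vertical Hessian of F^2. Keeping it as an iterated
    directional derivative removes the coordinates and lets symmetry of derivatives act on it. *)
Definition hess (u w : rV) : E -> R^o := dd (vert u) (dd (vert w) En).

Lemma smooth_hess u w : smooth_at (hess u w) z.
Proof. exact/smooth_at_dd/smooth_at_dd. Qed.

Lemma hessC u w : hess u w z = hess w u z.
Proof. exact: (dd_sym real_frame _ _ Ls). Qed.

Lemma hess_suml (I : finType) (a : I -> R) (u : I -> rV) w :
  hess (\sum_i a i *: u i) w z = \sum_i a i * hess (u i) w z.
Proof.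
by apply: dir_vert_sum; exact/smooth_at_differentiable/smooth_at_dd.
Qed.

Lemma hess_sumr (I : finType) (a : I -> R) (u : I -> rV) w :
  hess w (\sum_i a i *: u i) z = \sum_i a i * hess w (u i) z.
Proof. by rewrite hessC hess_suml; apply: eq_bigr => i _; rewrite hessC. Qed.

Lemma row_basisE (u : rV) : u = \sum_i u 0 i *: bv i.
Proof. exact: row_sum_delta. Qed.

Lemma gmxE i j : gmx L z i j = 2^-1 * hess (bv i) (bv j) z.
Proof. by rewrite mxE /dy /hess ddfE ddE. Qed.

Lemma gmx_sym i j : gmx L z i j = gmx L z j i.
Proof. by rewrite !gmxE hessC. Qed.

Lemma innerE u w : inner L z u w = 2^-1 * hess u w z.
Proof.
rewrite (row_basisE u) (row_basisE w) hess_suml mulr_sumr /inner.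
apply: eq_bigr => i _; rewrite hess_sumr !mulr_sumr; apply: eq_bigr => j _.
rewrite -!row_basisE /glow gmxE; ring.
Qed.

Lemma inner_sym u w : inner L z u w = inner L z w u.
Proof. by rewrite !innerE hessC. Qed.

Lemma innerDl u v w : inner L z (u + v) w = inner L z u w + inner L z v w.
Proof.
rewrite /inner -big_split; apply: eq_bigr => i _; rewrite -big_split.
by apply: eq_bigr => j _; rewrite mxE /=; ring.
Qed.

Lemma innerZl a v w : inner L z (a *: v) w = a * inner L z v w.
Proof.
rewrite /inner mulr_sumr; apply: eq_bigr => i _; rewrite mulr_sumr.
by apply: eq_bigr => j _; rewrite mxE /=; ring.
Qed.

Lemma innerNl v w : inner L z (- v) w = - inner L z v w.
Proof. by rewrite -scaleN1r innerZl mulN1r. Qed.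

(** Positive definiteness gives nondegeneracy. Vector identities below are proved after pairing with
    an arbitrary [w], which clears [ginv]. *)
Lemma inner_inj u v : (forall w, inner L z u w = inner L z v w) -> u = v.
Proof.
move=> uv; apply/eqP; rewrite -subr_eq0; apply: contraT => /Lpos.
by rewrite innerDl innerNl uv subrr ltxx.
Qed.

Lemma inner_mul u w : inner L z u w = (u *m gmx L z *m w^T) 0 0.
Proof.
rewrite !mxE /inner exchange_big /=; apply: eq_bigr => j _; rewrite !mxE mulr_suml.
by apply: eq_bigr => i _; rewrite /glow; ring.
Qed.

Lemma gmx_unit : gmx L z \in unitmx.
Proof.
rewrite -row_free_unit -kermx_eq0; apply/eqP/row_matrixP => i; rewrite row0.
apply/eqP; apply: contraT => /Lpos.
by rewrite inner_mul -row_mul mulmx_ker row0 mul0mx mxE ltxx.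
Qed.

Lemma ginv_gmx i k : \sum_j gmx L z i j * ginv L j k z = (i == k)%:R.
Proof.
by have := mulmxV gmx_unit => /matrixP /(_ i k); rewrite !mxE => <-.
Qed.

Lemma ginv_sym i j : ginv L i j z = ginv L j i z.
Proof.
have gT : (gmx L z)^T = gmx L z by apply/matrixP => k l; rewrite mxE gmx_sym.
by rewrite /ginv -{1}gT -trmx_inv mxE.
Qed.

(** [ginv] raises an index and the pairing lowers it again. Gamma, C, the spray and the gradient all
    have this form, so that g^{-1} disappears from each of them. *)
Lemma inner_raise (a : 'I_n -> R) (w : rV) :
  inner L z (\row_i \sum_l ginv L i l z * a l) w = \sum_l a l * w 0 l.
Proof.
have -> : \row_i \sum_l ginv L i l z * a l = (\row_l a l) *m invmx (gmx L z).
  apply/rowP => i; rewrite !mxE; apply: eq_bigr => l _.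
  by rewrite ginv_sym mxE mulrC.
rewrite inner_mul mulmxKV ?gmx_unit // mxE.
by apply: eq_bigr => l _; rewrite !mxE.
Qed.

Lemma derive_rowE (f : rV -> R^o) (x w : rV) : differentiable f x ->
  \sum_i dd (bv i) f x * w 0 i = dd w f x.
Proof.
by move=> df; rewrite {2}(row_basisE w) dd_sum //; apply: eq_bigr => i _; rewrite mulrC.
Qed.

Lemma inner_grad (psi : rV -> R^o) w : differentiable psi z.1 ->
  inner L z (grad L psi z) w = dd w psi z.1.
Proof.
move=> df; rewrite inner_raise -derive_rowE //.
by apply: eq_bigr => l _; rewrite -ddE.
Qed.

(* u^i delta_i *)
Definition hlift (u : rV) : E := (u, - \row_m \sum_l u 0 l * nonlin L m l z).

Lemma hlift_sum (I : finType) (a : I -> R) (u : I -> rV) :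
  hlift (\sum_i a i *: u i) = \sum_i a i *: hlift (u i).
Proof.
have lin (k : R) (v w : rV) : hlift (k *: v + w) = k *: hlift v + hlift w.
  rewrite /hlift pairZ pairD; congr pair; apply/rowP => m; rewrite !mxE.
  rewrite mulrN mulr_sumr -opprD -big_split; congr (- _).
  by apply: eq_bigr => l _; rewrite !mxE /=; ring.
have h0 : hlift 0 = 0.
  by have /eqP := lin 1 0 0; rewrite !scale1r addr0 -subr_eq subrr => /eqP.
elim/big_ind2: _ => // [b c d e <- <-|i _].
  by rewrite -[X in hlift (X + _)]scale1r lin scale1r.
by rewrite -[X in hlift X]addr0 lin h0 addr0.
Qed.

Lemma deltaE i (f : E -> R^o) : differentiable f z ->
  delta L i f z = dd (hlift (bv i)) f z.
Proof.
move=> df.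
have -> : hlift (bv i) = horz (bv i) + \sum_j (- nonlin L j i z) *: vert (bv j).
  under eq_bigr do rewrite -vertZ; rewrite -vert_sum /horz /vert pairD addr0 add0r.
  congr pair; under eq_bigr do rewrite scaleNr; rewrite sumrN; congr (- _).
  rewrite [LHS]row_basisE; apply: eq_bigr => m _; rewrite mxE; congr (_ *: _).
  rewrite (bigD1 i) //= mxE !eqxx mul1r big1 ?addr0 // => l li.
  by rewrite mxE eqxx (negbTE li) mul0r.
rewrite ddD // dd_sum // /delta /dx ddE; congr (_ + _); rewrite -sumrN.
by apply: eq_bigr => j _; rewrite scaleNr -ddE.
Qed.

Lemma derive_glow xi j k :
  dd xi (glow L j k) z = 2^-1 * dd xi (hess (bv j) (bv k)) z.
Proof.
have -> : glow L j k = (fun y => 2^-1 * hess (bv j) (bv k) y).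
  by apply/funext => w; rewrite /glow mxE /dy /hess ddfE ddE.
exact/dd_scal/smooth_at_differentiable/smooth_hess.
Qed.

Lemma differentiable_glow j k : differentiable (glow L j k) z.
Proof.
have -> : glow L j k = (fun y => 2^-1 * hess (bv j) (bv k) y).
  by apply/funext => w; rewrite /glow mxE /dy /hess ddfE ddE.
exact/differentiable_scal/smooth_at_differentiable/smooth_hess.
Qed.

Lemma derive_hessC xi u w : dd xi (hess u w) z = dd xi (hess w u) z.
Proof.
apply: near_eq_dd; apply: filterS Lsn => y Ly; exact: (dd_sym real_frame _ _ Ly).
Qed.

Lemma derive_hess_suml xi (I : finType) (a : I -> R) (u : I -> rV) w :
  dd xi (hess (\sum_i a i *: u i) w) z = \sum_i a i * dd xi (hess (u i) w) z.
Proof.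
have Ew : smooth_at (dd (vert w) En) z by exact: smooth_at_dd.
have C v : dd xi (hess v w) z = dd (vert v) (dd xi (dd (vert w) En)) z.
  exact: (dd_sym real_frame _ _ Ew).
transitivity (dd (vert (\sum_i a i *: u i)) (dd xi (dd (vert w) En)) z).
  exact: C.
have dE : differentiable (dd xi (dd (vert w) En)) z.
  exact/smooth_at_differentiable/smooth_at_dd.
rewrite (dir_vert_sum _ _ dE).
by apply: eq_bigr => i _; congr (_ * _); exact/esym/C.
Qed.

Lemma derive_hess_sumr xi (I : finType) (a : I -> R) (u : I -> rV) w :
  dd xi (hess w (\sum_i a i *: u i)) z = \sum_i a i * dd xi (hess w (u i)) z.
Proof.
by rewrite derive_hessC derive_hess_suml; apply: eq_bigr => i _; rewrite derive_hessC.
Qed.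

(** Trilinearity in [s], [u], [w]. The lift [h] is a parameter because Gamma calls for [hlift] and C
    for [vert]. *)
Lemma derive_hess_expand (h : rV -> E) (s u w : rV) :
    (forall a : 'I_n -> R, h (\sum_i a i *: bv i) = \sum_i a i *: h (bv i)) ->
  dd (h s) (hess u w) z =
  \sum_i \sum_j \sum_k s 0 i * u 0 j * w 0 k * dd (h (bv i)) (hess (bv j) (bv k)) z.
Proof.
move=> hl; rewrite {1}(row_basisE s) hl dd_sum; last exact/smooth_at_differentiable/smooth_hess.
apply: eq_bigr => i _; rewrite {1}(row_basisE u) derive_hess_suml -[LHS]/(_ * _) mulr_sumr.
apply: eq_bigr => j _; rewrite {1}(row_basisE w) derive_hess_sumr !mulr_sumr.
by apply: eq_bigr => k _; rewrite !mulrA.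
Qed.

Lemma inner_raise3 (G T : 'I_n -> 'I_n -> 'I_n -> R) (s a w : rV) :
  (forall i j k, G i j k = \sum_l ginv L i l z * T j k l) ->
  inner L z (\row_i \sum_j \sum_k s 0 j * (G i j k * a 0 k)) w =
  \sum_j \sum_k \sum_l s 0 j * a 0 k * w 0 l * T j k l.
Proof.
move=> GE; rewrite [X in inner L z X w](_ : _ =
    \row_i \sum_l ginv L i l z * (\sum_j \sum_k s 0 j * a 0 k * T j k l)); last first.
  apply/rowP => i; rewrite !mxE; under [RHS]eq_bigr do rewrite mulr_sumr.
  rewrite [RHS]exchange_big /=; apply: eq_bigr => j _.
  under [RHS]eq_bigr do rewrite mulr_sumr.
  rewrite [RHS]exchange_big /=; apply: eq_bigr => k _.
  rewrite GE mulr_suml mulr_sumr; apply: eq_bigr => l _; ring.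
rewrite inner_raise.
under eq_bigr do rewrite mulr_suml.
rewrite exchange_big; apply: eq_bigr => j _.
under eq_bigr do rewrite mulr_suml.
rewrite exchange_big; apply: eq_bigr => k _; apply: eq_bigr => l _; ring.
Qed.

(** A Koszul formula in which horizontal lifts replace coordinate fields. The factor [4^-1] combines
    the 1/2 of the Christoffel symbols with g = [hess] / 2. *)
Lemma inner_Gamma (s a w : rV) :
  inner L z (\row_i \sum_j \sum_k s 0 j * (Gamma L i j k z * a 0 k)) w =
  4^-1 * (dd (hlift s) (hess w a) z + dd (hlift a) (hess s w) z -
          dd (hlift w) (hess s a) z).
Proof.
pose T j k l : R := 4^-1 * (dd (hlift (bv j)) (hess (bv l) (bv k)) z +
  dd (hlift (bv k)) (hess (bv j) (bv l)) z - dd (hlift (bv l)) (hess (bv j) (bv k)) z).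
have GE i j k : Gamma L i j k z = \sum_l ginv L i l z * T j k l.
  rewrite /Gamma mulr_sumr; apply: eq_bigr => l _.
  rewrite !deltaE; try exact: differentiable_glow.
  have h4 : 4^-1 = 2^-1 * 2^-1 :> R by rewrite -invfM -natrM.
  rewrite !derive_glow /T h4.
  move: (dd _ _ z) (dd _ _ z) (dd _ _ z) => A B C; ring.
rewrite (inner_raise3 _ _ _ GE).
have X := derive_hess_expand _ _ _ (fun a => hlift_sum a _).
have -> : dd (hlift s) (hess w a) z = \sum_j \sum_k \sum_l
    s 0 j * a 0 k * w 0 l * dd (hlift (bv j)) (hess (bv l) (bv k)) z.
  rewrite X; apply: eq_bigr => j _; rewrite exchange_big; apply: eq_bigr => k _.
  by apply: eq_bigr => l _; rewrite (mulrAC (s 0 j)).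
have -> : dd (hlift a) (hess s w) z = \sum_j \sum_k \sum_l
    s 0 j * a 0 k * w 0 l * dd (hlift (bv k)) (hess (bv j) (bv l)) z.
  rewrite X exchange_big; apply: eq_bigr => j _; apply: eq_bigr => k _.
  by apply: eq_bigr => l _; rewrite (mulrC (s 0 j)).
have -> : dd (hlift w) (hess s a) z = \sum_j \sum_k \sum_l
    s 0 j * a 0 k * w 0 l * dd (hlift (bv l)) (hess (bv j) (bv k)) z.
  rewrite X exchange_big; apply: eq_bigr => j _; rewrite exchange_big.
  apply: eq_bigr => k _; apply: eq_bigr => l _.
  by rewrite -[w 0 l * _ * _]mulrA (mulrC (w 0 l)).
rewrite -big_split -sumrB mulr_sumr; apply: eq_bigr => j _.
rewrite -big_split -sumrB mulr_sumr; apply: eq_bigr => k _.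
rewrite -big_split -sumrB mulr_sumr; apply: eq_bigr => l _; rewrite /T /=.
move: (dd _ _ z) (dd _ _ z) (dd _ _ z) => A B C; ring.
Qed.

Lemma inner_Cart (s a w : rV) :
  inner L z (\row_i \sum_j \sum_k s 0 j * (Cart L i j k z * a 0 k)) w =
  4^-1 * dd (vert w) (hess s a) z.
Proof.
pose T j k l : R := 4^-1 * dd (vert (bv l)) (hess (bv j) (bv k)) z.
have GE i j k : Cart L i j k z = \sum_l ginv L i l z * T j k l.
  rewrite /Cart mulr_sumr; apply: eq_bigr => l _.
  have h4 : 4^-1 = 2^-1 * 2^-1 :> R by rewrite -invfM -natrM.
  rewrite /dy ddE derive_glow /T h4.
  move: (dd _ _ z) => A; ring.
rewrite (inner_raise3 _ _ _ GE).
rewrite (derive_hess_expand _ _ _ (fun a => vert_lincomb a _)).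
rewrite [X in _ * X]exchange_big mulr_sumr; apply: eq_bigr => j _.
rewrite [X in _ * X]exchange_big mulr_sumr; apply: eq_bigr => k _.
rewrite mulr_sumr; apply: eq_bigr => l _; rewrite /T.
move: (dd _ _ z) => A; ring.
Qed.

Lemma inner_cartan (s : E -> rV) (xi : E) w : differentiable s z ->
  inner L z (cartan L s xi z) w = inner L z (dd xi s z) w +
  4^-1 * (dd (hlift (s z)) (hess w xi.1) z + dd (hlift xi.1) (hess (s z) w) z -
          dd (hlift w) (hess (s z) xi.1) z) +
  4^-1 * dd (vert w) (hess (s z) (ver L z xi)) z.
Proof.
move=> ds; rewrite -inner_Gamma -inner_Cart -!innerDl; congr inner.
apply/rowP => i; rewrite !mxE; rewrite -addrA; congr (_ + _).
  by rewrite -ddE; exact: (derive_frame_coord (B := row_frame n) xi i ds).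
rewrite -big_split; apply: eq_bigr => j _; rewrite -big_split; apply: eq_bigr => k _.
by rewrite /= -mulrDr.
Qed.

Lemma hor_hlift u v : (hlift u + vert v).1 = u.
Proof. by rewrite /= addr0. Qed.

Lemma ver_hlift u v : ver L z (hlift u + vert v) = v.
Proof.
apply/rowP => k; rewrite mxE hor_hlift /= !mxE.
rewrite [X in _ + X](eq_bigr (fun l => u 0 l * nonlin L k l z)); last first.
  by move=> l _; rewrite mulrC.
by rewrite addrAC addNr add0r.
Qed.

(** The Laplacian contracts with Gamma + C. This sum is a single Cartan derivative, in the direction
    whose horizontal and vertical parts are both [bv j], so [inner_cartan] can evaluate it. *)
Lemma cartan_cst (i j : 'I_n) :
  cartan L (cst (bv i)) (hlift (bv j) + vert (bv j)) z =
  \row_k (Gamma L k i j z + Cart L k i j z).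
Proof.
rewrite /cartan /hor hor_hlift ver_hlift; apply/rowP => k; rewrite !mxE.
rewrite derive_cst add0r (bigD1 i) //= [X in _ + X]big1 => [|l li]; last first.
  by apply: big1 => m _; rewrite mxE eqxx (negbTE li) mul0r.
rewrite addr0 (bigD1 j) //= big1 => [|l lj]; last first.
  by rewrite [bv j 0 l]mxE eqxx (negbTE lj) /= !mulr0 addr0 mulr0.
by rewrite !mxE !eqxx mul1r !mulr1 addr0.
Qed.

Lemma smooth_glow i j : smooth_at (glow L i j) z.
Proof.
have -> : glow L i j = (fun y => 2^-1 * hess (bv i) (bv j) y).
  by apply/funext => w; rewrite /glow mxE /dy /hess ddfE ddE.
by apply: smooth_atM; [exact: smooth_at_cst|exact: smooth_hess].
Qed.

Lemma smooth_det m (A : E -> 'M[R]_m) :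
  (forall i j, smooth_at (fun y => A y i j : R^o) z) ->
  smooth_at (fun y => \det (A y) : R^o) z.
Proof.
move=> As; apply: smooth_at_sum => s _; apply: smooth_atM; first exact: smooth_at_cst.
by apply: smooth_at_prod => i _; exact: As.
Qed.

(** Cramer's rule makes the entries rational in g. On singular matrices [invmx] returns its
    argument, so the formula is used only where the determinant is nonzero, which holds near [z]. *)
Lemma smooth_ginv i j : smooth_at (ginv L i j) z.
Proof.
have gs k l : smooth_at (fun y => gmx L y k l : R^o) z by exact: smooth_glow.
have ds : smooth_at (fun y => \det (gmx L y) : R^o) z by exact: smooth_det.
have d0 : \det (gmx L z) != 0 by have := gmx_unit; rewrite unitmxE unitfE.
have nd0 : \near z, \det (gmx L z) != 0.
  have dc := differentiable_continuous (smooth_at_differentiable ds).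
  by apply: (dc [set r | r != 0]); apply: open_nbhs_nbhs; split => //; exact: open_neq.
have H : smooth_at (fun y => (\det (gmx L y))^-1 * cofactor (gmx L y) j i : R^o) z.
  apply: smooth_atM; first exact: smooth_atV.
  apply: smooth_atM; first exact: smooth_at_cst.
  apply: smooth_det => k l.
  rewrite [X in smooth_at X _](_ : _ = fun y => gmx L y (lift j k) (lift i l)) //.
  by apply/funext => y; rewrite !mxE.
apply: near_eq_smooth_at H; apply: filterS nd0 => y y0.
by rewrite /ginv /invmx unitmxE unitfE y0 !mxE.
Qed.

Lemma smooth_grad (psi : rV -> R^o) : smooth_at psi z.1 -> smooth_at (grad L psi) z.
Proof.
move=> ps; apply/smooth_at_row => i.
rewrite [X in smooth_at X _](_ : _ = fun y => \sum_j ginv L i j y * dphi psi j y); last first.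
  by apply/funext => y; rewrite mxE.
apply: smooth_at_sum => j _; apply: smooth_atM; first exact: smooth_ginv.
apply: (@smooth_at_comp _ _ _ _ (row_frame n) real_frame fst ('D_(bv j) psi)).
  exact: smooth_at_fst.
exact: smooth_at_derive.
Qed.

End Point.
End Metric.

(** * The Schwarzian in terms of the gradient *)

Section Mobius.
Context {R : realType} {n : nat}.
Local Notation rV := 'rV[R]_n.
Local Notation E := ('rV[R]_n * 'rV[R]_n)%type.
Local Notation bv := (@basis_vec R n).
Implicit Types (u w a b v : rV) (z xi : E).

Lemma vert_is_diff u : differentiable (vert : rV -> E) u /\
  forall v, 'D_v (vert : rV -> E) u = vert v.
Proof.
apply: linear_is_diff; first exact: vert_linear.
move=> w; apply: differentiable_continuous; apply: smooth_at_differentiable.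
by apply: smooth_at_pair; [exact: (smooth_at_cst (0 : rV))|exact: smooth_at_id].
Qed.

Lemma horz_is_diff u : differentiable (horz : rV -> E) u /\
  forall v, 'D_v (horz : rV -> E) u = horz v.
Proof.
apply: linear_is_diff; first exact: horz_linear.
move=> w; apply: differentiable_continuous; apply: smooth_at_differentiable.
by apply: smooth_at_pair; [exact: smooth_at_id|exact: (smooth_at_cst (0 : rV))].
Qed.

Lemma differentiable_vert (X : E -> rV) z : differentiable X z ->
  differentiable (fun y => vert (X y)) z.
Proof.
by move=> dX; apply: (differentiable_comp dX); exact: (vert_is_diff _).1.
Qed.

Lemma differentiable_horz (X : E -> rV) z : differentiable X z ->
  differentiable (fun y => horz (X y)) z.
Proof.
by move=> dX; apply: (differentiable_comp dX); exact: (horz_is_diff _).1.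
Qed.

Lemma dd_vert (X : E -> rV) z xi : differentiable X z ->
  dd xi (fun y => vert (X y)) z = vert (dd xi X z).
Proof.
move=> dX; rewrite -!ddE -((vert_is_diff (X z)).2 ('D_xi X z)).
exact: (derive_comp xi dX (vert_is_diff _).1).
Qed.

Lemma dd_horz (X : E -> rV) z xi : differentiable X z ->
  dd xi (fun y => horz (X y)) z = horz (dd xi X z).
Proof.
move=> dX; rewrite -!ddE -((horz_is_diff (X z)).2 ('D_xi X z)).
exact: (derive_comp xi dX (horz_is_diff _).1).
Qed.

Lemma dd_vert_along (f : E -> R^o) (X : E -> rV) z xi :
  smooth_at f z -> differentiable X z ->
  dd xi (fun y => dd (vert (X y)) f y) z =
  dd (vert (dd xi X z)) f z + dd (vert (X z)) (dd xi f) z.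
Proof.
move=> fs dX.
rewrite (dd_along tangent_frame real_frame xi fs (differentiable_vert dX)).
by rewrite dd_vert.
Qed.

Lemma dd_horz_along W (B : frame W) (f : E -> W) (X : E -> rV) z xi :
  smooth_at f z -> differentiable X z ->
  dd xi (fun y => dd (horz (X y)) f y) z =
  dd (horz (dd xi X z)) f z + dd (horz (X z)) (dd xi f) z.
Proof.
move=> fs dX.
rewrite (dd_along tangent_frame B xi fs (differentiable_horz dX)).
by rewrite dd_horz.
Qed.

Lemma differentiable_snd z : differentiable (snd : E -> rV) z.
Proof. exact/smooth_at_differentiable/smooth_at_snd. Qed.

Lemma dd_snd z xi : dd xi (snd : E -> rV) z = xi.2.
Proof.
rewrite -ddE; apply: (linear_is_diff z _ _).2 => // y; exact: cvg_snd.
Qed.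

Lemma dd_comp (V W Z : normedModType R) (f : V -> W) (g : W -> Z) (x v : V) :
  differentiable f x -> differentiable g (f x) ->
  dd v (g \o f) x = dd (dd v f x) g (f x).
Proof. by move=> df dg; rewrite -!ddE; exact: derive_comp. Qed.

Lemma dd_comp_fst (W : normedModType R) (f : rV -> W) z xi : differentiable f z.1 ->
  dd xi (f \o fst : E -> W) z = dd xi.1 f z.1.
Proof.
move=> df; have [d1 D1] : differentiable (fst : E -> rV) z /\
    forall k : E, 'D_k (fst : E -> rV) z = k.1.
  by apply: linear_is_diff => // y; exact: cvg_fst.
by rewrite dd_comp // -[dd xi fst z]ddE D1.
Qed.

Lemma dd_pair (f : E -> R^o) z a b : differentiable f z ->
  dd (a, b) f z = dd (horz a) f z + dd (vert b) f z.
Proof. by move=> df; rewrite -ddD // /horz /vert pairD addr0 add0r. Qed.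

(* Here En = F^2, Psi(x, y) = psi(x) and V = grad psi.  The last two equations say
   g(V, y) = dpsi(y) and V^c (F^2) = 2 dpsi(y)^2 + 2 lam F^2, where V^c is the complete lift
   of the vector field V. *)
Definition mobius_data (En Psi : E -> R^o) (V : E -> rV) (lam : E -> R^o) z : Prop :=
  [/\ smooth_at V z, differentiable lam z,
      forall u, dd (vert u) V z = 0 /\ dd (vert u) lam z = 0,
      dd (vert (V z)) En z = 2 * dd (horz z.2) Psi z &
      dd (horz (V z)) En z + dd (vert (dd (horz z.2) V z)) En z =
        2 * (dd (horz z.2) Psi z) ^+ 2 + 2 * (lam z * En z)].

(** [V] and [lam] are witnesses rather than expressions in [En]: rescaled and pulled-back energies
    are handled without inverting their metrics. The data hold on a neighbourhood, so that the
    equations can be differentiated. *)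
Definition mobius_at (En Psi : E -> R^o) z :=
  exists V lam, \forall y \near z, mobius_data En Psi V lam y.

Lemma smooth_dd_along W (B : frame W) (f : E -> W) (X : E -> E) z :
  smooth_at f z -> smooth_at X z -> smooth_at (fun y => dd (X y) f y) z.
Proof.
move=> fs Xs; rewrite [X in smooth_at X _](_ : _ = fun y => 'D_(X y) f y).
  exact: (smooth_at_along tangent_frame B).
by apply/funext => y; rewrite ddE.
Qed.

Lemma smooth_vert (X : E -> rV) z : smooth_at X z -> smooth_at (fun y => vert (X y)) z.
Proof. by move=> Xs; apply: smooth_at_pair => //; exact: (smooth_at_cst (0 : rV)). Qed.

Lemma smooth_horz (X : E -> rV) z : smooth_at X z -> smooth_at (fun y => horz (X y)) z.
Proof. by move=> Xs; apply: smooth_at_pair => //; exact: (smooth_at_cst (0 : rV)). Qed.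

(** * The Schwarzian on an open subset of TM_0 *)

Section Open.
Variables (L : E -> R^o) (psi : rV -> R^o) (O : set E).
Hypothesis Oo : open O.
Hypothesis O0 : forall z, O z -> z.2 != 0.
Hypothesis Ls : forall z, O z -> smooth_at (energy L) z.
Hypothesis Lpos : forall z, O z -> forall u, u != 0 -> 0 < inner L z u u.
Hypothesis Leul : forall z, O z -> dd (vert z.2) (energy L) z = 2 * energy L z.
Hypothesis psis : forall z, O z -> smooth_at psi z.1.

Let En : E -> R^o := energy L.
Let Psi : E -> R^o := psi \o fst.
Let V : E -> rV := grad L psi.
Let e u : E -> R^o := dd (vert u) En.
Let Q : E -> R^o := fun z => dd (horz z.2) Psi z.

Lemma nearO z : O z -> \near z, O z.
Proof. by move=> Oz; apply: open_nbhs_nbhs. Qed.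

Lemma eqO_dd (W : normedModType R) (f g : E -> W) z xi :
  (forall y, O y -> f y = g y) -> O z -> dd xi f z = dd xi g z.
Proof. by move=> fg Oz; apply: near_eq_dd; apply: filterS (nearO Oz). Qed.

Lemma Lsn z : O z -> \near z, smooth_at (energy L) z.
Proof. by move=> Oz; apply: filterS (nearO Oz). Qed.

Lemma smooth_e z u : O z -> smooth_at (e u) z.
Proof. by move=> Oz; exact/smooth_at_dd/Ls. Qed.

Lemma smooth_V z : O z -> smooth_at V z.
Proof. by move=> Oz; exact: (smooth_grad (Ls Oz) (Lpos Oz) (psis Oz)). Qed.

Lemma smooth_Psi z : O z -> smooth_at Psi z.
Proof.
move=> Oz; apply: (smooth_at_comp (row_frame n) real_frame); first exact: smooth_at_fst.
exact: psis.
Qed.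

Lemma dd_Psi z xi : O z -> dd xi Psi z = dd xi.1 psi z.1.
Proof. by move=> Oz; exact/dd_comp_fst/smooth_at_differentiable/psis. Qed.

Lemma dd2_Psi z a w : O z -> dd (horz a) (dd (horz w) Psi) z = dd a (dd w psi) z.1.
Proof.
move=> Oz; rewrite (eqO_dd (g := dd w psi \o fst) _ (fun y Oy => dd_Psi (horz w) Oy) Oz).
by rewrite dd_comp_fst //; exact/smooth_at_differentiable/smooth_at_dd/psis.
Qed.

Lemma dd_vert_Psi z u : O z -> dd (vert u) Psi z = 0.
Proof. by move=> Oz; rewrite dd_Psi // dd0. Qed.

Lemma dd_vert_horz_Psi z u w : O z -> dd (vert u) (dd (horz w) Psi) z = 0.
Proof.
move=> Oz; rewrite (dd_sym real_frame _ _ (smooth_Psi Oz)).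
rewrite (eqO_dd (g := cst 0) _ (fun y Oy => dd_vert_Psi u Oy) Oz).
by rewrite -ddE derive_cst.
Qed.

Lemma dd_Q z xi : O z ->
  dd xi Q z = dd (horz xi.2) Psi z + dd (horz z.2) (dd xi Psi) z.
Proof.
move=> Oz; rewrite /Q.
rewrite (dd_horz_along real_frame xi (smooth_Psi Oz) (differentiable_snd z)).
by rewrite dd_snd.
Qed.

Lemma dd_vert_Q z u : O z -> dd (vert u) Q z = dd (horz u) Psi z.
Proof.
move=> Oz; rewrite dd_Q // (eqO_dd (g := cst 0) _ (fun y Oy => dd_vert_Psi u Oy) Oz).
by rewrite -[X in _ + X]ddE derive_cst addr0.
Qed.

(** Euler's relation for F^2, differentiated along [xi]. A horizontal derivative keeps the degree 2
    in y, a vertical one lowers it to 1. *)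
Lemma euler1 z xi : O z ->
  dd (vert z.2) (dd xi En) z = 2 * dd xi En z - dd (vert xi.2) En z.
Proof.
move=> Oz.
have : dd xi (fun y => dd (vert y.2) En y) z = dd xi (fun y => 2 * En y) z.
  exact: eqO_dd.
rewrite (dd_vert_along xi (Ls Oz) (differentiable_snd z)) dd_snd.
rewrite dd_scal; last exact/smooth_at_differentiable/Ls.
by move=> <-; rewrite addrC addKr.
Qed.

Lemma euler_vert z u : O z -> dd (vert z.2) (e u) z = e u z.
Proof. by move=> Oz; rewrite euler1 //=; rewrite mulr_natl mulr2n addrK. Qed.

Lemma euler_horz z u : O z -> dd (vert z.2) (dd (horz u) En) z = 2 * dd (horz u) En z.
Proof. by move=> Oz; rewrite euler1 //= vert0 dd0 subr0. Qed.

Lemma euler2 z xi u : O z ->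
  dd (vert z.2) (dd xi (e u)) z = dd xi (e u) z - dd (vert xi.2) (e u) z.
Proof.
move=> Oz.
have : dd xi (fun y => dd (vert y.2) (e u) y) z = dd xi (e u) z.
  by apply: eqO_dd => // y Oy; exact: euler_vert.
rewrite (dd_vert_along xi (smooth_e u Oz) (differentiable_snd z)) dd_snd.
by move=> <-; rewrite addrC addKr.
Qed.

(** By Euler's relation, applied twice, F^2 = g(y, y). The factor lambda is later obtained through
    division by this function. *)
Lemma energy_gt0 z : O z -> 0 < En z.
Proof.
move=> Oz; have := Lpos Oz (O0 Oz); rewrite (innerE (Ls Oz)).
by rewrite /hess -/En -/(e z.2) euler_vert // /e Leul // mulKf // pnatr_eq0.
Qed.

Lemma grad_hess z w : O z -> dd (vert (V z)) (e w) z = 2 * dd (horz w) Psi z.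
Proof.
move=> Oz; have := inner_grad (Ls Oz) (Lpos Oz) w (smooth_at_differentiable (psis Oz)).
rewrite (innerE (Ls Oz)) (dd_Psi _ Oz) /= => <-.
by rewrite mulrA divff ?mul1r // pnatr_eq0.
Qed.

(** The defining relation g(V, w) = dpsi(w), differentiated along [xi]; all information on
    derivatives of [V] is drawn from it. *)
Lemma dd_grad_hess z xi w : O z ->
  dd (vert (dd xi V z)) (e w) z + dd (vert (V z)) (dd xi (e w)) z =
  2 * dd xi (dd (horz w) Psi) z.
Proof.
move=> Oz; have : dd xi (fun y => dd (vert (V y)) (e w) y) z =
    dd xi (fun y => 2 * dd (horz w) Psi y) z.
  by apply: eqO_dd => // y Oy; exact: grad_hess.
rewrite (dd_vert_along xi (smooth_e w Oz) (smooth_at_differentiable (smooth_V Oz))).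
move=> ->; rewrite dd_scal //; exact/smooth_at_differentiable/smooth_at_dd/smooth_Psi.
Qed.

Lemma grad_energy z : O z -> dd (vert (V z)) En z = 2 * Q z.
Proof.
move=> Oz; rewrite -[LHS]/(e (V z) z) -euler_vert // /e.
rewrite (dd_sym real_frame _ _ (Ls Oz)); exact: grad_hess.
Qed.

(** * Gradients independent of y *)

Section VerticallyConstantGradient.
Hypothesis V0 : forall z, O z -> forall u, dd (vert u) V z = 0.

Let DV u : E -> rV := dd (horz u) V.
Let W : E -> R^o := fun z =>
  dd (horz (V z)) En z + dd (vert (dd (horz z.2) V z)) En z.

Lemma dd_V z xi : O z -> dd xi V z = DV xi.1 z.
Proof.
move=> Oz; rewrite {1}(horz_vert xi) ddD; last exact/smooth_at_differentiable/smooth_V.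
by rewrite V0 // addr0.
Qed.

Lemma dd_vert_DV z u w : O z -> dd (vert u) (DV w) z = 0.
Proof.
move=> Oz; rewrite (dd_sym (row_frame n) _ _ (smooth_V Oz)).
rewrite (eqO_dd (g := cst 0) _ (fun y Oy => V0 Oy u) Oz).
by rewrite -ddE derive_cst.
Qed.

Lemma smooth_DyV z : O z -> smooth_at (fun y => dd (horz y.2) V y) z.
Proof.
move=> Oz; apply: (smooth_dd_along (row_frame n)); first exact: smooth_V.
exact/smooth_horz/smooth_at_snd.
Qed.

Lemma dd_DyV z u : O z -> dd (vert u) (fun y => dd (horz y.2) V y) z = DV u z.
Proof.
move=> Oz.
rewrite (dd_horz_along (row_frame n) _ (smooth_V Oz) (differentiable_snd z)) dd_snd.
rewrite (dd_sym (row_frame n) _ _ (smooth_V Oz)) -/(DV z.2) dd_vert_DV //.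
by rewrite addr0.
Qed.

Lemma dd_W z u : O z -> dd (vert u) W z =
  dd (horz (V z)) (e u) z +
  (dd (vert (DV u z)) En z + dd (vert (dd (horz z.2) V z)) (e u) z).
Proof.
move=> Oz.
have dV := smooth_at_differentiable (smooth_V Oz).
have dDV := smooth_at_differentiable (smooth_DyV Oz).
have sE := Ls Oz.
have d1 : differentiable (fun y => dd (horz (V y)) En y) z.
  apply: smooth_at_differentiable; apply: (smooth_dd_along real_frame) => //.
  exact/smooth_horz/smooth_V.
have d2 : differentiable (fun y => dd (vert (dd (horz y.2) V y)) En y) z.
  apply: smooth_at_differentiable; apply: (smooth_dd_along real_frame) => //.
  exact/smooth_vert/smooth_DyV.
rewrite /W dd_add // (dd_horz_along real_frame _ sE dV) (dd_vert_along _ sE dDV).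
by rewrite V0 // horz0 dd0 add0r dd_DyV.
Qed.

(** This is C(V, b, w) = 0 up to a factor: in g(V, w) = dpsi(w) only the tensor g could depend on y,
    while the right side does not. *)
Lemma grad_hess2 z b w : O z -> dd (vert (V z)) (dd (vert b) (e w)) z = 0.
Proof.
move=> Oz; have := dd_grad_hess (vert b) w Oz.
by rewrite V0 // vert0 dd0 add0r dd_vert_horz_Psi // mulr0.
Qed.

Lemma dd_horz_Psi z xi w : O z ->
  dd xi (dd (horz w) Psi) z = dd (horz xi.1) (dd (horz w) Psi) z.
Proof.
move=> Oz; rewrite {1}(horz_vert xi) ddD; last first.
  exact/smooth_at_differentiable/smooth_at_dd/smooth_Psi.
by rewrite dd_vert_horz_Psi // addr0.
Qed.

Lemma hlift_hess_grad z a b : O z -> dd (hlift L z a) (hess L (V z) b) z =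
  2 * dd (horz a) (dd (horz b) Psi) z - dd (vert (DV a z)) (e b) z.
Proof.
move=> Oz; rewrite /hess -/En -/(e b) (dd_sym real_frame _ _ (smooth_e b Oz)).
have := dd_grad_hess (hlift L z a) b Oz.
by rewrite dd_horz_Psi // dd_V //= => <-; rewrite addrC addKr.
Qed.

(** The second derivatives of psi cancel by symmetry, and [b] drops out because the Cartan tensor
    annihilates [V]. What remains is half the Lie derivative of g along [V], except that the
    horizontal lift of [V] stands where its complete lift should be; [hlift_grad] repairs this. *)
Lemma inner_cartan_grad z a b w : O z ->
  inner L z (cartan L V (hlift L z a + vert b) z) w =
  4^-1 * (dd (vert (DV a z)) (e w) z + dd (vert (DV w z)) (e a) z +
          dd (hlift L z (V z)) (hess L w a) z).
Proof.
move=> Oz; have sV := smooth_at_differentiable (smooth_V Oz).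
rewrite (inner_cartan (Ls Oz) (Lpos Oz) (Lsn Oz)) // ver_hlift hor_hlift.
have -> : dd (vert w) (hess L (V z) b) z = 0.
  rewrite /hess -/En -/(e b) (dd_sym real_frame _ _ (smooth_e b Oz)).
  exact: grad_hess2.
rewrite mulr0 addr0 (innerE (Ls Oz)) dd_V // hor_hlift.
rewrite hlift_hess_grad // [dd (hlift L z w) _ z]hlift_hess_grad // (dd_sym real_frame (horz w) (horz a) (smooth_Psi Oz)).
have h2 : 2^-1 = 4^-1 + 4^-1 :> R by lra.
rewrite /hess -/En -/(e w) h2.
move: (dd (hlift _ _ _) _ z) (dd (horz a) _ z) (dd _ (e a) z) (dd _ (e w) z) => A B C D.
ring.
Qed.

Let mu z : R := n%:R^-1 * (laplacian L psi z - grad_sqnorm L psi z).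

Lemma inner_schwarzian z a b w : O z ->
  inner L z (local_schwarzian L psi (hlift L z a + vert b) z) w =
  4^-1 * (dd (vert (DV a z)) (e w) z + dd (vert (DV w z)) (e a) z +
          dd (hlift L z (V z)) (hess L w a) z)
  - dd (horz a) Psi z * dd (horz w) Psi z - mu z * (2^-1 * hess L a w z).
Proof.
move=> Oz; rewrite /local_schwarzian /hor hor_hlift !innerDl !innerNl !innerZl.
rewrite inner_cartan_grad // !(inner_grad (Ls Oz) (Lpos Oz)); last 2 first.
- exact/smooth_at_differentiable/psis.
- exact/smooth_at_differentiable/psis.
by rewrite !(dd_Psi _ Oz) /= (innerE (Ls Oz)).
Qed.

(** [e u] has degree 1 in y, so its vertical derivatives have degree 0 and are killed by the
    derivative along y. Hence contraction with y leaves no trace of the nonlinear connection. *)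
Lemma dd_horz_V_hess z w u : O z ->
  dd (vert z.2) (dd (hlift L z (V z)) (e u)) z = dd (horz (V z)) (e u) z.
Proof.
move=> Oz; rewrite euler2 // {1}(horz_vert (hlift L z (V z))) ddD ?addrK //.
exact/smooth_at_differentiable/smooth_e.
Qed.

(** Contraction with y assembles the three Lie derivative terms into the vertical derivative of the
    single function [W] = V^c(F^2). *)
Lemma inner_schwarzian_euler z a b : O z ->
  inner L z (local_schwarzian L psi (hlift L z a + vert b) z) z.2 =
  4^-1 * dd (vert a) W z - dd (horz a) Psi z * Q z - mu z * (2^-1 * e a z).
Proof.
move=> Oz; rewrite inner_schwarzian // dd_W //.
rewrite (hessC (Ls Oz)) /hess -/En -/(e a) euler_vert //.
rewrite (dd_sym real_frame _ _ (smooth_e a Oz)) dd_horz_V_hess //.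
rewrite {1}/e (dd_sym real_frame _ _ (Ls Oz)) -/En -/(e (DV a z)) euler_vert //.
by congr (4^-1 * _ - _ - _); exact: addrC.
Qed.

(** Both summands of [W] inherit degree 2 in y from F^2, so [W] can be recovered from its vertical
    derivatives. *)
Lemma gradient_energy z : O z ->
  dd (vert z.2) W z = 2 * W z.
Proof.
move=> Oz; rewrite dd_W // /W mulrDr.
rewrite (dd_sym real_frame (horz (V z)) _ (Ls Oz)) euler_horz //.
rewrite (dd_sym real_frame _ (vert z.2) (Ls Oz)) -/En -/(e (dd (horz z.2) V z)).
by rewrite euler_vert //; congr (_ + _); rewrite mulr_natl mulr2n.
Qed.

End VerticallyConstantGradient.

Lemma hlift_surj z xi : xi = hlift L z xi.1 + vert (xi.2 - (hlift L z xi.1).2).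
Proof.
case: xi => p q; rewrite /vert [RHS]surjective_pairing /=; congr pair.
  by rewrite addr0.
by rewrite addrC subrK.
Qed.

Lemma inner0l z w : inner L z 0 w = 0.
Proof. by rewrite -(scale0r 0) innerZl mul0r. Qed.

(* On vertical vectors the Schwarzian is, up to a factor, the vertical derivative of grad psi. *)
Lemma schwarzian_vert z : O z ->
  (forall xi, local_schwarzian L psi xi z = 0) -> forall u, dd (vert u) V z = 0.
Proof.
move=> Oz S0 b; apply: (inner_inj (Lpos Oz)) => w; rewrite inner0l.
have := congr1 (inner L z ^~ w) (S0 (hlift L z 0 + vert b)).
have sV := smooth_at_differentiable (smooth_V Oz).
rewrite /= inner0l /local_schwarzian /hor hor_hlift !scaler0 !subr0.
have l0 : hlift L z 0 = 0.
  have := hlift_sum L z (fun i : 'I_0 => 0) (fun _ => 0); rewrite !big_ord0; exact.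
have inner00 : inner L z (V z) 0 = 0 by rewrite (inner_sym (Ls Oz)) inner0l.
rewrite inner00 scale0r subr0 (inner_cartan (Ls Oz) (Lpos Oz) (Lsn Oz)) //.
rewrite ver_hlift hor_hlift l0 dd0 add0r /hess vert0.
have z0 (f : E -> R^o) : dd 0 f = cst 0 :> (E -> R^o).
  by apply/funext => y; rewrite dd0.
have c0 xi : dd xi (cst 0 : E -> R^o) = cst 0.
  by apply/funext => y; rewrite -ddE derive_cst.
rewrite !z0 !c0 /= add0r subr0 mulr0 addr0 -/En -/V -/(e b).
(* By the vertical derivative of g(V, w) = dpsi(w), the Cartan term contributes minus one half of
   the derivative term. One half of it survives, which is the factor in question. *)
have -> : dd (vert w) (dd (vert (V z)) (e b)) z = - (2 * inner L z (dd (vert b) V z) w).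
  rewrite (dd_sym real_frame _ _ (smooth_e b Oz)).
  have := dd_grad_hess (vert b) w Oz.
  rewrite dd_vert_horz_Psi // mulr0 (innerE (Ls Oz)) /e.
  rewrite -/(hess L b w) (derive_hessC (Lsn Oz)) => /eqP; rewrite addrC addr_eq0 => /eqP ->.
  by rewrite mulrA divff ?mul1r ?pnatr_eq0.
move: (inner _ _ _ _) => A; lra.
Qed.

Lemma schwarzian_mobius :
  (forall z, O z -> forall xi, local_schwarzian L psi xi z = 0) ->
  forall z, O z -> mobius_at En Psi z.
Proof.
move=> S0 z0 Oz0.
have V0 z : O z -> forall u, dd (vert u) V z = 0.
  by move=> Oz; apply: schwarzian_vert => //; exact: S0.
pose W : E -> R^o := fun z => dd (horz (V z)) En z + dd (vert (dd (horz z.2) V z)) En z.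
pose mu z : R := n%:R^-1 * (laplacian L psi z - grad_sqnorm L psi z).
have H1 z u : O z -> dd (vert u) W z = 4 * (dd (horz u) Psi z * Q z) + 2 * (mu z * e u z).
  move=> Oz; have := inner_schwarzian_euler V0 u 0 Oz.
  rewrite S0 // inner0l -/W -/(mu z);  rewrite mulrCA.
  by move: (dd _ W z) (mu z * _) (_ * Q z) => A m p h; lra.
(* Second contraction: [u] = y in [H1], with Euler's relation for [W] and for F^2. *)
have W2 z : O z -> W z = 2 * Q z ^+ 2 + 2 * (mu z * En z).
  move=> Oz; have := H1 z z.2 Oz; rewrite (gradient_energy V0) // -/(Q z) /e Leul //.
  rewrite expr2 -/(W z) -/En (mulrCA (mu z)).
  by move: (W z) (Q z * Q z) (mu z * En z) => A q m h; lra.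
pose lam : E -> R^o := fun z => (W z - 2 * (Q z * Q z)) * (2 * En z)^-1.
(* [mu] is written with the Laplacian, hence with Gamma and C. Solving [W2] for it gives a quotient
   [lam] of functions already known to be smooth. *)
have lamE z : O z -> lam z = mu z.
  move=> Oz; have E0 := energy_gt0 Oz; rewrite /lam W2 // expr2 addrC addKr.
  by rewrite mulrCA mulfK // mulf_neq0 ?pnatr_eq0 // gt_eqF.
have sW z : O z -> smooth_at W z.
  move=> Oz; apply: smooth_atD; apply: (smooth_dd_along real_frame); try exact: Ls.
    exact/smooth_horz/smooth_V.
  exact/smooth_vert/smooth_DyV.
have sQ z : O z -> smooth_at Q z.
  move=> Oz; apply: (smooth_dd_along real_frame); first exact: smooth_Psi.
  exact/smooth_horz/smooth_at_snd.
have slam z : O z -> smooth_at lam z.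
  move=> Oz; apply: smooth_atM.
    apply: smooth_atD; first exact: sW.
    apply: smooth_atN; apply: smooth_atM; first exact: smooth_at_cst.
    by apply: smooth_atM; exact: sQ.
  apply: smooth_atV; first by rewrite mulf_neq0 ?pnatr_eq0 // gt_eqF // energy_gt0.
  by apply: smooth_atM; [exact: smooth_at_cst|exact: Ls].
exists V, lam; apply: filterS (nearO Oz0) => z Oz; split.
- exact: smooth_V.
- exact/smooth_at_differentiable/slam.
- move=> u; split; first exact: V0.
  have E0 := energy_gt0 Oz.
  have dl := smooth_at_differentiable (slam z Oz).
  have dE := smooth_at_differentiable (Ls Oz).
  have dQ := smooth_at_differentiable (sQ z Oz).
  (* Differentiating [W2] reproduces [H1] plus one extra term, F^2 times the vertical derivative of
     [lam]. Since F^2 > 0, that derivative vanishes. *)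
  have : dd (vert u) W z = dd (vert u) (fun y => 2 * (Q y * Q y) + 2 * (lam y * En y)) z.
    by apply: eqO_dd => // y Oy; rewrite W2 // lamE // expr2.
  rewrite H1 // dd_add; [|apply: differentiable_scal; exact: differentiableM..].
  rewrite !dd_scal; [|exact: differentiableM..].
  rewrite (dd_mul _ dQ dQ) (dd_mul _ dl dE) dd_vert_Q // lamE // -/(e u).
  rewrite [dd _ Psi z * _]mulrC -/(En z).
  move: (Q z * _) (mu z * _) => p q h.
  have /eqP : En z * dd (vert u) lam z = 0.
    by move: h; move: (En z * _) => r h; lra.
  by rewrite mulf_eq0 (gt_eqF E0) => /eqP.
- exact: grad_energy.
- by rewrite -/(W z) -/(Q z) lamE // W2.
Qed.

(** * From the conditions on the gradient back to the Schwarzian *)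

Section MobiusConditions.
Hypothesis V0 : forall z, O z -> forall u, dd (vert u) V z = 0.
Variable lam : E -> R^o.
Hypothesis dlam : forall z, O z -> differentiable lam z.
Hypothesis lam0 : forall z, O z -> forall u, dd (vert u) lam z = 0.

Let DV u : E -> rV := dd (horz u) V.
Let W : E -> R^o := fun z =>
  dd (horz (V z)) En z + dd (vert (dd (horz z.2) V z)) En z.

Hypothesis WE : forall z, O z -> W z = 2 * Q z ^+ 2 + 2 * (lam z * En z).

Lemma smooth_Q z : O z -> smooth_at Q z.
Proof.
move=> Oz; apply: (smooth_dd_along real_frame); first exact: smooth_Psi.
exact/smooth_horz/smooth_at_snd.
Qed.

Lemma dd_WE z u : O z ->
  dd (vert u) W z = 4 * (dd (horz u) Psi z * Q z) + 2 * (lam z * e u z).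
Proof.
move=> Oz; have dE := smooth_at_differentiable (Ls Oz).
have dQ := smooth_at_differentiable (smooth_Q Oz).
have -> : dd (vert u) W z = dd (vert u) (fun y => 2 * (Q y * Q y) + 2 * (lam y * En y)) z.
  by apply: eqO_dd => // y Oy; rewrite WE // expr2.
have dl := dlam Oz.
rewrite dd_add; [|apply: differentiable_scal; exact: differentiableM..].
rewrite !dd_scal; [|exact: differentiableM..].
rewrite (dd_mul _ dQ dQ) (dd_mul _ dl dE) dd_vert_Q // lam0 // mulr0 addr0.
rewrite [dd _ Psi z * _]mulrC -/(e u).
by move: (Q z * _) (lam z * _) => p q; lra.
Qed.

(** Polarisation: the vertical Hessian of the identity for [W] undoes the contraction with y. As [V]
    and [lam] do not depend on y, their derivatives do not appear; D_y V is linear in y and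
    contributes the two mixed terms. *)
Lemma dd_WE2 z u w : O z ->
  dd (horz (V z)) (dd (vert w) (e u)) z +
  (dd (vert (DV u z)) (e w) z +
   (dd (vert (DV w z)) (e u) z + dd (vert (dd (horz z.2) V z)) (dd (vert w) (e u)) z)) =
  4 * (dd (horz u) Psi z * dd (horz w) Psi z) + 2 * (lam z * dd (vert w) (e u) z).
Proof.
move=> Oz; have sE := Ls Oz; have se := smooth_e u Oz.
have dV := smooth_at_differentiable (smooth_V Oz).
have dDV := smooth_at_differentiable (smooth_DyV Oz).
have sDu : smooth_at (DV u) z by exact/smooth_at_dd/smooth_V.
have dDu := smooth_at_differentiable sDu.
have dQ := smooth_at_differentiable (smooth_Q Oz).
have dPu : differentiable (dd (horz u) Psi) z.
  exact/smooth_at_differentiable/smooth_at_dd/smooth_Psi.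
have dl := dlam Oz; have de := smooth_at_differentiable se.
have : dd (vert w) (fun y => dd (horz (V y)) (e u) y +
    (dd (vert (DV u y)) En y + dd (vert (dd (horz y.2) V y)) (e u) y)) z =
    dd (vert w) (fun y => 4 * (dd (horz u) Psi y * Q y) + 2 * (lam y * e u y)) z.
  by apply: eqO_dd => // y Oy; rewrite -(dd_W V0) // dd_WE.
have d1 : differentiable (fun y => dd (horz (V y)) (e u) y) z.
  apply: smooth_at_differentiable; apply: (smooth_dd_along real_frame) => //.
  exact/smooth_horz/smooth_V.
have d2 : differentiable (fun y => dd (vert (DV u y)) En y) z.
  apply: smooth_at_differentiable; apply: (smooth_dd_along real_frame) => //.
  exact/smooth_vert.
have d3 : differentiable (fun y => dd (vert (dd (horz y.2) V y)) (e u) y) z.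
  apply: smooth_at_differentiable; apply: (smooth_dd_along real_frame) => //.
  exact/smooth_vert/smooth_DyV.
rewrite (dd_add _ d1 (differentiableD d2 d3)) (dd_add _ d2 d3).
rewrite (dd_horz_along real_frame _ se dV) (dd_vert_along _ sE dDu) (dd_vert_along _ se dDV).
rewrite V0 // horz0 dd0 add0r (dd_vert_DV V0) // vert0 dd0 add0r (dd_DyV V0) //.
move=> ->.
rewrite dd_add; [|apply: differentiable_scal; exact: differentiableM..].
rewrite !dd_scal; [|exact: differentiableM..].
rewrite (dd_mul _ dPu dQ) (dd_mul _ dl de) dd_vert_Q // lam0 // mulr0 addr0.
by rewrite dd_vert_horz_Psi // mulr0 addr0.
Qed.

Let G : E -> rV := fun z => \row_i spray L i z.

Lemma smooth_spray z i : O z -> smooth_at (spray L i) z.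
Proof.
move=> Oz; apply: smooth_atM; first exact: smooth_at_cst.
apply: smooth_at_sum => l _; apply: smooth_atM; first exact: (smooth_ginv (Ls Oz) (Lpos Oz)).
apply: smooth_atD; last first.
  by apply: smooth_atN; exact/smooth_at_derive/Ls.
apply: smooth_at_sum => k _; apply: smooth_atM.
  exact/smooth_at_derive/smooth_at_derive/Ls.
exact: (smooth_at_row _ _).1 (smooth_at_snd z) k.
Qed.

(** The Euler-Lagrange form of the spray, with its index lowered so that it can be differentiated
    without touching [ginv]. *)
Lemma spray_hess z w : O z ->
  2 * dd (vert (G z)) (e w) z = dd (horz z.2) (e w) z - dd (horz w) En z.
Proof.
move=> Oz.
have : inner L z (G z) w = 4^-1 * (dd (horz z.2) (e w) z - dd (horz w) En z).
  have -> : G z = \row_i \sum_l ginv L i l z *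
     (4^-1 * (\sum_k dy l (dx k En) z * z.2 0 k - dx l En z)).
    apply/rowP => i; rewrite !mxE /spray mulr_sumr; apply: eq_bigr => l _.
    by rewrite mulrCA.
  have D l k : dy l (dx k En) z = dd (horz (bv k)) (e (bv l)) z.
    by rewrite /dy /dx ddfE ddE; exact: (dd_sym real_frame _ _ (Ls Oz)).
  have S l : dx l En z = dd (horz (bv l)) En z by rewrite /dx ddE.
  rewrite (inner_raise (Ls Oz) (Lpos Oz)).
  have dE := smooth_at_differentiable (Ls Oz).
  have -> : dd (horz w) En z = \sum_l w 0 l * dx l En z.
    rewrite {1}(row_basisE w) dir_horz_sum //.
    by apply: eq_bigr => l _; rewrite S.
  have -> : dd (horz z.2) (e w) z = \sum_l w 0 l * \sum_k dy l (dx k En) z * z.2 0 k.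
    rewrite -(dd_sym real_frame _ _ (Ls Oz)) {1}(row_basisE w) dir_vert_sum; last first.
      exact/smooth_at_differentiable/smooth_at_dd/Ls.
    apply: eq_bigr => l _; congr (_ * _).
    rewrite (dd_sym real_frame _ _ (Ls Oz)) {1}(row_basisE z.2) dir_horz_sum; last first.
      exact/smooth_at_differentiable/smooth_e.
    by apply: eq_bigr => k _; rewrite D mulrC.
  rewrite -sumrB mulr_sumr; apply: eq_bigr => l _; rewrite -mulrBr.
  by rewrite -mulrA; congr (_ * _); rewrite mulrC.
rewrite (innerE (Ls Oz)) /hess -/En -/(e w).
by move: (dd (horz w) En z) (dd (vert (G z)) (e w) z) (dd (horz z.2) (e w) z) => A B C h; lra.
Qed.

(** The right side is the derivative along the complete lift (V, D_y V). It differs from the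
    horizontal lift by a vertical vector in the span of V and y, and vertical derivatives of g along
    V and y vanish: the first by [grad_hess2], the second by homogeneity. *)
Lemma hlift_grad z u w : O z ->
  dd (hlift L z (V z)) (dd (vert w) (e u)) z =
  dd (horz (V z)) (dd (vert w) (e u)) z +
  dd (vert (dd (horz z.2) V z)) (dd (vert w) (e u)) z.
Proof.
move=> Oz.
have sG : smooth_at G z.
  apply/smooth_at_row => i.
  rewrite [X in smooth_at X _](_ : _ = spray L i); first exact: smooth_spray.
  by apply/funext => y; rewrite mxE.
have dG := smooth_at_differentiable sG.
have dhess b c : differentiable (dd (vert b) (e c)) z.
  exact/smooth_at_differentiable/smooth_at_dd/smooth_e.
pose N := dd (vert (V z)) G z.
have NE : hlift L z (V z) = horz (V z) - vert N.
  rewrite /hlift /horz /vert; congr pair => /=; first by rewrite subr0.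
  rewrite add0r; congr (- _); apply/rowP => m; rewrite mxE.
  have -> : N 0 m = dd (vert (V z)) (spray L m) z.
    rewrite /N -!ddE.
    apply: (etrans (esym (derive_frame_coord (B := row_frame n) _ m dG))).
    have -> : frame_coord (row_frame n) m \o G = spray L m; last by [].
    by apply/funext => y; rewrite /= mxE.
  rewrite {2}(row_basisE (V z)) dir_vert_sum; last exact/smooth_at_differentiable/smooth_spray.
  by apply: eq_bigr => l _; rewrite /nonlin /dy ddE.
(* Paired with [c], this is a linear combination of derivatives of known equations: [h1] of the
   spray equation along V, [h3] of g(V, c) = dpsi(c) along y, [h4] of dE(0, V) = 2 dpsi(y) along
   [c], and [h5] of the equation for [W] along vertical [c]. *)
have ND : N + dd (horz z.2) V z = Q z *: V z + lam z *: z.2.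
  apply: (inner_inj (Lpos Oz)) => c; rewrite !innerDl !innerZl !(innerE (Ls Oz)).
  rewrite /hess -/En -/(e c) grad_hess // euler_vert //.
  have h1 : 2 * (dd (vert N) (e c) z + dd (vert (G z)) (dd (vert (V z)) (e c)) z) =
      dd (horz (V z)) (e c) z + dd (horz z.2) (dd (vert (V z)) (e c)) z -
      dd (vert (V z)) (dd (horz c) En) z.
    have : dd (vert (V z)) (fun y => 2 * dd (vert (G y)) (e c) y) z =
        dd (vert (V z)) (fun y => dd (horz y.2) (e c) y - dd (horz c) En y) z.
      by apply: eqO_dd => // y Oy; exact: spray_hess.
    have d1 : differentiable (fun y => dd (vert (G y)) (e c) y) z.
      apply: smooth_at_differentiable; apply: (smooth_dd_along real_frame).
        exact: smooth_e.
      exact/smooth_vert.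
    have d2 : differentiable (fun y => dd (horz y.2) (e c) y) z.
      apply: smooth_at_differentiable; apply: (smooth_dd_along real_frame).
        exact: smooth_e.
      exact/smooth_horz/smooth_at_snd.
    rewrite (dd_scal _ _ d1) (dd_vert_along _ (smooth_e c Oz) dG).
    rewrite (dd_sub _ d2); last exact/smooth_at_differentiable/smooth_at_dd/Ls.
    by rewrite (dd_horz_along real_frame _ (smooth_e c Oz) (differentiable_snd z)) dd_snd.
  have h2 : dd (vert (G z)) (dd (vert (V z)) (e c)) z = 0.
    by rewrite (dd_sym real_frame _ _ (smooth_e c Oz)) (grad_hess2 V0).
  have h3 := dd_grad_hess (horz z.2) c Oz.
  rewrite (dd_sym real_frame (vert (V z)) _ (smooth_e c Oz)) in h3.
  have h4 : dd (vert (DV c z)) En z + dd (vert (V z)) (dd (horz c) En) z =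
      2 * dd (horz z.2) (dd (horz c) Psi) z.
    have : dd (horz c) (fun y => dd (vert (V y)) En y) z = dd (horz c) (fun y => 2 * Q y) z.
      by apply: eqO_dd => // y Oy; exact: grad_energy.
    have dQ := smooth_at_differentiable (smooth_Q Oz).
    rewrite (dd_vert_along _ (Ls Oz) (smooth_at_differentiable (smooth_V Oz))).
    by rewrite (dd_scal _ _ dQ) dd_Q // horz0 dd0 add0r.
  have h5 := dd_WE c Oz; rewrite (dd_W V0) // in h5.
  rewrite h2 addr0 in h1; rewrite -/(DV c) in h5.
  rewrite [Q z * _]mulrCA [Q z * _]mulrC [lam z * _]mulrCA -mulrA.
  move: h1 h3 h4 h5; rewrite -/(DV z.2).
  move: (dd (vert N) (e c) z) (dd (vert (DV z.2 z)) (e c) z) (dd (horz (V z)) (e c) z).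
  move: (dd (horz z.2) (dd (vert (V z)) (e c)) z) (dd (vert (V z)) (dd (horz c) En) z).
  move: (dd (horz z.2) (dd (horz c) Psi) z) (dd (vert (DV c z)) En z).
  move: (_ * Q z) (lam z * _) => x1 x2 x3 x4 x5 x6 x7 x8 x9 h1 h3 h4 h5.
  lra.
have H0 : dd (vert (N + dd (horz z.2) V z)) (dd (vert w) (e u)) z = 0.
  rewrite ND vertD !vertZ ddD // !ddZ // (grad_hess2 V0) // euler2 //= subrr.
  by rewrite !scaler0 addr0.
rewrite NE ddD // ddN //; congr (_ + _); apply/eqP; rewrite eq_sym -addr_eq0 addrC.
by rewrite -ddD // -vertD H0.
Qed.

(** Once [hlift_grad] has replaced the horizontal lift, the bracket of [inner_cartan_grad] is the
    left side of [dd_WE2]. This is the Schwarzian equation with [lam] in place of its scalar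
    factor. *)
Lemma schwarzian_inner0 z a b w : O z ->
  inner L z (cartan L V (hlift L z a + vert b) z) w =
  inner L z (dd (horz a) Psi z *: V z + lam z *: a) w.
Proof.
move=> Oz; rewrite (inner_cartan_grad V0) // /hess -/En -/(e a) hlift_grad //.
have H := dd_WE2 a w Oz.
rewrite innerDl !innerZl !(innerE (Ls Oz)) /hess -/En -/(e w) grad_hess //.
rewrite [dd (vert a) (e w) z](dd_sym real_frame _ _ (Ls Oz)) -/En -/(e a).
rewrite [dd _ Psi z * _]mulrCA [dd _ Psi z * _]mulrCA [lam z * _]mulrCA.
move: H; rewrite /= -/(DV a) -/(DV w).
move: (dd (vert (DV a z)) (e w) z) (dd (vert (DV w z)) (e a) z) => x1 x2.
move: (dd (horz (V z)) _ z) (dd (vert (dd (horz z.2) V z)) _ z) => x3 x4.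
move: (lam z * _) (_ * dd _ Psi z) => x5 x6 h; lra.
Qed.

(** Since dpsi = g(V, .), the connection terms are the pairing with [V] of a Cartan derivative of
    the constant section [bv i]. Its vertical part vanishes by [grad_hess2], and its horizontal part
    is tied to the derivative of [V], known from [schwarzian_inner0]. *)
Lemma hessian_grad z (i j : 'I_n) : O z ->
  ddphi psi i j z - \sum_k (Gamma L k i j z + Cart L k i j z) * dphi psi k z =
  dphi psi i z * dphi psi j z + lam z * gmx L z i j.
Proof.
move=> Oz.
have -> : \sum_k (Gamma L k i j z + Cart L k i j z) * dphi psi k z =
    inner L z (cartan L (cst (bv i)) (hlift L z (bv j) + vert (bv j)) z) (V z).
  rewrite cartan_cst (inner_sym (Ls Oz)).
  rewrite (inner_grad (Ls Oz) (Lpos Oz)); last exact/smooth_at_differentiable/psis.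
  rewrite -derive_rowE; last exact/smooth_at_differentiable/psis.
  by apply: eq_bigr => k _; rewrite mxE mulrC /dphi ddE.
rewrite (inner_cartan (Ls Oz) (Lpos Oz) (Lsn Oz)); last exact: differentiable_cst.
rewrite hor_hlift ver_hlift /= -[dd _ (cst _) z]ddE derive_cst inner0l add0r.
have -> : dd (vert (V z)) (hess L (bv i) (bv j)) z = 0 by exact: grad_hess2.
rewrite mulr0 addr0 [dd (hlift L z (bv j)) _ z](derive_hessC (Lsn Oz)).
rewrite !(hlift_hess_grad V0) //.
have := schwarzian_inner0 (bv j) 0 (bv i) Oz.
rewrite (inner_cartan_grad V0) // innerDl !innerZl (inner_grad (Ls Oz) (Lpos Oz)); last first.
  exact/smooth_at_differentiable/psis.
rewrite (inner_sym (Ls Oz)) (innerE (Ls Oz)) -gmxE.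
rewrite dd_Psi // /ddphi ddfE ddE -dd2_Psi // /dphi !ddE /=.
rewrite (dd_sym real_frame (horz (bv j)) _ (smooth_Psi Oz)).
rewrite [_ * dd (bv i) psi z.1]mulrC.
move: (dd (horz (bv i)) _ z) (dd (vert (DV (bv i) z)) _ z) (dd (vert (DV (bv j) z)) _ z).
move: (dd (hlift _ _ _) _ z) (dd (bv i) psi z.1 * _) (lam z * _) => x1 x2 x3 x4 x5 x6 h.
lra.
Qed.

(** The trace of [hessian_grad], with g^{ij} g_{ij} = n, identifies the witness [lam] with the
    scalar of the Schwarzian. Division by [n] is legitimate: a nonzero vector [z.2] excludes
    dimension 0. *)
Lemma laplacian_grad z : O z ->
  n%:R^-1 * (laplacian L psi z - grad_sqnorm L psi z) = lam z.
Proof.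
move=> Oz; have n0 : n%:R != 0 :> R.
  rewrite pnatr_eq0; apply: contraNneq (O0 Oz) => n0.
  by apply/eqP/rowP => i; have := ltn_ord i; rewrite {2}n0.
suff -> : laplacian L psi z = grad_sqnorm L psi z + n%:R * lam z.
  by rewrite addrC addKr mulKf.
rewrite /laplacian /grad_sqnorm.
have -> : n%:R * lam z = \sum_i \sum_j ginv L i j z * (lam z * gmx L z i j).
  rewrite mulr_natl -[X in _ *+ X](card_ord n) -sumr_const; apply: eq_bigr => i _.
  have h : \sum_j gmx L z i j * ginv L j i z = 1 by rewrite ginv_gmx ?eqxx //; exact: Lpos.
  rewrite -[LHS]mulr1 -h mulr_sumr; apply: eq_bigr => j _.
  by rewrite (ginv_sym (Ls Oz) j i); ring.
rewrite -big_split; apply: eq_bigr => i _; rewrite -big_split; apply: eq_bigr => j _ /=.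
by rewrite hessian_grad // mulrDr; congr (_ + _); exact: mulrA.
Qed.

Lemma schwarzian_eq0_on z xi : O z -> local_schwarzian L psi xi z = 0.
Proof.
move=> Oz; rewrite (hlift_surj z xi); apply: (inner_inj (Lpos Oz)) => w.
rewrite inner0l /local_schwarzian /hor hor_hlift !innerDl !innerNl schwarzian_inner0 //.
rewrite laplacian_grad // innerDl !innerZl.
rewrite (inner_grad (Ls Oz) (Lpos Oz) xi.1); last exact/smooth_at_differentiable/psis.
by rewrite dd_Psi // -addrA -opprD subrr.
Qed.

End MobiusConditions.

End Open.

(** * From germs of data to the Schwarzian at a point *)

Section Germ.
Variables (L : E -> R^o) (psi : rV -> R^o) (O : set E).
Hypothesis Oo : open O.
Hypothesis O0 : forall z, O z -> z.2 != 0.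
Hypothesis Ls : forall z, O z -> smooth_at (energy L) z.
Hypothesis Lpos : forall z, O z -> forall u, u != 0 -> 0 < inner L z u u.
Hypothesis Leul : forall z, O z -> dd (vert z.2) (energy L) z = 2 * energy L z.
Hypothesis psis : forall z, O z -> smooth_at psi z.1.

Lemma mobius_schwarzian z xi : O z -> mobius_at (energy L) (psi \o fst) z ->
  local_schwarzian L psi xi z = 0.
Proof.
move=> Oz [V [lam M]].
pose P : set E := [set y | mobius_data (energy L) (psi \o fst) V lam y].
(* The data hold near [z] only; shrinking to this open set turns them into identities that can be
   differentiated throughout. *)
pose U := O `&` P°.
have Uo : open U by apply: openI => //; exact: open_interior.
have UO y : U y -> O y by case.
have UP y : U y -> P y by case=> _; exact: interior_subset.
have Uz : U z by split.
(* The vertical derivative of dE(0, V) = 2 dpsi(y), with V free of y, is g(V, w) = dpsi(w). So the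
   witness is the gradient. *)
have Vgrad y : U y -> grad L psi y = V y.
  move=> Uy; have Oy := UO _ Uy; have [sV _ c1 c2 _] := UP _ Uy.
  apply: (inner_inj (Lpos Oy)) => w; apply/esym.
  rewrite (innerE (Ls Oy)) (inner_grad (Ls Oy) (Lpos Oy)); last first.
    exact/smooth_at_differentiable/psis.
  have dQ := smooth_at_differentiable (smooth_Q psis Oy).
  have : dd (vert w) (fun y => dd (vert (V y)) (energy L) y) y =
      dd (vert w) (fun y => 2 * dd (horz y.2) (psi \o fst : E -> R^o) y) y.
    by apply: (eqO_dd Uo) => // y' Uy'; have [] := UP _ Uy'.
  rewrite (dd_vert_along _ (Ls Oy) (smooth_at_differentiable sV)) (c1 w).1 vert0 dd0 add0r.
  rewrite (dd_scal _ _ dQ) (dd_vert_Q Oo psis) // (dd_Psi psis) //=.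
  by rewrite /hess => ->; rewrite mulKf ?pnatr_eq0.
have dgrad y (k : E) : U y -> dd k (grad L psi) y = dd k V y.
  by move=> Uy; apply: (eqO_dd Uo).
apply: (@schwarzian_eq0_on L psi U Uo _ _ _ _ _ _ lam) => // y Uy.
- exact/O0/UO.
- exact/Ls/UO.
- exact/Lpos/UO.
- exact/Leul/UO.
- exact/psis/UO.
- by move=> u; have [_ _ /(_ u)[<- _] _ _] := UP _ Uy; exact: dgrad.
- by have [] := UP _ Uy.
- by move=> u; have [_ _ /(_ u)[_ ->]] := UP _ Uy.
- by have [_ _ _ _ <-] := UP _ Uy; rewrite Vgrad // dgrad.
Qed.

End Germ.
End Mobius.

(** * Conformal changes and changes of coordinates *)

Section MobiusTransfer.
Context {R : realType} {n : nat}.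
Local Notation rV := 'rV[R]_n.
Local Notation E := ('rV[R]_n * 'rV[R]_n)%type.
Implicit Types (u w : rV) (z xi : E).

Lemma mobius_cst (En : E -> R^o) (c : R) z : mobius_at En (cst c) z.
Proof.
exists (cst 0), (cst 0); near=> y; split.
- exact: smooth_at_cst.
- exact: differentiable_cst.
- by move=> u; rewrite -!ddE !derive_cst.
- by rewrite vert0 dd0 -ddE derive_cst mulr0.
- by rewrite horz0 -[dd _ (cst 0) y]ddE -[dd _ (cst c) y]ddE !derive_cst vert0 !dd0
    expr0n /= mul0r !mulr0.
Unshelve. all: by end_near. Qed.

Lemma near_eq_mobius (En En' Psi Psi' : E -> R^o) z :
  (\near z, En z = En' z) -> (\near z, Psi z = Psi' z) ->
  mobius_at En Psi z -> mobius_at En' Psi' z.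
Proof.
move=> EE PP [V [lam M]]; exists V, lam.
have EE' := nbhs_interior EE; have PP' := nbhs_interior PP.
apply: filterS2 (filterI EE' PP') M => y [Ey Py] [sV dl c1 c2 c3].
by split=> //; rewrite -!(near_eq_dd _ Ey) -!(near_eq_dd _ Py) // -(nbhs_singleton Ey).
Qed.

Lemma dd_scale (V W : normedModType R) (B : frame W) (a : V -> R^o) (f : V -> W) (x v : V) :
  differentiable a x -> differentiable f x ->
  dd v (fun y => a y *: f y) x = dd v a x *: f x + a x *: dd v f x.
Proof.
move=> da df; apply: (frame_eq (B := B)) => i.
have := frame_coord_linear B i 1 (dd v a x *: f x) (a x *: dd v f x).
rewrite !scale1r => ->.
rewrite !frame_coordZ -!ddE -(derive_frame_coord (B := B) v i df).
rewrite -(derive_frame_coord (B := B) v i (differentiable_scale B da df)).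
have -> : frame_coord B i \o (fun y => a y *: f y) = a * (frame_coord B i \o f).
  by apply/funext => y; exact: frame_coordZ.
rewrite deriveM; [|exact: diff_derivable|apply: diff_derivable; exact: differentiable_frame].
by rewrite addrC; congr (_ + _); exact: mulrC.
Qed.

Lemma dd_expR (V : normedModType R) (f : V -> R^o) (x v : V) : differentiable f x ->
  dd v (fun y => expR (f y) : R^o) x = expR (f x) * dd v f x.
Proof. by move=> df; rewrite -!ddE; exact: derive_expR_comp. Qed.

(** Completing a square: with c = dchi(y) and f = dphi(y), subtracting the two equations gives 2 c^2
    - 2 f^2, the factor of the new gradient contributes -4 f (c - f), and the sum is 2 (c - f)^2.
    The weight is [expR (2 * Phi)] because [En] is F^2. *)
Lemma mobius_conformal (En Phi Chi : E -> R^o) z :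
  (\forall y \near z, [/\ smooth_at En y, smooth_at Phi y, smooth_at Chi y &
     forall u, dd (vert u) Phi y = 0]) ->
  mobius_at En Phi z -> mobius_at En Chi z ->
  mobius_at (fun y => expR (2 * Phi y) * En y) (fun y => Chi y - Phi y) z.
Proof.
move=> H [V1 [l1 M1]] [V2 [l2 M2]].
pose U y := V2 y - V1 y.
pose a : E -> R^o := fun y => expR (- 2 * Phi y).
(* The metric is multiplied by e^{2 Phi}, so the gradient of the difference [Chi] - [Phi] acquires
   the factor [a] = e^{-2 Phi}. The last summand of the new lambda comes from differentiating the
   weight of the energy along [U]. *)
exists (fun y => a y *: U y),
  (fun y => a y * (l2 y - l1 y + dd (horz (U y)) Phi y)).
have H' := nbhs_interior H; have M1' := nbhs_interior M1; have M2' := nbhs_interior M2.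
near=> y.
have Hy : \near y, [/\ smooth_at En y, smooth_at Phi y, smooth_at Chi y &
     forall u, dd (vert u) Phi y = 0] by near: y.
have [sV1 dl1 c1 q1 w1] : mobius_data En Phi V1 l1 y by near: y.
have [sV2 dl2 c2 q2 w2] : mobius_data En Chi V2 l2 y by near: y.
have [sE sP sC vP] := nbhs_singleton Hy.
have sU : smooth_at U y.
  apply: smooth_atD => //; apply: (@smooth_at_lin _ _ _ _ V1 (fun r => - r)) => //.
    by move=> k p q; rewrite opprD scalerN.
  exact: opp_continuous.
have dU := smooth_at_differentiable sU.
have dE := smooth_at_differentiable sE.
have dP := smooth_at_differentiable sP.
have dC := smooth_at_differentiable sC.
have dV1 := smooth_at_differentiable sV1.
have dV2 := smooth_at_differentiable sV2.
have ddU k : dd k U y = dd k V2 y - dd k V1 y.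
  by rewrite -!ddE; apply: deriveB; exact: diff_derivable.
have dm (c : R) : differentiable (fun y => c * Phi y : R^o) y by exact: differentiable_scal.
have sex (c : R) : smooth_at (fun y => expR (c * Phi y) : R^o) y.
  by apply: smooth_at_expR; apply: smooth_atM => //; exact: smooth_at_cst.
have dex (c : R) := smooth_at_differentiable (sex c).
have ddex (c : R) k : dd k (fun y => expR (c * Phi y) : R^o) y = expR (c * Phi y) * (c * dd k Phi y).
  by rewrite dd_expR // dd_scal.
have ae : a y * expR (2 * Phi y) = 1.
  by rewrite /a -expRD mulNr addNr expR0.
have ddE' k : dd k (fun y => expR (2 * Phi y) * En y : R^o) y =
    expR (2 * Phi y) * dd k En y + En y * (expR (2 * Phi y) * (2 * dd k Phi y)).
  by rewrite dd_mul // ddex.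
have dpU : differentiable (fun y => dd (horz (U y)) Phi y) y.
  apply: smooth_at_differentiable; apply: (smooth_dd_along real_frame) => //.
  exact: smooth_horz.
have dl : differentiable (fun y => l2 y - l1 y) y by exact: differentiableB.
have dL : differentiable (fun y => l2 y - l1 y + dd (horz (U y)) Phi y : R^o) y.
  exact: differentiableD.
have dR : differentiable (fun y => expR (2 * Phi y) * En y : R^o) y.
  exact: (differentiableM (dex 2) dE).
split.
- by apply: (smooth_at_scale (row_frame n)) => //; exact: sex.
- exact: (differentiableM (dex _) dL).
- move=> u; split.
    rewrite (dd_scale (row_frame n)) //; last exact: dex.
    by rewrite ddex vP !mulr0 scale0r add0r ddU (c1 u).1 (c2 u).1 subr0 scaler0.
  rewrite (dd_mul _ (dex _) dL) ddex vP !mulr0 addr0.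
  rewrite (dd_add _ dl dpU) (dd_sub _ dl2 dl1) (c1 u).2 (c2 u).2 subr0 add0r.
  rewrite (dd_horz_along real_frame _ sP dU) ddU (c1 u).1 (c2 u).1 subr0 horz0 dd0 add0r.
  rewrite (near_eq_dd (g := cst 0)) -?[dd _ (cst 0) y]ddE ?derive_cst ?mulr0 //.
  by apply: filterS Hy => t [].
- rewrite vertZ ddZ // ddE' vP !mulr0 addr0 -[LHS]/(a y * _) mulrA ae mul1r.
  rewrite /U vertD -scaleN1r vertZ ddD // ddZ // q1 q2 dd_sub //.
  by rewrite scaleN1r mulrBr.
- rewrite (dd_scale (row_frame n)) //; last exact: dex.
  rewrite horzZ vertD !vertZ ddZ // ddD // !ddZ // !ddE' !vP !mulr0 !addr0 ddex dd_sub //.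
  have qU : dd (vert (U y)) En y = 2 * dd (horz y.2) Chi y - 2 * dd (horz y.2) Phi y.
    by rewrite /U vertD -scaleN1r vertZ ddD // ddZ // q1 q2 scaleN1r.
  have wU : dd (horz (U y)) En y + dd (vert (dd (horz y.2) U y)) En y =
      (2 * dd (horz y.2) Chi y ^+ 2 + 2 * (l2 y * En y)) -
      (2 * dd (horz y.2) Phi y ^+ 2 + 2 * (l1 y * En y)).
    rewrite -w1 -w2 ddU /U horzD vertD -scaleN1r -[- dd _ V1 y]scaleN1r.
    rewrite horzZ vertZ !ddD // !ddZ // !scaleN1r; move: (dd _ En y) => A; ring.
  rewrite qU.
  set A := dd (horz (U y)) En y in wU *; set B := dd (vert _) En y in wU *.
  have -> : A = (2 * dd (horz y.2) Chi y ^+ 2 + 2 * (l2 y * En y)) -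
      (2 * dd (horz y.2) Phi y ^+ 2 + 2 * (l1 y * En y)) - B by rewrite -wU addrK.
  rewrite /GRing.scale /= -[expR (-2 * Phi y)]/(a y); clear wU.
  move: ae; move: (expR (2 * Phi y)) (a y) B (dd (horz y.2) Chi y) (dd (horz y.2) Phi y).
  move: (l1 y) (l2 y) (En y) (dd (horz (U y)) Phi y) => m1 m2 x p ex ai B' c f ae.
  transitivity (ai * ex * (2 * c ^+ 2 + 2 * (m2 * x) - (2 * f ^+ 2 + 2 * (m1 * x)) +
    2 * x * p - 2 * f * (2 * c - 2 * f))); first by ring.
  transitivity (2 * (c - f) ^+ 2 + 2 * (ai * ex * ((m2 - m1 + p) * x))); last by ring.
  rewrite ae; ring.
Unshelve. all: by end_near. Qed.

Definition tlift (T : rV -> rV) (z : E) : E := (T z.1, 'D_(z.2) T z.1).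

Lemma smooth_comp_fst (W : normedModType R) (B : frame W) (f : rV -> W) z :
  smooth_at f z.1 -> smooth_at (f \o fst : E -> W) z.
Proof.
by move=> fs; apply: (smooth_at_comp (row_frame n) B) => //; exact: smooth_at_fst.
Qed.

Lemma near_fst (P : rV -> Prop) z : (\forall x \near z.1, P x) -> \forall y \near z, P y.1.
Proof. by move=> H; exact: (@cvg_fst _ _ (nbhs z.1) (nbhs z.2) _ _ H). Qed.

Lemma smooth_tlift (T : rV -> rV) z : smooth_at T z.1 -> smooth_at (tlift T) z.
Proof.
move=> Ts; apply: smooth_at_pair; first exact: (smooth_comp_fst (row_frame n)).
have H : smooth_at (fun y => dd (horz y.2) (T \o fst : E -> rV) y) z.
  apply: (smooth_dd_along (row_frame n)); first exact: (smooth_comp_fst (row_frame n)).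
  exact/smooth_horz/smooth_at_snd.
apply: near_eq_smooth_at H.
by apply: filterS (near_fst (ndiff_at_near (Ts 0))) => y dT; rewrite dd_comp_fst // ddE.
Qed.

Lemma dd_tlift (T : rV -> rV) z xi : smooth_at T z.1 ->
  dd xi (tlift T) z = (dd xi.1 T z.1, dd xi.1 (dd z.2 T) z.1 + dd xi.2 T z.1).
Proof.
move=> Ts; have sl := smooth_tlift Ts.
have dl := smooth_at_differentiable sl.
have fD : dd xi (fst \o tlift T) z = (dd xi (tlift T) z).1.
  have [d1 D1] : differentiable (fst : E -> rV) (tlift T z) /\
      forall k : E, 'D_k (fst : E -> rV) (tlift T z) = k.1.
    by apply: linear_is_diff => // y; exact: cvg_fst.
  by rewrite dd_comp // -[LHS]ddE D1.
have sD : dd xi (snd \o tlift T) z = (dd xi (tlift T) z).2.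
  rewrite dd_comp // ?dd_snd //; exact: differentiable_snd.
rewrite [LHS]surjective_pairing -fD -sD; congr pair.
  by rewrite -(dd_comp_fst xi (smooth_at_differentiable Ts)).
have -> : dd xi (snd \o tlift T) z = dd xi (fun y => dd (horz y.2) (T \o fst : E -> rV) y) z.
  apply: near_eq_dd; apply: filterS (near_fst (ndiff_at_near (Ts 0))) => y dT.
  by rewrite dd_comp_fst // /= ddE.
have sTf := smooth_comp_fst (row_frame n) Ts.
rewrite (dd_horz_along (row_frame n) _ sTf (differentiable_snd z)) dd_snd.
rewrite (dd_comp_fst _ (smooth_at_differentiable Ts)) addrC; congr (_ + _).
have -> : dd (horz z.2) (dd xi (T \o fst : E -> rV)) z = dd (horz z.2) (dd xi.1 T \o fst : E -> rV) z.
  apply: near_eq_dd; apply: filterS (near_fst (ndiff_at_near (Ts 0))) => y dT.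
  by rewrite dd_comp_fst.
rewrite dd_comp_fst /=; last exact/smooth_at_differentiable/smooth_at_dd.
exact: (dd_sym (row_frame n)).
Qed.

(** Complete lifts are natural: the differential of [tlift T] carries the complete lift of a
    pulled-back field to the complete lift of the field. All conditions in [mobius_data] are
    therefore transported by the chain rule. *)
Lemma mobius_change (En Psi : E -> R^o) (T S : rV -> rV) z :
  (\forall y \near z, [/\ smooth_at T y.1, smooth_at S (T y.1) & S (T y.1) = y.1]) ->
  (\forall x \near T z.1, T (S x) = x) ->
  (\forall y \near tlift T z, [/\ smooth_at En y, smooth_at Psi y &
     forall u, dd (vert u) Psi y = 0]) ->
  mobius_at En Psi (tlift T z) -> mobius_at (En \o tlift T) (Psi \o tlift T) z.
Proof.
move=> sTS TS sEP [V [lam M]].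
(* The field is pulled back with the differential of the local inverse [S]; composed with [tlift T]
   this is the witness for the new coordinates. *)
pose H y : rV := dd (horz (V y)) (S \o fst : E -> rV) y.
have [sT0 _ _] := nbhs_singleton sTS.
have lc : tlift T @ z --> tlift T z.
  exact/differentiable_continuous/smooth_at_differentiable/smooth_tlift.
have Tc : (T \o fst : E -> rV) @ z --> T z.1.
  exact/differentiable_continuous/smooth_at_differentiable/(smooth_comp_fst (row_frame n)).
exists (H \o tlift T), (lam \o tlift T).
have A1 : \forall y \near z, mobius_data En Psi V lam (tlift T y) := lc _ M.
have A2 : \forall y \near z, [/\ smooth_at En (tlift T y), smooth_at Psi (tlift T y) &
   forall u, dd (vert u) Psi (tlift T y) = 0] := lc _ sEP.
have A3 : \forall y \near z, \forall x \near T y.1, T (S x) = x := Tc _ (nbhs_interior TS).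
have A4 : \forall y \near z, \forall t \near y,
    mobius_data En Psi V lam (tlift T t) /\ (\forall x \near T t.1, T (S x) = x).
  exact: (nbhs_interior (filterI A1 A3)).
have A5 : \forall y \near z, \forall t \near y,
    [/\ smooth_at T t.1, smooth_at S (T t.1) & S (T t.1) = t.1].
  exact: (nbhs_interior sTS).
apply: filterS3 A2 A4 A5 => y [sE sP vP] A4 sTSn.
have [[sV dl c1 q w] _] := nbhs_singleton A4.
have [sT sS STy] := nbhs_singleton sTSn.
have sl : smooth_at (tlift T) y by exact: smooth_tlift.
have dl' := smooth_at_differentiable sl.
have sSf : smooth_at (S \o fst : E -> rV) (tlift T y).
  exact: (smooth_comp_fst (row_frame n)).
have dV := smooth_at_differentiable sV.
have dE := smooth_at_differentiable sE.
have dP := smooth_at_differentiable sP.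
have dT := smooth_at_differentiable sT.
have sH : smooth_at H (tlift T y).
  by apply: (smooth_dd_along (row_frame n)) => //; exact: smooth_horz.
have dH := smooth_at_differentiable sH.
have sHl : smooth_at (H \o tlift T) y.
  exact: (smooth_at_comp tangent_frame (row_frame n) sl sH).
have vl u : dd (vert u) (tlift T) y = vert (dd u T y.1).
  by rewrite dd_tlift //= !dd0 add0r.
have DTV : \forall t \near y, dd (H (tlift T t)) T t.1 = V (tlift T t).
  apply: filterS2 A4 sTSn => t [_ TSt] [sTt sSt STt].
  have dSt : differentiable S (tlift T t).1 by exact: smooth_at_differentiable.
  rewrite /H (dd_comp_fst _ dSt) /=.
  have dTt : differentiable T (S (T t.1)) by rewrite STt; exact: smooth_at_differentiable.
  transitivity (dd (V (tlift T t)) (T \o S) (T t.1)).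
    by rewrite (dd_comp _ (smooth_at_differentiable sSt) dTt) STt.
  by rewrite (near_eq_dd (g := id)) // -ddE derive_id.
have V0 u : dd (vert u) (H \o tlift T) y = 0.
  rewrite dd_comp // vl /H (dd_horz_along (row_frame n) _ sSf dV) (c1 _).1 horz0 dd0 add0r.
  rewrite (near_eq_dd (g := cst 0)) -?[dd _ (cst 0) _]ddE ?derive_cst //.
  have nS : \forall t \near tlift T y, differentiable S t.1.
    by apply: (@near_fst (fun x => differentiable S x)); exact: ndiff_at_near (sS 0).
  by apply: filterS nS => t dSt; rewrite dd_comp_fst // dd0.
(* The vertical component of naturality, obtained by differentiating dT(H) = V along (y, 0). *)
have D2 : dd (H (tlift T y)) (dd y.2 T) y.1 + dd (dd (horz y.2) (H \o tlift T) y) T y.1 =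
    dd (horz (tlift T y).2) V (tlift T y).
  have : dd (horz y.2) (fun t => dd (horz (H (tlift T t))) (T \o fst : E -> rV) t) y =
      dd (horz y.2) (V \o tlift T) y.
    apply: near_eq_dd; apply: filterS2 DTV sTSn => t Dt [sTt _ _].
    by rewrite dd_comp_fst //; exact: smooth_at_differentiable.
  have sTf : smooth_at (T \o fst : E -> rV) y by exact: (smooth_comp_fst (row_frame n)).
  rewrite (dd_horz_along (row_frame n) _ sTf (smooth_at_differentiable sHl)).
  rewrite (dd_comp_fst _ dT) /= addrC.
  have -> : dd (horz (H (tlift T y))) (dd (horz y.2) (T \o fst : E -> rV)) y =
      dd (horz (H (tlift T y))) (dd y.2 T \o fst : E -> rV) y.
    apply: near_eq_dd; apply: filterS sTSn => t [sTt _ _].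
    by rewrite dd_comp_fst //; exact: smooth_at_differentiable.
  rewrite dd_comp_fst /=; last exact/smooth_at_differentiable/smooth_at_dd.
  move=> ->; rewrite dd_comp // dd_tlift //= dd0 addr0.
  rewrite (horz_vert (_, _)) ddD //= (c1 _).1 addr0; congr (dd (horz _) _ _).
  by rewrite ddE.
split=> //.
- exact: differentiable_comp.
- by move=> u; split => //; rewrite dd_comp // vl (c1 _).2.
- rewrite (dd_comp _ dl' dE) vl (nbhs_singleton DTV) q (dd_comp _ dl' dP) dd_tlift //= dd0 addr0.
  by rewrite (horz_vert (_, _)) ddD //= vP addr0 ddE.
- rewrite !(dd_comp _ dl' dE) (dd_comp _ dl' dP) -ddD // -ddD //.
  rewrite -(horz_vert (H (tlift T y), dd (horz y.2) (H \o tlift T) y)).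
  have X1 : dd (H (tlift T y), dd (horz y.2) (H \o tlift T) y) (tlift T) y =
      (V (tlift T y), dd (horz (tlift T y).2) V (tlift T y)).
    by rewrite (dd_tlift _ sT) D2 (nbhs_singleton DTV).
  have X2 : dd (horz y.2) (tlift T) y = ((tlift T y).2, dd y.2 (dd y.2 T) y.1).
    by rewrite (dd_tlift _ sT) /= dd0 addr0 ddE.
  by rewrite X1 X2 (dd_pair _ _ dE) (dd_pair _ _ dP) vP addr0 w.
Qed.

End MobiusTransfer.

(** * Bump functions *)

Section Bump.
Context {R : realType}.

(* All the functions t^-m exp(-1/t), because the derivative of one of them is a combination of
   two others. *)
Definition flat (m : nat) (t : R^o) : R^o :=
  if 0 < t then t^-1 ^+ m * expR (- t^-1) else 0.

Lemma flat_ge0 m t : 0 <= flat m t.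
Proof.
rewrite /flat; case: ifPn => // t0; apply: mulr_ge0; last exact: expR_ge0.
by rewrite exprn_ge0 // invr_ge0 ltW.
Qed.

(** The exponential dominates the term of degree m + 2 of its Taylor series at 1/t. These two
    degrees beyond the pole leave a factor t^2, enough for the derivative at 0 to vanish. *)
Lemma flat_le m (t : R) : flat m t <= m.+2`!%:R * (t * t).
Proof.
rewrite /flat; case: ifPn => [t0|_]; last first.
  by rewrite mulr_ge0 // -expr2 sqr_ge0.
have i0 : 0 <= t^-1 by rewrite invr_ge0 ltW.
have H : t^-1 ^+ m.+2 / m.+2`!%:R <= expR t^-1.
  by apply: le_trans (expR_ge1Dxn m.+1 i0); rewrite lerDr.
rewrite expRN -[leLHS]/(t^-1 ^+ m * (expR t^-1)^-1).
rewrite ler_pdivrMr ?expR_gt0 //.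
have f0 : 0 < m.+2`!%:R :> R by rewrite ltr0n fact_gt0.
have c0 : 0 <= m.+2`!%:R * (t * t) by rewrite !mulr_ge0 // ltW.
apply: le_trans (ler_wpM2l c0 H).
rewrite !exprS; move: (t^-1 ^+ m) => p.
have -> // : m.+2`!%:R * (t * t) * (t^-1 * (t^-1 * p) / m.+2`!%:R) = p.
by field; rewrite !gt_eqF.
Qed.

Lemma dd_inv (t : R^o) : t != 0 ->
  differentiable (fun s : R^o => s^-1 : R^o) t /\
  dd (1 : R^o) (fun s : R^o => s^-1 : R^o) t = - (t^-1 * t^-1).
Proof.
move=> tn0.
have di : differentiable (fun s : R^o => s^-1 : R^o) t.
  by apply: smooth_at_differentiable; apply: smooth_atV => //; exact: smooth_at_id.
have d1 : differentiable (fun s : R^o => s : R^o) t.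
  exact/smooth_at_differentiable/smooth_at_id.
have D1 : dd (1 : R^o) (fun s : R^o => s : R^o) t = 1 by rewrite -ddE; exact: derive_id.
split=> //.
have nt : \forall s \near t, s * s^-1 = cst 1 s :> R^o.
  have : \forall s \near t, s != 0.
    by apply: open_nbhs_nbhs; split => //; exact: open_neq.
  by apply: filterS => s s0; rewrite divff.
have := near_eq_dd (1 : R^o) nt.
rewrite (dd_mul _ d1 di) D1 mulr1 -[dd _ (cst _) _]ddE derive_cst => /eqP.
rewrite addr_eq0 => /eqP h; apply: (mulfI tn0); rewrite h.
by rewrite mulrN mulrA divff // mul1r.
Qed.

Lemma dd_inv_exp (t : R^o) m : t != 0 ->
  differentiable (fun s : R^o => s^-1 ^+ m : R^o) t /\
  dd (1 : R^o) (fun s : R^o => s^-1 ^+ m : R^o) t = - (m%:R * t^-1 ^+ m.+1).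
Proof.
move=> tn0; have [di Di] := dd_inv tn0; elim: m => [|m [dX DX]].
  by rewrite mul0r oppr0 -ddE derive_cst; split => //; exact: differentiable_cst.
have -> : (fun s : R^o => s^-1 ^+ m.+1 : R^o) = (fun s : R^o => s^-1 * s^-1 ^+ m : R^o).
  by apply/funext => s; rewrite exprS.
split; first exact: (differentiableM di dX).
rewrite (dd_mul _ di dX) Di DX !exprS.
by move: (t^-1) (t^-1 ^+ m) => i p; rewrite -natr1; ring.
Qed.

Lemma dd_flat m (t : R^o) : differentiable (flat m) t /\
  dd (1 : R^o) (flat m) t = flat m.+2 t - m%:R * flat m.+1 t.
Proof.
case: (ltgtP t 0) => [t0|t0|->].
- have nt : \forall s \near t, (cst 0 : R^o -> R^o) s = flat m s.
    near=> s; rewrite /flat ifN // -leNgt ltW //.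
    by near: s; exact: lt_nbhsl.
  split; first by apply: (near_eq_differentiable nt); exact: differentiable_cst.
  rewrite -(near_eq_dd _ nt) -ddE derive_cst /flat !ifN -?leNgt ?ltW //.
  by rewrite mulr0 subr0.
- have nt : \forall s \near t, ((fun s : R^o => s^-1 ^+ m * expR (- s^-1) : R^o) s = flat m s).
    near=> s; rewrite /flat ifT //.
    by near: s; exact: lt_nbhsr.
  have tn0 : t != 0 by rewrite gt_eqF.
  have [di Di] := dd_inv tn0; have [dX DX] := dd_inv_exp m tn0.
  have dN : differentiable (fun s : R^o => (-1) * s^-1 : R^o) t by exact: differentiable_scal.
  have nE : (fun s : R^o => expR (- s^-1) : R^o) = (fun s : R^o => expR ((-1) * s^-1) : R^o).
    by apply/funext => s; rewrite mulN1r.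
  have dE : differentiable (fun s : R^o => expR (- s^-1) : R^o) t.
    rewrite nE; apply: smooth_at_differentiable; apply: smooth_at_expR.
    apply: smooth_atM; first exact: smooth_at_cst.
    by apply: smooth_atV => //; exact: smooth_at_id.
  split; first exact: (near_eq_differentiable nt (differentiableM dX dE)).
  rewrite -(near_eq_dd _ nt) (dd_mul _ dX dE) DX nE (dd_expR _ dN) (dd_scal _ _ di) Di.
  rewrite /flat t0 mulN1r !exprS.
  by move: (t^-1) (expR _) (t^-1 ^+ m) => i e p; ring.
- have z0 : flat m.+2 0 - m%:R * flat m.+1 0 = 0 by rewrite /flat ltxx mulr0 subr0.
  (* By [flat_le] the difference quotient at 0 is at most (m+2)! |h|. *)
  have L : (fun h : R => h^-1 *: (flat m (h *: 1 + 0) - flat m 0)) h @[h --> 0^'] --> (0 : R^o).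
    apply/cvgr0Pnorm_le => e e0.
    have f0 : 0 < m.+2`!%:R :> R by rewrite ltr0n fact_gt0.
    have d0 : 0 < e / m.+2`!%:R by rewrite divr_gt0.
    near=> h.
    have hn0 : h != 0 by near: h; exact: nbhs_dnbhs_neq.
    have he : `|h| <= e / m.+2`!%:R by near: h; exact: dnbhs0_le.
    rewrite addr0 {2}/flat ltxx subr0 [h *: 1]mulr1 normrZ normfV.
    rewrite (ger0_norm (flat_ge0 _ _)) mulrC ler_pdivrMr ?normr_gt0 //.
    apply: le_trans (flat_le _ _) _.
    have -> : h * h = `|h| * `|h| by rewrite -normrM ger0_norm // -expr2 sqr_ge0.
    by rewrite mulrA ler_wpM2r // mulrC -ler_pdivlMr.
  split; last by rewrite z0 -ddE; exact: cvg_lim.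
  by apply/derivable1_diffP; apply: cvgP L.
Unshelve. all: by end_near. Qed.

Lemma smooth_flat m (t : R^o) : smooth_at (flat m) t.
Proof.
move=> k; elim: k m => [|k IH] m.
  by split=> //; near=> s; exact: (dd_flat m s).1.
split; first by near=> s; exact: (dd_flat m s).1.
move=> v.
have -> : 'D_v (flat m) = (fun s => v * (flat m.+2 s + (- m%:R) * flat m.+1 s) : R^o).
  apply/funext => s; have [df Df] := dd_flat m s.
  have -> : v = v *: (1 : R^o) by rewrite [RHS]mulr1.
  by rewrite ddE (ddZ _ _ df) Df mulNr [v *: 1]mulr1.
apply: ndiff_atM; first exact: ndiff_at_cst.
apply: ndiff_atD; first exact: IH.
by apply: ndiff_atM; [exact: ndiff_at_cst|exact: IH].
Unshelve. all: by end_near. Qed.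

(** A product over the coordinates: it vanishes outside a cube, whose compactness is that of a
    product of segments. *)
Definition bump_fun n (x0 : 'rV[R]_n) (r : R) (x : 'rV[R]_n) : R^o :=
  \prod_i flat 0 (r ^+ 2 - (x 0 i - x0 0 i) ^+ 2).

Lemma smooth_bump n (x0 : 'rV[R]_n) (r : R) x : smooth_at (bump_fun x0 r) x.
Proof.
apply: smooth_at_prod => i _.
apply: (@smooth_at_comp _ _ _ _ real_frame real_frame
  (fun x : 'rV[R]_n => r ^+ 2 - (x 0 i - x0 0 i) ^+ 2 : R^o) (flat 0)).
  apply: smooth_atD; first exact: smooth_at_cst.
  apply: smooth_atN.
  have H : smooth_at (fun x : 'rV[R]_n => x 0 i - x0 0 i : R^o) x.
    apply: smooth_atD; last exact: smooth_at_cst.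
    exact: (smooth_at_row _ _).1 (@smooth_at_id _ _ x) i.
  exact: (smooth_atM H H).
exact: smooth_flat.
Qed.

Lemma bump_gt0 n (x0 : 'rV[R]_n) (r : R) : 0 < r -> 0 < bump_fun x0 r x0.
Proof.
move=> r0; apply: prodr_gt0 => i _; rewrite subrr expr0n subr0 /flat.
have -> : 0 < r ^+ 2 by rewrite exprn_gt0.
by rewrite mul1r expR_gt0.
Qed.

Lemma bump_eq0 n (x0 : 'rV[R]_n) (r : R) x : 0 < r ->
  bump_fun x0 r x != 0 -> forall i, `|x 0 i - x0 0 i| <= r.
Proof.
move=> r0 /prodf_neq0 H i; have := H i isT; rewrite /flat; case: ifPn => [|_]; last first.
  by rewrite eqxx.
rewrite subr_gt0 => h _; rewrite -(ler_pXn2r (n := 2)) ?nnegrE ?(ltW r0) //.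
by rewrite real_normK ?num_real // ltW.
Qed.

End Bump.

(** * Charts and extension of vector fields *)

Section Charts.
Context {R : realType} {n : nat} {M : topologicalType} (S : manifold R n M).
Local Notation rV := 'rV[R]_n.
Local Notation E := ('rV[R]_n * 'rV[R]_n)%type.
Implicit Types (c : chart R n M) (f g : M -> M) (x : rV) (z : E).

Lemma near_eq_tlift (T T' : rV -> rV) z :
  (\forall x \near z.1, T x = T' x) -> tlift T z = tlift T' z.
Proof.
by move=> TT; rewrite /tlift (nbhs_singleton TT) (near_eq_derive _ TT).
Qed.

Lemma tlift_compE (T T' : rV -> rV) z :
  differentiable T z.1 -> differentiable T' (T z.1) ->
  tlift (T' \o T) z = tlift T' (tlift T z).
Proof. by move=> dT dT'; rewrite /tlift derive_comp. Qed.

Lemma tlift_id z : tlift id z = z.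
Proof. by rewrite /tlift derive_id; case: z. Qed.

Definition mapT f c c' : rV -> rV := coords c' \o f \o param c.

Definition in_charts f c c' x := target c x /\ source c' (f (param c x)).

Lemma near_target c x : target c x -> \forall y \near x, target c y.
Proof. by move=> cx; apply: open_nbhs_nbhs; split => //; exact: target_open. Qed.

Lemma near_source c p : source c p -> \forall q \near p, source c q.
Proof. by move=> cp; apply: open_nbhs_nbhs; split => //; exact: source_open. Qed.

Lemma param_cvg c x : target c x -> param c @ x --> param c x.
Proof. by move=> cx; apply: (param_continuous (c := c)); exact: mem_set. Qed.

Lemma near_in_charts f c c' x : continuous f -> in_charts f c c' x ->
  \forall y \near x, in_charts f c c' y.
Proof.
move=> fc [cx c'x]; apply: filterI; first exact: near_target.
exact: (param_cvg cx (fc _ _ (near_source c'x))).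
Qed.

Lemma coordsKp c p : source c p -> param c (coords c p) = p.
Proof. by move=> cp; apply: coordsK; exact: mem_set. Qed.

Lemma paramKx c x : target c x -> coords c (param c x) = x.
Proof. by move=> cx; apply: paramK; exact: mem_set. Qed.

Lemma smooth_mapT f c c' x : smooth_map S f -> atlas S c -> atlas S c' ->
  in_charts f c c' x -> smooth_at (mapT f c c') x.
Proof.
move=> [fc fs] ac ac' xcc'; have := fs c c' ac ac'.
move/smooth_onP => H; apply: H => //; rewrite openE => y yc.
exact: (near_in_charts fc yc).
Qed.

Lemma smooth_map_id : smooth_map S id.
Proof.
by split=> [p|c c' ac ac']; [exact: cvg_id|exact: (transition_smooth ac ac')].
Qed.

Lemma in_charts_comp f g c c' c'' x : in_charts g c c' x ->
  source c'' (f (g (param c x))) -> in_charts f c' c'' (mapT g c c' x).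
Proof.
move=> [cx c'x] h; split; first exact: coords_target.
by rewrite /mapT /= coordsKp.
Qed.

Lemma mapT_comp f g c c' c'' x : source c' (g (param c x)) ->
  mapT (f \o g) c c'' x = mapT f c' c'' (mapT g c c' x).
Proof. by move=> h; rewrite /mapT /= coordsKp. Qed.

Lemma tlift_mapT_comp f g c c' c'' z : smooth_map S f -> smooth_map S g ->
  atlas S c -> atlas S c' -> atlas S c'' ->
  in_charts g c c' z.1 -> source c'' (f (g (param c z.1))) ->
  tlift (mapT (f \o g) c c'') z = tlift (mapT f c' c'') (tlift (mapT g c c') z).
Proof.
move=> fs gs ac ac' ac'' i1 i2; rewrite -tlift_compE; last 2 first.
- exact/smooth_at_differentiable/smooth_mapT.
- exact/smooth_at_differentiable/(smooth_mapT fs)/in_charts_comp.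
apply: near_eq_tlift; apply: filterS (near_in_charts gs.1 i1) => x [_ h].
exact: mapT_comp.
Qed.

Lemma smooth_map_comp f g : smooth_map S f -> smooth_map S g -> smooth_map S (f \o g).
Proof.
move=> fs gs; have fgc : continuous (f \o g).
  by move=> p; apply: continuous_comp; [exact: gs.1|exact: fs.1].
split=> // c c'' ac ac''.
apply/smooth_onP; first by rewrite openE => y yc; exact: (near_in_charts fgc yc).
move=> x [cx c''x].
pose c' := chart_at S (g (param c x)).
have i1 : in_charts g c c' x by split => //; exact: chart_at_source.
have ac' : atlas S c' by exact: chart_at_atlas.
have H : smooth_at (mapT f c' c'' \o mapT g c c') x.
  apply: (smooth_at_comp (row_frame n) (row_frame n)); first exact: smooth_mapT.
  by apply: smooth_mapT => //; exact: in_charts_comp.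
apply: near_eq_smooth_at H; apply: filterS (near_in_charts gs.1 i1) => y [_ h].
exact/esym/mapT_comp.
Qed.

Lemma tlift_mapT_id c z : target c z.1 -> tlift (mapT id c c) z = z.
Proof.
move=> cz; rewrite -[RHS]tlift_id; apply: near_eq_tlift.
by apply: filterS (near_target cz) => x cx; exact: paramKx.
Qed.

Lemma tangent_mapE f p v : let q := chart_at S p in let q' := chart_at S (f p) in
  tangent_map S f p v = (tlift (mapT f q q') (coords q p, v)).2.
Proof. by []. Qed.

Lemma ttransitionE c c' z : ttransition c c' z = tlift (mapT id c c') z.
Proof. by []. Qed.

Lemma smooth_fun_comp (phi : M -> R) f : smooth_fun S phi -> smooth_map S f ->
  smooth_fun S (phi \o f).
Proof.
move=> ps fs c ac; apply/smooth_onP; first exact: target_open.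
move=> x cx; pose c' := chart_at S (f (param c x)).
have i1 : in_charts f c c' x by split => //; exact: chart_at_source.
have ac' : atlas S c' by exact: chart_at_atlas.
have H : smooth_at ((phi \o param c' : rV -> R^o) \o mapT f c c') x.
  apply: (smooth_at_comp (row_frame n) real_frame); first exact: smooth_mapT.
  apply: (smooth_onP _ (@target_open _ _ _ c')).1; first exact: ps.
  exact/coords_target/i1.2.
apply: near_eq_smooth_at H; apply: filterS (near_in_charts fs.1 i1) => y [_ h].
by rewrite /mapT /= coordsKp.
Qed.

Lemma smooth_fun_at (phi : M -> R) c x : smooth_fun S phi -> atlas S c -> target c x ->
  smooth_at (phi \o param c : rV -> R^o) x.
Proof.
by move=> ps ac cx; apply: (smooth_onP _ (@target_open _ _ _ c)).1 => //; exact: ps.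
Qed.

Lemma open_slit c : open (slit c : set E).
Proof.
rewrite openE => z [cz z0]; apply: filterI.
  exact: (near_fst (near_target cz)).
have op : open [set y : rV | y != 0].
  have -> : [set y : rV | y != 0] = ~` [set 0].
    by apply/seteqP; split => y /= /eqP.
  apply: closed_openC; apply: accessible_closed_set1.
  exact/hausdorff_accessible/norm_hausdorff.
have h : \forall y \near z.2, y != 0 :> rV by exact: (open_nbhs_nbhs (conj op z0)).
exact: (@cvg_snd _ _ (nbhs z.1) (nbhs z.2) _ _ h).
Qed.

(** * Extension of a tangent vector of TM_0 to a global field *)

Section ExtendField.
Variables (c0 : chart R n M) (z0 xi0 : E).
Hypothesis ac0 : atlas S c0.
Hypothesis cz0 : target c0 z0.1.

Lemma closed_ball_target : exists2 r : R, 0 < r &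
  forall x : rV, (forall i, `|x 0 i - z0.1 0 i| <= r) -> target c0 x.
Proof.
have /nbhs_ballP[r /= r0 H] : nbhs z0.1 (target c0).
  by apply: open_nbhs_nbhs; split => //; exact: target_open.
exists (r / 2); first by rewrite divr_gt0.
move=> x xr; apply: H; split=> // i j; rewrite (ord1 i) /ball /= distrC.
by rewrite (le_lt_trans (xr j)) // ltr_pdivrMr // ltr_pMr // ltr1n.
Qed.

Let r : R := projT1 (cid2 closed_ball_target).
Let r0 : 0 < r. Proof. exact: (s2valP (cid2 closed_ball_target)). Qed.
Let ball_sub x : (forall i, `|x 0 i - z0.1 0 i| <= r) -> target c0 x.
Proof. exact: (s2valP' (cid2 closed_ball_target)). Qed.

Let rho : rV -> R^o := bump_fun z0.1 r.
Let K : set rV := [set x | forall i, `|x 0 i - z0.1 0 i| <= r].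

(** A compact set in a Hausdorff space is closed. Closedness in [M], and not merely in the chart,
    makes the extension by zero smooth at the points outside [source c0]. *)
Lemma closed_support : closed (param c0 @` K).
Proof.
apply: compact_closed; first exact: (manifold_hausdorff S).
apply: continuous_compact.
  apply: continuous_in_subspaceT => x /set_mem Kx.
  exact/param_cvg/ball_sub.
have -> : K = [set x : rV | forall i, `[z0.1 0 i - r, z0.1 0 i + r]%classic (x ord0 i)].
  by apply/seteqP; split => x /= Kx i; have := Kx i; rewrite /= in_itv /= ler_distl.
apply: (@rV_compact R n (fun i => `[z0.1 0 i - r, z0.1 0 i + r]%classic)) => i.
exact: segment_compact.
Qed.

Definition extend_field (p : M) (v : rV) : E :=
  let q := chart_at S p in
  if p \in source c0 then
    let z := tlift (mapT id q c0) (coords q p, v) in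
    'D_((rho z.1 / rho z0.1) *: xi0) (tlift (mapT id c0 q)) z
  else 0.

Let eta (z : E) : E := (rho z.1 / rho z0.1) *: xi0.

(** The preferred chart may jump from point to point. The cocycle rule for transitions eliminates
    it, and the resulting expression is visibly smooth in [z]. *)
Lemma local_extend_field c z : atlas S c -> in_charts id c c0 z.1 ->
  local_field S extend_field c z =
  'D_(eta (tlift (mapT id c c0) z)) (tlift (mapT id c0 c)) (tlift (mapT id c c0) z).
Proof.
move=> ac i1; rewrite /local_field.
set p := param c z.1; set q := chart_at S p.
have aq : atlas S q by exact: chart_at_atlas.
have sq : source q p by exact: chart_at_source.
have cz : target c z.1 by case: i1.
have sp0 : source c0 p by case: i1.
set w := ttransition c q z.
have wE : (coords q p, w.2) = w by [].
have idm := smooth_map_id.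
have wz : tlift (mapT id q c0) w = tlift (mapT id c c0) z.
  by rewrite /w ttransitionE -(tlift_mapT_comp (f := id) (g := id)).
have hE : extend_field p w.2 = 'D_(eta (tlift (mapT id q c0) w)) (tlift (mapT id c0 q))
    (tlift (mapT id q c0) w).
  by rewrite /extend_field (mem_set sp0).
rewrite hE wz.
set y := tlift (mapT id c c0) z.
have yw : tlift (mapT id c0 q) y = w.
  rewrite /y /w ttransitionE -(tlift_mapT_comp (f := id) (g := id)) //.
have y1 : y.1 = coords c0 p by [].
have i2 : in_charts id c0 q y.1.
  by split; rewrite y1; [exact: coords_target|rewrite /= coordsKp].
have sl1 : smooth_at (tlift (mapT id c0 q)) y by exact/smooth_tlift/smooth_mapT.
have i3 : in_charts id q c w.1.
  have w1 : w.1 = coords q p by [].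
  split; rewrite w1; first exact: coords_target.
  by rewrite /= coordsKp //; exact: param_source.
have sl2 : smooth_at (tlift (mapT id q c)) w by exact/smooth_tlift/smooth_mapT.
rewrite -[in LHS]yw -/(eta y).
rewrite -[LHS](derive_comp (f := tlift (mapT id c0 q)) (g := tlift (mapT id q c))); last 2 first.
- exact: smooth_at_differentiable.
- by rewrite yw; exact: smooth_at_differentiable.
apply: near_eq_derive.
have i4 : in_charts id c0 c y.1.
  split; rewrite y1; first exact: coords_target.
  by rewrite /= coordsKp //; exact: param_source.
apply: filterS2 (near_fst (near_in_charts idm.1 i2)) (near_fst (near_in_charts idm.1 i4)).
move=> t it [_ it']; exact/esym/(tlift_mapT_comp (f := id) (g := id)).
Qed.

Lemma rho_eq0 x : rho x != 0 -> K x.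
Proof. by move=> h i; apply: (bump_eq0 r0 h). Qed.

Lemma local_extend_field_out c z : target c z.1 ->
  ~ (param c0 @` K) (param c z.1) -> local_field S extend_field c z = 0.
Proof.
move=> cz out; rewrite /local_field; set p := param c z.1; set q := chart_at S p.
set w := ttransition c q z.
suff -> : extend_field p w.2 = 0 by rewrite derive0.
rewrite /extend_field; case: ifPn => // /set_mem sp0 /=.
have [->|/rho_eq0 Kx] := eqVneq (rho (tlift (mapT id q c0) (coords q p, w.2)).1) 0.
  by rewrite mul0r scale0r derive0.
exfalso; apply: out; exists (coords c0 p); last exact: coordsKp.
suff <- : (tlift (mapT id q c0) (coords q p, w.2)).1 = coords c0 p by [].
by rewrite /= /mapT /= coordsKp //; exact: chart_at_source.
Qed.

Lemma smooth_extend_field : smooth_field S extend_field.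
Proof.
move=> c ac; apply/smooth_onP; first exact: open_slit.
move=> z [cz _]; have idm := smooth_map_id.
have [sz|nsz] := pselect (source c0 (param c z.1)).
  have i1 : in_charts id c c0 z.1 by [].
  have sl : smooth_at (tlift (mapT id c c0)) z by exact/smooth_tlift/smooth_mapT.
  have i2 : in_charts id c0 c (tlift (mapT id c c0) z).1.
    by apply: (in_charts_comp (f := id) i1); exact: param_source.
  have sl' : smooth_at (tlift (mapT id c0 c)) (tlift (mapT id c c0) z).
    exact/smooth_tlift/smooth_mapT.
  have seta y : smooth_at eta y.
    apply: (smooth_at_scale tangent_frame); last exact: smooth_at_cst.
    apply: smooth_atM; last exact: smooth_at_cst.
    apply: (smooth_comp_fst real_frame (f := rho)); exact: smooth_bump.
  have H : smooth_at ((fun y => 'D_(eta y) (tlift (mapT id c0 c)) y) \o tlift (mapT id c c0)) z.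
    apply: (smooth_at_comp tangent_frame tangent_frame) => //.
    exact: (smooth_at_along tangent_frame tangent_frame).
  apply: near_eq_smooth_at H.
  apply: filterS (near_fst (near_in_charts idm.1 i1)) => y iy.
  exact/esym/local_extend_field.
have nK : ~ (param c0 @` K) (param c z.1).
  by case=> x Kx xp; apply: nsz; rewrite -xp; exact/param_source/ball_sub.
have op : open (~` (param c0 @` K)) by exact/closed_openC/closed_support.
have near_out : \forall y \near z, ~ (param c0 @` K) (param c y.1).
  exact: (near_fst (param_cvg cz (open_nbhs_nbhs (conj op nK)))).
have H : smooth_at (cst 0 : E -> E) z by exact: smooth_at_cst.
apply: near_eq_smooth_at H.
apply: filterS2 near_out (near_fst (near_target cz)) => y oy cy.
exact/esym/local_extend_field_out.
Qed.

Lemma local_extend_field_at : local_field S extend_field c0 z0 = xi0.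
Proof.
have i1 : in_charts id c0 c0 z0.1 by split => //; exact: param_source.
rewrite local_extend_field // tlift_mapT_id //.
have nE : \forall y \near z0, tlift (mapT id c0 c0) y = id y.
  by apply: filterS (near_fst (near_target cz0)) => y cy; exact: tlift_mapT_id.
rewrite (near_eq_derive _ nE) derive_id /eta divff ?scale1r //.
by rewrite gt_eqF // bump_gt0.
Qed.

End ExtendField.

(** [schwarzian_eq0] quantifies over global fields; this lets it be evaluated on any single vector
    [xi] over the chart. *)
Lemma exists_smooth_field c z xi : atlas S c -> target c z.1 ->
  exists2 X, smooth_field S X & local_field S X c z = xi.
Proof.
move=> ac cz; exists (extend_field xi cz).
  exact: smooth_extend_field.
exact: local_extend_field_at.
Qed.

End Charts.

(** * Conformal transformations *)

Section Transformations.
Context {R : realType} {n : nat} {M : topologicalType} {S : manifold R n M}.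
Variable F : finsler S.
Local Notation rV := 'rV[R]_n.
Local Notation E := ('rV[R]_n * 'rV[R]_n)%type.
Implicit Types (c : chart R n M) (z : E) (phi : M -> R) (f g : selfbij M).

Let L c : E -> R^o := local_fun S F c.

Definition expression phi c : E -> R^o := (phi \o param c : rV -> R^o) \o fst.

Lemma smooth_energy c z : atlas S c -> slit c z -> smooth_at (energy (L c)) z.
Proof.
move=> ac sz; have sL : smooth_at (L c) z.
  apply: (smooth_onP _ (@open_slit _ _ _ c)).1 => //; exact: finsler_smooth.
have H := smooth_atM sL sL.
by apply: near_eq_smooth_at H; near=> y; rewrite /energy expr2.
Unshelve. all: by end_near. Qed.

Lemma local_fun_homogeneous c z (a : R) : atlas S c -> target c z.1 -> 0 < a ->
  L c (z.1, a *: z.2) = a * L c z.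
Proof.
move=> ac cz a0; rewrite /L /local_fun -finsler_homogeneous //; congr (F _ _).
have dT : differentiable (mapT id c (chart_at S (param c z.1))) z.1.
  apply: smooth_at_differentiable; apply: (smooth_mapT (smooth_map_id S)) => //.
    exact: chart_at_atlas.
  by split => //; exact: chart_at_source.
by rewrite /= -[LHS]/('D_(a *: z.2) (mapT id c (chart_at S (param c z.1))) z.1) ddE ddZ // -ddE.
Qed.

(** Homogeneity is differentiated at t = 0 along the ray (1 + t) y, where 1 + t is positive for t
    near 0. *)
Lemma euler_energy c z : atlas S c -> slit c z ->
  dd (vert z.2) (energy (L c)) z = 2 * energy (L c) z.
Proof.
move=> ac sz; have cz := sz.1.
have dE := smooth_at_differentiable (smooth_energy ac sz).
pose l (t : R^o) : E := z + t *: vert z.2.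
have line : is_derive (0 : R^o) 1 (fun t : R^o => energy (L c) (z + t *: vert z.2))
    ('D_(vert z.2) (energy (L c)) (z + (0 : R) *: vert z.2)).
  by apply: is_derive_line; rewrite scale0r addr0.
have nE : \forall t \near (0 : R^o), energy (L c) (z + t *: vert z.2) =
    (1 + t) * (1 + t) * energy (L c) z.
  near=> t.
  have t0 : 0 < 1 + t.
    have : - 1 < t by near: t; apply: lt_nbhsr; rewrite oppr_lt0.
    by rewrite -subr_gt0 opprK addrC.
  have -> : z + t *: vert z.2 = (z.1, (1 + t) *: z.2).
    by rewrite {1}(horz_vert z) -vertZ /horz /vert !pairD addr0 add0r addr0 scalerDl scale1r.
  by rewrite /energy local_fun_homogeneous // exprMn expr2.
have d1 : differentiable (fun t : R^o => 1 + t : R^o) (0 : R^o).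
  apply: smooth_at_differentiable; apply: smooth_atD; first exact: smooth_at_cst.
  exact: smooth_at_id.
have D1 : dd (1 : R^o) (fun t : R^o => 1 + t : R^o) (0 : R^o) = 1.
  rewrite (@dd_add _ _ (cst 1) id) -?[dd _ (cst _) _]ddE -?[dd _ id _]ddE.
  - by rewrite derive_cst derive_id add0r.
  - exact: differentiable_cst.
  - exact/smooth_at_differentiable/smooth_at_id.
have := @derive_val _ _ _ _ _ _ _ line; rewrite scale0r addr0 -ddE => <-.
rewrite ddE (near_eq_dd _ nE).
rewrite (@dd_mul _ _ (fun t : R^o => (1 + t) * (1 + t) : R^o) (cst (energy (L c) z))); last 2 first.
- exact: (differentiableM d1 d1).
- exact: differentiable_cst.
rewrite -[dd _ (cst _) _]ddE derive_cst mulr0 add0r (dd_mul _ d1 d1) D1 addr0 !mulr1.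
by rewrite mulrC.
Unshelve. all: by end_near. Qed.

Definition mobius_exponent phi := forall c z, atlas S c -> slit c z ->
  mobius_at (energy (L c)) (expression phi c) z.

Lemma schwarzian_eq0P phi : smooth_fun S phi ->
  schwarzian_eq0 F phi <-> mobius_exponent phi.
Proof.
move=> ps; have psis c : atlas S c -> forall z, slit c z -> smooth_at (phi \o param c : rV -> R^o) z.1.
  by move=> ac z [cz _]; exact: (smooth_fun_at ps).
split=> [S0 c z ac sz|mob X Xs c z ac sz].
  apply: (@schwarzian_mobius _ _ (L c) (phi \o param c) (slit c)) => //.
  - exact: open_slit.
  - by move=> y [].
  - by move=> y; exact: smooth_energy.
  - by move=> y sy u u0; exact: (finsler_convex F ac sy u0).
  - by move=> y; exact: euler_energy.
  - exact: psis.
  move=> y sy xi; have [X Xs <-] := exists_smooth_field (S := S) xi ac sy.1.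
  exact: S0.
apply: (@mobius_schwarzian _ _ (L c) (phi \o param c) (slit c)) => //.
- exact: open_slit.
- by move=> y [].
- by move=> y; exact: smooth_energy.
- by move=> y sy u u0; exact: (finsler_convex F ac sy u0).
- by move=> y; exact: euler_energy.
- exact: psis.
exact: mob.
Qed.

Lemma local_fun_change (f : M -> M) phi c c' z :
  smooth_map S f -> atlas S c -> atlas S c' -> in_charts f c c' z.1 ->
  (forall p v, F (f p) (tangent_map S f p v) = expR (phi p) * F p v) ->
  L c' (tlift (mapT f c c') z) = expR (phi (param c z.1)) * L c z.
Proof.
move=> fs ac ac' i1 fF; rewrite /L /local_fun.
set p := param c z.1; set q := chart_at S p.
have sp : source c' (f p) by case: i1.
have cz : target c z.1 by case: i1.
have -> : param c' (tlift (mapT f c c') z).1 = f p by exact: coordsKp.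
set q' := chart_at S (f p).
have aq : atlas S q by exact: chart_at_atlas.
have aq' : atlas S q' by exact: chart_at_atlas.
have sq : source q p by exact: chart_at_source.
have sq' : source q' (f p) by exact: chart_at_source.
have idm := smooth_map_id S.
rewrite !ttransitionE -(tlift_mapT_comp (S := S) (f := id) (g := f)) // -fF tangent_mapE.
have -> : (coords q p, (tlift (mapT id c q) z).2) = tlift (mapT id c q) z by [].
by rewrite -(tlift_mapT_comp (S := S) (f := f) (g := id)).
Qed.

Lemma energy_change (f : M -> M) phi c c' z :
  smooth_map S f -> atlas S c -> atlas S c' -> in_charts f c c' z.1 ->
  (forall p v, F (f p) (tangent_map S f p v) = expR (phi p) * F p v) ->
  energy (L c') (tlift (mapT f c c') z) = expR (2 * phi (param c z.1)) * energy (L c) z.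
Proof.
move=> fs ac ac' i1 fF; rewrite /energy (local_fun_change fs ac ac' i1 fF) exprMn.
by rewrite expRM_natl.
Qed.

Lemma tangent_map_id p v : tangent_map S id p v = v.
Proof.
rewrite tangent_mapE tlift_mapT_id //.
exact/coords_target/chart_at_source.
Qed.

Lemma tangent_map_comp (f g : M -> M) p v : smooth_map S f -> smooth_map S g ->
  tangent_map S (f \o g) p v = tangent_map S f (g p) (tangent_map S g p v).
Proof.
move=> fs gs; rewrite !tangent_mapE.
set q := chart_at S p; set q' := chart_at S (g p); set q'' := chart_at S (f (g p)).
have sq : source q p by exact: chart_at_source.
have sq' : source q' (g p) by exact: chart_at_source.
have sq'' : source q'' (f (g p)) by exact: chart_at_source.
have -> : (coords q' (g p), (tlift (mapT g q q') (coords q p, v)).2) =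
    tlift (mapT g q q') (coords q p, v).
  by rewrite [RHS]surjective_pairing /= /mapT /= coordsKp.
rewrite -(tlift_mapT_comp (S := S) (f := f) (g := g)) //; try exact: chart_at_atlas.
- by split; [exact: coords_target|rewrite /= coordsKp].
- by rewrite /= coordsKp.
Qed.

Lemma conformal_id : conformal_with F (selfbij_one : selfbij M) (fun=> 0).
Proof.
split; first by split; exact: smooth_map_id.
  move=> c ac; apply/smooth_onP; first exact: target_open.
  by move=> x _; exact: (smooth_at_cst (0 : R^o)).
by move=> p v; rewrite tangent_map_id expR0 mul1r.
Qed.

Lemma conformal_mul f g phi psi : conformal_with F f phi -> conformal_with F g psi ->
  conformal_with F (selfbij_mul f g) (fun p => phi (g p) + psi p).
Proof.
move=> [[fs fs'] ps fF] [[gs gs'] qs gF]; split.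
- by split; exact: smooth_map_comp.
- have H := smooth_fun_comp ps gs.
  move=> c ac; apply/smooth_onP; first exact: target_open.
  move=> x cx; apply: smooth_atD; first exact: (smooth_fun_at H).
  exact: (smooth_fun_at qs).
- move=> p v; rewrite [fwd _]/= tangent_map_comp // fF gF mulrA -expRD.
  by [].
Qed.

Lemma conformal_inv f phi : conformal_with F f phi ->
  conformal_with F (selfbij_inv f) (fun p => - phi (bwd f p)).
Proof.
move=> [[fs fs'] ps fF]; split.
- by split.
- have H := smooth_fun_comp ps fs'.
  move=> c ac; apply/smooth_onP; first exact: target_open.
  by move=> x cx; apply: smooth_atN; exact: (smooth_fun_at H).
- move=> p v /=; have := fF (bwd f p) (tangent_map S (bwd f) p v).
  rewrite -tangent_map_comp // bwdK.
  have -> : fwd f \o bwd f = id by apply/funext => y /=; rewrite bwdK.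
  by rewrite tangent_map_id => ->; rewrite mulrA -expRD addNr expR0 mul1r.
Qed.

Lemma near_slit c z : atlas S c -> slit c z -> forall phi, smooth_fun S phi ->
  \forall y \near z, [/\ smooth_at (energy (L c)) y, smooth_at (expression phi c) y &
     forall u, dd (vert u) (expression phi c) y = 0].
Proof.
move=> ac sz phi ps.
have : \forall y \near z, slit c y by apply: open_nbhs_nbhs; split => //; exact: open_slit.
apply: filterS => y sy; have sP := smooth_fun_at ps ac sy.1.
split; first exact: smooth_energy.
  exact: (smooth_comp_fst real_frame).
by move=> u; rewrite dd_comp_fst ?dd0 //; exact: smooth_at_differentiable.
Qed.

Lemma tlift_mapT_inv f c c' z : smooth_map S (fwd f) -> smooth_map S (bwd f) ->
  atlas S c -> atlas S c' -> in_charts (fwd f) c c' z.1 ->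
  tlift (mapT (bwd f) c' c) (tlift (mapT (fwd f) c c') z) = z.
Proof.
move=> fs fs' ac ac' i1.
rewrite -(tlift_mapT_comp (S := S) (f := bwd f) (g := fwd f)) //; last first.
  by rewrite fwdK; exact: param_source i1.1.
have -> : bwd f \o fwd f = id by apply/funext => y /=; rewrite fwdK.
exact: tlift_mapT_id i1.1.
Qed.

Lemma slit_change f c c' z : smooth_map S (fwd f) -> smooth_map S (bwd f) ->
  atlas S c -> atlas S c' -> in_charts (fwd f) c c' z.1 -> slit c z ->
  slit c' (tlift (mapT (fwd f) c c') z).
Proof.
move=> fs fs' ac ac' i1 [cz z0]; split; first exact/coords_target/i1.2.
apply: contraNneq z0 => h.
have -> : z.2 = 'D_((tlift (mapT (fwd f) c c') z).2) (mapT (bwd f) c' c)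
    (tlift (mapT (fwd f) c c') z).1 by rewrite -{1}(tlift_mapT_inv fs fs' ac ac' i1).
by rewrite h derive0.
Qed.

Lemma near_tlift_charts (f : selfbij M) c c' z :
  smooth_map S (fwd f) -> smooth_map S (bwd f) -> atlas S c -> atlas S c' ->
  in_charts (fwd f) c c' z.1 ->
  (\forall y \near z, [/\ smooth_at (mapT (fwd f) c c') y.1,
     smooth_at (mapT (bwd f) c' c) (mapT (fwd f) c c' y.1) &
     mapT (bwd f) c' c (mapT (fwd f) c c' y.1) = y.1]) /\
  (\forall x \near mapT (fwd f) c c' z.1, mapT (fwd f) c c' (mapT (bwd f) c' c x) = x).
Proof.
move=> fs fs' ac ac' i1; split.
  apply: filterS (near_fst (near_in_charts fs.1 i1)) => y iy.
  have [cy sy] := iy.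
  have iy' : in_charts (bwd f) c' c (mapT (fwd f) c c' y.1).
    by apply: (in_charts_comp iy); rewrite fwdK; exact: param_source.
  split; [exact: (smooth_mapT fs ac ac' iy)|exact: (smooth_mapT fs' ac' ac iy')|].
  by rewrite -mapT_comp // /mapT /= fwdK paramKx.
have i2 : in_charts (bwd f) c' c (mapT (fwd f) c c' z.1).
  by apply: (in_charts_comp i1); rewrite fwdK; exact: param_source i1.1.
apply: filterS (near_in_charts fs'.1 i2) => x [cx sx].
by rewrite -mapT_comp // /mapT /= bwdK paramKx.
Qed.

(* The metric here is the pullback f^*F = e^phi F. *)
Lemma mobius_pull (f : selfbij M) phi psi c z :
  conformal_with F f phi -> smooth_fun S psi -> mobius_exponent psi ->
  atlas S c -> slit c z ->
  mobius_at (fun y => expR (2 * expression phi c y) * energy (L c) y)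
    (expression (psi \o fwd f) c) z.
Proof.
move=> [[fs fs'] ps fF] qs mob ac sz.
pose c' := chart_at S (f (param c z.1)).
have ac' : atlas S c' by exact: chart_at_atlas.
have i1 : in_charts (fwd f) c c' z.1 by split; [case: sz|exact: chart_at_source].
have [N1 N2] := near_tlift_charts fs fs' ac ac' i1.
have sl := slit_change fs fs' ac ac' i1 sz.
have H := mobius_change N1 N2 (near_slit ac' sl qs) (mob _ _ ac' sl).
have nc := near_fst (near_in_charts fs.1 i1).
apply: near_eq_mobius H.
  apply: filterS nc => y iy; exact: energy_change.
by apply: filterS nc => y [cy sy]; rewrite /expression /= /mapT /= coordsKp.
Qed.

(** The conformal rule read backwards. Applied to the constant 0, it shows that -Phi solves the
    equation for e^{2 Phi} En; applied again to -Phi and Chi over this energy, it yields Chi + Phi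
    over e^{-2 Phi} e^{2 Phi} En = En. *)
Lemma mobius_add (En Phi Chi : E -> R^o) z :
  (\forall y \near z, [/\ smooth_at En y, smooth_at Phi y &
     forall u, dd (vert u) Phi y = 0]) ->
  (\forall y \near z, smooth_at Chi y) ->
  mobius_at En Phi z -> mobius_at (fun y => expR (2 * Phi y) * En y) Chi z ->
  mobius_at En (fun y => Chi y + Phi y) z.
Proof.
move=> H HC m1 m2.
have sN y : smooth_at Phi y -> smooth_at (fun t => 0 - Phi t : R^o) y.
  by move=> sP; apply: smooth_atD; [exact: smooth_at_cst|exact: smooth_atN].
have H1 : \forall y \near z, [/\ smooth_at En y, smooth_at Phi y,
    smooth_at (cst 0 : E -> R^o) y & forall u, dd (vert u) Phi y = 0].
  by apply: filterS H => y [sE sP vP]; split=> //; exact: smooth_at_cst.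
have m3 := mobius_conformal H1 m1 (mobius_cst En 0 z).
have H2 : \forall y \near z, [/\ smooth_at (fun t => expR (2 * Phi t) * En t : R^o) y,
    smooth_at (fun t => 0 - Phi t : R^o) y, smooth_at Chi y &
    forall u, dd (vert u) (fun t => 0 - Phi t : R^o) y = 0].
  apply: filterS2 H HC => y [sE sP vP] sC; split=> //; last first.
  - move=> u; rewrite (@dd_sub _ _ (cst 0) Phi); last 2 first.
    + exact: differentiable_cst.
    + exact: smooth_at_differentiable.
    by rewrite vP -ddE derive_cst subr0.
  - exact: sN.
  apply: smooth_atM => //; apply: smooth_at_expR; apply: smooth_atM => //.
  exact: smooth_at_cst.
have m4 := mobius_conformal H2 m3 m2.
apply: near_eq_mobius m4; near=> y; last by rewrite sub0r opprK.
by rewrite sub0r mulrA -expRD mulrN addNr expR0 mul1r.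
Unshelve. all: by end_near. Qed.

(** The pullback of [phi] by [g] solves the equation for g^*F = e^psi F, by [mobius_pull]; adding
    [psi] returns to F. *)
Lemma mobius_exponent_mul f g phi psi :
  conformal_with F f phi -> conformal_with F g psi ->
  mobius_exponent phi -> mobius_exponent psi ->
  mobius_exponent (fun p => phi (g p) + psi p).
Proof.
move=> cf cg mf mg c z ac sz; have [_ ps _] := cf; have [[gs _] qs _] := cg.
have H1 := near_slit ac sz qs.
have H2 := near_slit ac sz (smooth_fun_comp ps gs).
have H2' : \forall y \near z, smooth_at (expression (phi \o fwd g) c) y.
  by apply: filterS H2 => y [].
exact: (mobius_add H1 H2' (mg c z ac sz) (mobius_pull cg ps mf ac sz)).
Qed.

(** By the conformal rule with the constant 0, -phi solves the equation for e^phi F = f^*F.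
    Transport along the inverse of [f] turns this metric back into F. *)
Lemma mobius_exponent_inv f phi : conformal_with F f phi -> mobius_exponent phi ->
  mobius_exponent (fun p => - phi (bwd f p)).
Proof.
move=> [[fs fs'] ps fF] mf c z ac sz.
pose c' := chart_at S (bwd f (param c z.1)).
have ac' : atlas S c' by exact: chart_at_atlas.
have i1 : in_charts (bwd f) c c' z.1 by split; [case: sz|exact: chart_at_source].
have [N1 N2] := near_tlift_charts (f := selfbij_inv f) fs' fs ac ac' i1.
have sl := slit_change (f := selfbij_inv f) fs' fs ac ac' i1 sz.
have NS := near_slit ac' sl ps.
have H1 : \forall y \near tlift (mapT (bwd f) c c') z, [/\ smooth_at (energy (L c')) y,
    smooth_at (expression phi c') y, smooth_at (cst 0 : E -> R^o) y &
    forall u, dd (vert u) (expression phi c') y = 0].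
  by apply: filterS NS => y [sE sP vP]; split=> //; exact: smooth_at_cst.
have m := mobius_conformal H1 (mf _ _ ac' sl) (mobius_cst _ 0 _).
have NS' : \forall y \near tlift (mapT (bwd f) c c') z,
   [/\ smooth_at (fun t => expR (2 * expression phi c' t) * energy (L c') t : R^o) y,
    smooth_at (fun t => 0 - expression phi c' t : R^o) y &
    forall u, dd (vert u) (fun t => 0 - expression phi c' t : R^o) y = 0].
  apply: filterS NS => y [sE sP vP]; split.
  - apply: smooth_atM => //; apply: smooth_at_expR; apply: smooth_atM => //.
    exact: smooth_at_cst.
  - by apply: smooth_atD; [exact: smooth_at_cst|exact: smooth_atN].
  - move=> u; rewrite (@dd_sub _ _ (cst 0) (expression phi c')); last 2 first.
    + exact: differentiable_cst.
    + exact: smooth_at_differentiable.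
    by rewrite vP -ddE derive_cst subr0.
have H := mobius_change N1 N2 NS' m.
have nc := near_fst (near_in_charts fs'.1 i1).
apply: near_eq_mobius H; last first.
  by apply: filterS nc => y [cy sy]; rewrite /expression /= /mapT /= coordsKp // sub0r.
apply: filterS nc => y iy /=.
have iy' : in_charts (fwd f) c' c (tlift (mapT (bwd f) c c') y).1.
  by apply: (in_charts_comp iy); rewrite bwdK; exact: param_source iy.1.
rewrite -(energy_change fs ac' ac iy' fF).
by rewrite (tlift_mapT_inv (f := selfbij_inv f) fs' fs ac ac' iy).
Qed.

Lemma homothety_mobius_exponent phi : (forall p q, phi p = phi q) -> mobius_exponent phi.
Proof.
move=> pc c z ac sz; have -> : expression phi c = cst (phi (param c z.1)).
  by apply/funext => y; exact: pc.
exact: mobius_cst.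
Qed.

Lemma group_closedMV (G : groupType) (A : {pred G}) : (1%g \in A) ->
  (forall x y, x \in A -> y \in A -> (x * y)%g \in A) ->
  (forall x, x \in A -> (x^-1)%g \in A) -> group_closed A.
Proof. by move=> A1 AM AV; split=> // x y xA yA; apply: AM => //; exact: AV. Qed.

End Transformations.

Theorem theorem1p1 (R : realType) (n : nat) (M : topologicalType)
    (S : manifold R n M) (F : finsler S) :
  [/\ group_closed (conformal_transformations F),
      group_closed (mobius_transformations F),
      {subset mobius_transformations F <= conformal_transformations F},
      group_closed (homotheties F) &
      {subset homotheties F <= mobius_transformations F}].
Proof.
have mobE f : f \in mobius_transformations F <->
    exists2 phi, conformal_with F f phi & mobius_exponent F phi.
  split=> [/asboolP[phi cf]|[phi cf]]; have [_ ps _] := cf.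
    by move/(schwarzian_eq0P F ps) => mf; exists phi.
  by move=> mf; apply/asboolP; exists phi => //; exact/(schwarzian_eq0P F ps).
have confE f : f \in conformal_transformations F <-> exists phi, conformal_with F f phi.
  by split=> /asboolP.
have homE f : f \in homotheties F <->
    exists2 phi, conformal_with F f phi & forall p q, phi p = phi q.
  by split=> /asboolP.
split.
- apply: group_closedMV.
  + by apply/confE; exists (fun=> 0); exact: conformal_id.
  + move=> f g /confE[phi cf] /confE[psi cg]; apply/confE.
    by exists (fun p => phi (g p) + psi p); exact: conformal_mul.
  + move=> f /confE[phi cf]; apply/confE.
    by exists (fun p => - phi (bwd f p)); exact: conformal_inv.
- apply: group_closedMV.
  + apply/mobE; exists (fun=> 0); first exact: conformal_id.
    exact: homothety_mobius_exponent.
  + move=> f g /mobE[phi cf mf] /mobE[psi cg mg]; apply/mobE.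
    exists (fun p => phi (g p) + psi p); first exact: conformal_mul.
    exact: (mobius_exponent_mul cf cg).
  + move=> f /mobE[phi cf mf]; apply/mobE.
    exists (fun p => - phi (bwd f p)); first exact: conformal_inv.
    exact: mobius_exponent_inv cf mf.
- by move=> f /mobE[phi cf _]; apply/confE; exists phi.
- apply: group_closedMV.
  + by apply/homE; exists (fun=> 0) => //; exact: conformal_id.
  + move=> f g /homE[phi cf kf] /homE[psi cg kg]; apply/homE.
    exists (fun p => phi (g p) + psi p); first exact: conformal_mul.
    by move=> p q; rewrite (kf (g p) (g q)) (kg p q).
  + move=> f /homE[phi cf kf]; apply/homE.
    exists (fun p => - phi (bwd f p)); first exact: conformal_inv.
    by move=> p q; rewrite (kf (bwd f p) (bwd f q)).
- move=> f /homE[phi cf kf]; apply/mobE; exists phi => //.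
  exact: homothety_mobius_exponent.
Qed.
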